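(* Let $\mathcal P$ be a set of primes with positive density $\delta>0$, satisfying the Siegel--Walfisz condition with squarefree modulus $B$, and having a positive level of distribution (as in the context). Fix an integer $r\ge2$, a real $\eta$ with $0<\eta<1/r$, and a small $\epsilon>0$. Then for every $u\in\mathbb R$ and $A>0$, $$\sum_{\substack{q\le N^{u(\frac12-\epsilon)}\\(q,B)=1}}\max_{(a,q)=1}\left|\sum_{n<N^u}\left(\frac{1}{\phi(q)}\beta_r(n;q)-\beta_r(n;q,a)\right)\right|\ll\frac{N^u}{(\log N)^A}$$ as $N\to\infty$, where the implied constant depends only on $u$ and $A$.
   Context: Density: $\#\{p\in\mathcal P:p\le x\}=(1+o(1))\delta x/\log x$. Siegel--Walfisz: there is a squarefree positive integer $B$ such that for $(q,B)=1$, $(a,q)=1$ and every $A>0$, $|\pi_{\mathcal P}(x;q,a)-\pi_{\mathcal P}(x)/\phi(q)|\ll x/(\log x)^A$. Level of distribution $\theta_1>0$: for every $A>0$, $\sum_{q<x^{\theta_1},(q,B)=1}\max_{(a,q)=1}|\pi_{\mathcal P}(x;q,a)-\pi_{\mathcal P}(x)/\phi(q)|\ll x/(\log x)^A$; here $\pi_{\mathcal P}(x;q,a)$ counts primes of $\mathcal P$ up to $x$ that are $\equiv a\pmod q$. For a parameter $N$, $\beta_r$ is the indicator function of $E_r=\{p_1\cdots p_r: p_i\in\mathcal P,\ N^\eta\le p_1<\cdots<p_r,\ N^{1/2}\le p_r\}$; $\beta_r(n;q,a)=\beta_r(n)$ if $n\equiv a\pmod q$ and $0$ otherwise; $\beta_r(n;q)=\beta_r(n)$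 if $(n,q)=1$ and $0$ otherwise. *)

(* Defs.v *)
From mathcomp Require Export all_boot all_order all_algebra.
From mathcomp Require Export all_classical all_reals all_analysis.
Export Order.TTheory GRing.Theory Num.Theory.
Export numFieldNormedType.Exports.

Set Implicit Arguments.
Unset Strict Implicit.
Unset Printing Implicit Defensive.

Local Open Scope classical_set_scope.
Local Open Scope ring_scope.

Definition squarefree (m : nat) : Prop :=
  forall d : nat, (d ^ 2 %| m)%N -> d = 1%N.

(* In the bounded sums below, [Num.truncn y] only makes the index range finite;
   the real inequality in the filter is the actual constraint. *)

Section PrimeSets.
Context {R : realType}.
Implicit Types (P : set nat) (B q a : nat) (x : R).

Definition primeCount P x : R :=
  \sum_(0 <= p < (Num.truncn x).+1 | (p%:R <= x) && (p \in P)) 1.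

Definition primeCountAP P x q a : R :=
  \sum_(0 <= p < (Num.truncn x).+1
     | [&& p%:R <= x, p \in P & p == a %[mod q]]) 1.

Definition hasPrimeDensity P (delta : R) : Prop :=
  exists2 e : R -> R, e x @[x --> +oo_R] --> (0 : R)
    & \forall x \near +oo_R,
        primeCount P x = (1 + e x) * (delta * x / ln x).

(* The implied constant depends on A, but is uniform in q and a. *)
Definition siegelWalfisz P B : Prop :=
  forall A : R, 0 < A -> exists C : R, \forall x \near +oo_R,
    forall q a : nat, (0 < q)%N -> coprime q B -> coprime a q ->
      `|primeCountAP P x q a - primeCount P x / (totient q)%:R|
        <= C * (x / ln x `^ A).

Definition levelOfDistribution P B (theta : R) : Prop :=
  forall A : R, 0 < A -> exists C : R, \forall x \near +oo_R,
    \sum_(1 <= q < (Num.truncn (x `^ theta)).+1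
        | (q%:R < x `^ theta) && coprime q B)
      \big[Num.max/0]_(a < q | coprime a q)
        `|primeCountAP P x q a - primeCount P x / (totient q)%:R|
    <= C * (x / ln x `^ A).

End PrimeSets.

Section AlmostPrimes.
Context {R : realType}.
Variables (P : set nat) (r : nat) (eta N : R).

(* The defaults of [head] and [last] are irrelevant for r > 0. *)
Definition almostPrimes : set nat :=
  [set n | exists p : r.-tuple nat,
    [/\ forall i : 'I_r, P (tnth p i),
        sorted ltn p,
        N `^ eta <= (head 0%N p)%:R,
        N `^ (1 / 2) <= (last 0%N p)%:R
      & n = (\prod_(i < r) tnth p i)%N]].

Definition beta (n : nat) : R := \1_almostPrimes n.

Definition betaAP (n q a : nat) : R :=
  if n == a %[mod q] then beta n else 0.

Definition betaCoprime (n q : nat) : R :=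
  if coprime n q then beta n else 0.

End AlmostPrimes.

(* Main.v *)
Require Import Defs.
From mathcomp Require Import cyclic ring lra zify.

(** A sum of the bilinear shape [sum_(m n = a mod q) al m * be n], minus its
    expected value, splits over the divisors [d > 1] of [q] into the parts
    carried by the characters of conductor [d].  By Cauchy-Schwarz the part of
    conductor [d] is at most the product of the norms of the projections of
    [al] and [be] to the span of the primitive characters mod [d], whatever [a]
    is.  For small [d] Siegel-Walfisz bounds the projection of the indicator of
    the primes; for large [d] the large sieve bounds both projections on
    average.  This is the method of Motohashi and of Bombieri, Friedlander and
    Iwaniec; here the primitive characters appear only through their
    reproducing kernel [sum_(chi primitive mod d) chi(x) * conj(chi(y))], an
    integer-valued function obtained by inversion over divisors from the
    kernels [phi(d) * [x = y mod d]], so that everything is real.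

    To reach bilinear sums, [beta_r] is written as the indicator of squarefree
    products of [r] primes of [P] that are [>= N^eta], minus the indicator of
    those with all primes [< N^(1/2)].  Marking one prime factor [p] of
    [n = m * p] yields, up to terms with [p^2 | n], a convolution with the
    indicator of primes; the constraint [m * p < N^u] is separated by cutting
    the range of [p] into intervals of ratio [exp(1/T)]. *)

Set Implicit Arguments.
Unset Strict Implicit.
Unset Printing Implicit Defensive.
Local Open Scope ring_scope.

(** * The kernel of primitive characters *)

(** Write [q = d * e] with [d] the conductor. Since [phi(q) >= phi(d) * phi(e)], the kernel mod [d]
    absorbs [phi(d)], and the sum of [1 / phi(e)] costs only logarithms; the price is that both
    coefficients are restricted to arguments coprime to [e]. For [d] of size [D] and coefficients of
    lengths [M], [Y] with [M * Y] at most about [x = N^u], the large sieve yields, up to logarithms,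
    [sqrt (M * Y * (M + D^2) * (Y + D^2)) / D]. This beats [x] by a power of [ln x] once [D] exceeds
    such a power, [D^2] stays below [x] by such a power, and neither [M] nor [Y] is too short. The
    first condition leaves only small [d] to Siegel-Walfisz; the second is the range of [q]; the
    third is where [N^eta] and [r >= 2] enter, since the cofactor of the marked prime then still
    contains a prime that is at least [N^eta]. The condition [p_r >= N^(1/2)] singles out the
    largest prime and would obstruct marking; the two indicators whose difference is [beta_r] are
    symmetric in the primes, so marking counts each product equally often. *)

Lemma modn_lin_solve (d b s x : nat) : (0 < d)%N -> coprime b d ->
  exists t0 : 'I_d, forall t : 'I_d,
    (s + t * b == x %[mod d]) = (t == t0).
Proof.
move=> d0 cbd.
pose f (t : 'I_d) : 'I_d := Ordinal (ltn_pmod (s + t * b) d0).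
have finj : injective f.
  move=> t t' /(congr1 val) /= /eqP.
  rewrite eqn_modDl.
  wlog le : t t' / (t' <= t)%N.
    move=> H; case: (leqP t' t) => [|/ltnW] le; first exact: H.
    by rewrite eq_sym => /(H _ _ le).
  rewrite eqn_mod_dvd ?leq_mul2r ?le ?orbT// -mulnBl Gauss_dvdl 1?coprime_sym//.
  rewrite -eqn_mod_dvd// !modn_small// => /eqP e; exact: val_inj.
have [g fg gf] := injF_bij finj.
exists (g (Ordinal (ltn_pmod x d0))) => t.
by rewrite -(inj_eq finj) gf -val_eqE.
Qed.

Lemma totient_prime_mul (p n : nat) : prime p -> (0 < n)%N ->
  totient (p * n) = ((if p %| n then p else p.-1) * totient n)%N.
Proof.
move=> pp n0; case: ifPn => [pn|npn]; last first.
  by rewrite totient_coprime ?prime_coprime// totient_prime.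
have [p0 k0] : (0 < p)%N /\ (0 < logn p n)%N by rewrite prime_gt0// logn_gt0 mem_primes pp n0.
have e : n = (p ^ logn p n * n`_p^')%N.
  by rewrite -p_part partnC.
set m := (n`_p^')%N in e; set k := logn p n in e k0.
have cm j : coprime (p ^ j) m.
  by apply: coprimeXl; rewrite -[in coprime p _](part_pnat_id (pnat_id pp)); exact: coprime_partC.
rewrite e mulnA -expnS !totient_coprime// !totient_pfactor//.
by rewrite mulnA; congr (_ * _)%N; case: k k0 {e} => // k _ /=; rewrite expnS mulnCA.
Qed.

Lemma sum_nat_fibers (V : nmodType) (p e : nat) (F : nat -> V) :
  \sum_(y < p * e) F y = \sum_(c < e) \sum_(t < p) F (c + t * e)%N.
Proof.
rewrite exchange_big /= -(big_mkord xpredT F) big_nat_mul big_mkord.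
apply: eq_bigr => t _; rewrite mulSnr.
rewrite -{1}[(t * e)%N]add0n big_addn addnC addnK big_mkord.
by apply: eq_bigr.
Qed.

Section Kernel.
Variable R : comNzRingType.
Implicit Types (n d e p q x y a c : nat).

Definition residueKernel d x y : R :=
  if x == y %[mod d] then (totient d)%:R else 0.

(** Each character mod [d] is induced by exactly one primitive character, of conductor dividing [d].
    Removing the proper divisors from [residueKernel d], the sum over all characters, therefore
    leaves the primitive part. The fuel [n] only serves termination: for [d > 0] any [n >= d] gives
    the same value. *)
Fixpoint primKernelRec (n d x y : nat) {struct n} : R :=
  if n is n'.+1 then
    residueKernel d x y - \sum_(e < d | (e %| d)%N) primKernelRec n' e x y
  else 0.

(* On units [x], [y] of Z/d this is the sum of chi(x) * conj(chi(y)) over the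
   primitive characters chi mod d. *)
Definition primKernel d x y := primKernelRec d d x y.

Lemma primKernelRec_fuel n d x y : (0 < d)%N -> (d <= n)%N ->
  primKernelRec n d x y = primKernel d x y.
Proof.
rewrite /primKernel; have [m] := ubnP d.
elim: m n d => // m IH n d dm d0 dn.
case: n dn => [|n] dn; first by rewrite leqNgt d0 in dn.
case: d d0 dm dn => // d _ dm dn /=; congr (_ - _).
apply: eq_bigr => e ed.
have e0 : (0 < e)%N by case: (posnP e) ed => [->|]; rewrite ?dvd0n.
by rewrite !IH//; have := ltn_ord e; lia.
Qed.

Lemma sum_primKernel d x y : (0 < d)%N ->
  \sum_(e < d.+1 | (e %| d)%N) primKernel e x y = residueKernel d x y.
Proof.
move=> d0; rewrite big_mkcond big_ord_recr /= dvdnn -big_mkcond /=.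
rewrite {2}/primKernel; case: d d0 => // d _ /=.
rewrite addrC -[RHS]addr0 -addrA; congr (_ + _); apply/eqP.
rewrite addrC subr_eq0; apply/eqP; apply: eq_bigr => e ed.
rewrite primKernelRec_fuel//; last by have := ltn_ord e; lia.
by case: (posnP e) ed => [->|]; rewrite ?dvd0n.
Qed.

Lemma primKernelE d x y : (0 < d)%N ->
  primKernel d x y =
  residueKernel d x y - \sum_(e < d | (e %| d)%N) primKernel e x y.
Proof.
move=> d0; rewrite -sum_primKernel// [X in _ = X - _]big_mkcond big_ord_recr /=.
rewrite dvdnn -big_mkcond /=. by rewrite addrAC subrr add0r.
Qed.

(** The kernel sees a pair only through the divisors of [d] modulo which its members agree.
    Periodicity, symmetry and invariance under multiplication by a unit are all read off from
    this. *)
Lemma primKernel_eq d x y x' y' : (0 < d)%N ->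
  (forall e, (e %| d)%N -> (x == y %[mod e]) = (x' == y' %[mod e])) ->
  primKernel d x y = primKernel d x' y'.
Proof.
have [m] := ubnP d; elim: m d => // m IH d dm d0 H.
rewrite !primKernelE// /residueKernel H//; congr (_ - _).
apply: eq_bigr => e ed; apply: IH.
- by have := ltn_ord e; lia.
- by case: (posnP e) ed => [->|]; rewrite ?dvd0n//; lia.
- by move=> f fe; apply: H; exact: dvdn_trans fe ed.
Qed.

Lemma eqmod_dvd d e x y : (e %| d)%N -> x = y %[mod d] -> x = y %[mod e].
Proof. by move=> ed h; rewrite -(modn_dvdm x ed) h modn_dvdm. Qed.

Lemma primKernel_mod d x y x' y' : (0 < d)%N ->
  x = x' %[mod d] -> y = y' %[mod d] ->
  primKernel d x y = primKernel d x' y'.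
Proof.
move=> d0 hx hy; apply: primKernel_eq => // e ed.
by rewrite (eqmod_dvd ed hx) (eqmod_dvd ed hy).
Qed.

Lemma primKernel_sym d x y : (0 < d)%N -> primKernel d x y = primKernel d y x.
Proof. by move=> d0; apply: primKernel_eq => // e _; rewrite eq_sym. Qed.

Lemma eqn_modMr_coprime z d x y : coprime z d ->
  (x * z == y * z %[mod d]) = (x == y %[mod d]).
Proof.
move=> zd; wlog le : x y / (y <= x)%N.
  move=> H; case: (leqP y x) => [|/ltnW] le; first exact: H.
  by rewrite eq_sym H// eq_sym.
by rewrite !eqn_mod_dvd ?leq_mul2r ?le ?orbT// -mulnBl Gauss_dvdl// coprime_sym.
Qed.

Lemma primKernel_scale d x y z : (0 < d)%N -> coprime z d ->
  primKernel d (x * z) (y * z) = primKernel d x y.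
Proof.
move=> d0 zd; apply: primKernel_eq => // e ed.
by apply: eqn_modMr_coprime; exact: coprime_dvdr zd.
Qed.

Lemma primKernel1 x y : primKernel 1 x y = 1.
Proof.
by rewrite primKernelE// big_pred0 ?subr0 => [|[[]//]]; rewrite /residueKernel !modn1 eqxx.
Qed.

(** The congruence mod [g] does not depend on [t]. If it fails, both sides vanish. If it holds,
    exactly one [t] lifts it to a congruence mod [p * g], because [n * h] is invertible mod [p];
    that one term [phi(p g)] balances the terms [phi(g)], since the fibre contains [p] units if [p]
    divides [g] and [p - 1] otherwise. *)
Lemma residueKernel_fiber p g h n a c : prime p -> (0 < g)%N -> (0 < h)%N ->
  ~~ (p %| h)%N -> coprime n (p * (g * h)) -> coprime a (p * (g * h)) ->
  \sum_(t < p | coprime (c + t * (g * h)) (p * (g * h)))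
     residueKernel (p * g) (n * (c + t * (g * h))) a =
  \sum_(t < p | coprime (c + t * (g * h)) (p * (g * h)))
     residueKernel g (n * (c + t * (g * h))) a.
Proof.
move=> pp g0 h0 ph cn ca; set e := (g * h)%N.
have p0 := prime_gt0 pp.
have e0 : (0 < e)%N by rewrite muln_gt0 g0.
have cop t : coprime (c + t * e) (p * e) = coprime (c + t * e) p && coprime c e.
  by rewrite coprimeMr; congr (_ && _); rewrite /coprime -gcdn_modl addnC modnMDl gcdn_modl.
case cce : (coprime c e); last first.
  by rewrite !big_pred0// => t; rewrite cop cce andbF.
have modg t : (n * (c + t * e) == a %[mod g]) = (n * c == a %[mod g]).
  rewrite mulnDr /e -modnDmr.
  have -> : (n * (t * (g * h)) = n * t * h * g)%N by ring.
  by rewrite modnMl addn0.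
rewrite /residueKernel; under [RHS]eq_bigr do rewrite modg.
case: eqVneq => [hg|hg]; last first.
  rewrite [RHS]big1// big1// => t _; rewrite ifF//.
  apply: contra_neqF hg => /eqP /(eqmod_dvd (dvdn_mull p (dvdnn g))) /eqP.
  by rewrite modg => /eqP.
have [cnp cnh] : coprime n p /\ coprime n (g * h).
  by apply/andP; rewrite -coprimeMr.
have [t0 ht0] : exists t0 : 'I_p, forall t : 'I_p,
    (n * (c + t * e) == a %[mod p * g]) = (t == t0).
  (* The multiple [p * g * a] of the modulus is added so that subtracting [a] in [nat] does not
     truncate. *)
  have [w hw] : exists w, (n * c + p * g * a = a + g * w)%N.
    have le : (a <= n * c + p * g * a)%N.
      by apply: leq_trans (leq_addl _ _); rewrite leq_pmull// muln_gt0 p0.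
    have : (g %| n * c + p * g * a - a)%N.
      by rewrite -eqn_mod_dvd// mulnAC addnC modnMDl; apply/eqP.
    by case/dvdnP => w hw; exists w; rewrite [(g * w)%N]mulnC -hw subnKC.
  have cb : coprime (n * h) p.
    by rewrite coprimeMl cnp coprime_sym prime_coprime.
  have [t0 H] := modn_lin_solve w 0 p0 cb.
  exists t0 => t; rewrite -H.
  rewrite -(modnMDl a (n * _)) mod0n eqn_mod_dvd; last first.
    by apply: leq_trans (leq_addr _ _); rewrite leq_pmulr// muln_gt0 p0.
  have -> : (a * (p * g) + n * (c + t * e) - a = g * (w + t * (n * h)))%N.
    by apply/eqP; rewrite eqn_leq; apply/andP; rewrite /e; split; nia.
  by rewrite mulnC dvdn_pmul2l.
have ct0 : coprime (c + t0 * e) (p * e).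
  rewrite cop cce andbT.
  have h1 : n * (c + t0 * e) = a %[mod p].
    apply: (@eqmod_dvd (p * g)); first exact: dvdn_mulr.
    by apply/eqP; rewrite ht0.
  have : coprime (n * (c + t0 * e)) p.
    by rewrite /coprime -gcdn_modl h1 gcdn_modl; move: ca; rewrite coprimeMr => /andP[].
  by rewrite coprimeMl => /andP[].
rewrite (bigD1 t0) //= ht0 eqxx big1 ?addr0; last first.
  by move=> t /andP[_ tt0]; rewrite ht0 (negPf tt0).
rewrite sumr_const totient_prime_mul// natrM mulr_natl; congr (_ *+ _).
rewrite (eq_card (B := [pred t : 'I_p | coprime (c + t * e) p])); last first.
  by move=> t; rewrite !unfold_in -[in RHS](andbT (coprime _ _)) -cce -cop.
have pe : (p %| e)%N = (p %| g)%N by rewrite Euclid_dvdM// (negPf ph) orbF.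
case: ifPn => pg.
  rewrite eq_cardT ?size_enum_ord// => t; rewrite !inE.
  have := cce; move/(coprime_dvdr (m := p)); rewrite pe => /(_ pg).
  rewrite /coprime -[gcdn (_ + _) _]gcdn_modl -modnDmr -modnMmr.
  by move: pg; rewrite -pe /dvdn => /eqP ->; rewrite muln0 mod0n addn0 gcdn_modl.
have cep : coprime e p by rewrite coprime_sym prime_coprime// pe.
have [t1 ht1] := modn_lin_solve c 0 p0 cep.
rewrite (eq_card (B := predC1 t1)); last first.
  by move=> t; rewrite !inE -ht1 coprime_sym prime_coprime// /dvdn mod0n.
by rewrite cardC1 card_ord.
Qed.

(** A character whose conductor does not divide [e] averages to zero over the units in a class mod
    [e]. Here [d = p * g] with [g] dividing [e]. Expanding both sides of [residueKernel_fiber] over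
    divisors and cancelling those of [g] leaves the divisors of [d] that do not divide [g]; all of
    them except [d] vanish by induction, hence so does [d]. *)
Lemma primKernel_fiber p e d n a c : prime p -> (0 < e)%N ->
  coprime n (p * e) -> coprime a (p * e) ->
  (d %| p * e)%N -> ~~ (d %| e)%N ->
  \sum_(t < p | coprime (c + t * e) (p * e))
     primKernel d (n * (c + t * e)) a = 0.
Proof.
move=> pp e0 cn ca.
have [m] := ubnP d; elim: m d => // m IH d dm dpe nde.
have p0 := prime_gt0 pp.
have pd : (p %| d)%N.
  apply: contraNT nde; rewrite -prime_coprime// coprime_sym => cdp.
  by rewrite Gauss_dvdr in dpe.
have [g dE] : exists g, d = (p * g)%N by case/dvdnP: pd => g ->; exists g; rewrite mulnC.
have ge : (g %| e)%N by rewrite dE dvdn_pmul2l in dpe.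
have [h eE] : exists h, e = (g * h)%N by case/dvdnP: ge => h ->; exists h; rewrite mulnC.
have [g0 h0] : (0 < g)%N /\ (0 < h)%N by apply/andP; rewrite -muln_gt0 -eE.
have ph : ~~ (p %| h)%N.
  by apply: contra nde; rewrite dE eE mulnC dvdn_pmul2l.
have d0 : (0 < d)%N by rewrite dE muln_gt0 p0.
have := residueKernel_fiber c pp g0 h0 ph; rewrite -eE -dE => /(_ n a cn ca).
under eq_bigr do rewrite -sum_primKernel//.
under [X in _ = X]eq_bigr do rewrite -sum_primKernel//.
have gd : (g %| d)%N by rewrite dE dvdn_mull.
have -> : \sum_(t < p | coprime (c + t * e) (p * e))
     \sum_(f < g.+1 | (f %| g)%N) primKernel f (n * (c + t * e)) a =
   \sum_(t < p | coprime (c + t * e) (p * e))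
     \sum_(f < d.+1 | (f %| d)%N && (f %| g)%N) primKernel f (n * (c + t * e)) a.
  apply: eq_bigr => t _.
  have le : (g.+1 <= d.+1)%N by rewrite ltnS dvdn_leq.
  rewrite (big_ord_widen_cond _ (fun f => f %| g)%N (fun f => primKernel f (n * (c + t * e)) a) le).
  apply: eq_bigl => f; case fg: (f %| g)%N; rewrite ?andbF//= ltnS dvdn_leq//.
  by rewrite (dvdn_trans fg gd).
under eq_bigr do rewrite (bigID (fun f : 'I__ => (f %| g)%N)) /=.
rewrite big_split /= => /(congr1 (fun z => z - \sum_(t < p | coprime (c + t * e) (p * e))
     \sum_(f < d.+1 | (f %| d)%N && (f %| g)%N) primKernel f (n * (c + t * e)) a)).
rewrite addrAC !subrr add0r exchange_big /= (bigD1 ord_max) /=; last first.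
  by rewrite dvdnn dE; apply/negP => /(dvdn_leq g0); have := prime_gt1 pp; nia.
rewrite [X in _ + X]big1 ?addr0 // => f /andP[/andP[fd nfg] fm].
apply: IH.
- apply: leq_trans (_ : d <= m)%N => //.
  rewrite ltn_neqAle -[(f <= d)%N]ltnS ltn_ord andbT.
  by apply: contra fm => /eqP hf; apply/eqP; exact: val_inj.
- exact: dvdn_trans fd dpe.
(* A divisor of [d] that divides [e] already divides [g], because [p] does not divide
   [h = e / g]. *)
- clear fm; move: (nat_of_ord f) fd nfg => {}f fd; apply: contra => fe.
  have [/dvdnP[f' fE]|npf] := boolP (p %| f)%N; last first.
    by move: fd; rewrite dE Gauss_dvdr// coprime_sym prime_coprime.
  move: fd fe; rewrite fE mulnC dE dvdn_pmul2l// => /dvdnP[g2 gE].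
  have f'0 : (0 < f')%N by move: g0; rewrite gE muln_gt0 => /andP[].
  rewrite eE gE mulnAC dvdn_pmul2r// Euclid_dvdM// (negPf ph) orbF => pg2.
  by rewrite dvdn_pmul2r.
Qed.

(** This orthogonality to functions of smaller period is all that is later retained of primitivity,
    in [primitiveMod]. *)
Lemma primKernel_orth p e n a (H : nat -> R) : prime p -> (0 < e)%N ->
  coprime n (p * e) -> coprime a (p * e) ->
  (forall c t, H (c + t * e)%N = H c) ->
  \sum_(y < p * e | coprime y (p * e)) primKernel (p * e) (n * y) a * H y = 0.
Proof.
move=> pp e0 cn ca Hper; rewrite big_mkcond.
rewrite (sum_nat_fibers p e (fun y => if coprime y (p * e) then
  primKernel (p * e) (n * y) a * H y else 0)) big1// => c _.
rewrite -big_mkcond /=; under eq_bigr do rewrite Hper.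
rewrite -mulr_suml primKernel_fiber ?mul0r//.
by apply/negP => /(dvdn_leq e0); have := prime_gt1 pp; nia.
Qed.

(** In the second factor only [residueKernel d] matters: the kernels of proper divisors of [d] have
    a period [d / p] and are orthogonal to the first factor. The residue kernel then selects
    [y = y0]. *)
Lemma primKernel_reproducing d n n' a a' y0 : (0 < d)%N ->
  coprime n d -> coprime n' d -> coprime a d -> coprime y0 d ->
  n' * y0 = a' %[mod d] ->
  \sum_(y < d | coprime y d) primKernel d (n * y) a * primKernel d (n' * y) a' =
  (totient d)%:R * primKernel d (n * y0) a.
Proof.
move=> d0 cn cn' ca cy0 hy0.
under eq_bigr do rewrite (primKernelE (n' * _))// mulrBr mulr_sumr.
rewrite sumrB [X in _ - X]exchange_big /= [X in _ - X]big1 ?subr0; last first.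
  move=> e ed; have := ltn_ord e; move: (nat_of_ord e) ed => {}e ed ltd.
  case/dvdnP: (ed) => h dE.
  have h1 : (1 < h)%N by move: ltd d0; rewrite dE; case: h {dE} => [|[|h]]//; lia.
  have [p pp ph] := pdivP h1; case/dvdnP: ph => h' hE.
  have dE' : d = (p * (h' * e))%N by rewrite {1}dE hE mulnC mulnA mulnC; ring.
  have := @primKernel_orth p (h' * e) n a (fun y => primKernel e (n' * y) a') pp.
  rewrite -dE'; apply=> //.
    by move: d0; rewrite dE' !muln_gt0 => /andP[].
  move=> c t; apply: primKernel_mod => //.
    by move: d0; rewrite dE' !muln_gt0 => /and3P[].
  by rewrite mulnDr !mulnA addnC modnMDl.
pose z : 'I_d := Ordinal (ltn_pmod y0 d0).
have hz y : (n' * y == a' %[mod d]) = (y == y0 %[mod d]).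
  by rewrite -hy0 ![(n' * _)%N]mulnC eqn_modMr_coprime.
rewrite (bigD1 z) /=; last by rewrite /coprime gcdn_modl.
rewrite big1 ?addr0; last first.
  move=> y /andP[_ yz]; rewrite /residueKernel hz ifF ?mulr0//.
  by apply: contraNF yz => /eqP; rewrite (modn_small (ltn_ord y)) => h; apply/eqP/val_inj.
rewrite /residueKernel hz modn_mod eqxx mulrC; congr (_ * _).
by apply: primKernel_mod => //; rewrite modnMmr.
Qed.
End Kernel.

(** * Fourier analysis modulo d *)

Lemma CauchySchwarz_sum (R : realFieldType) (I : Type) (r : seq I) (P : pred I)
    (F G : I -> R) :
  (\sum_(i <- r | P i) F i * G i) ^+ 2 <=
  (\sum_(i <- r | P i) F i ^+ 2) * (\sum_(i <- r | P i) G i ^+ 2).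
Proof.
set A := \sum_(i <- r | P i) F i ^+ 2; set C := \sum_(i <- r | P i) G i ^+ 2.
set B := \sum_(i <- r | P i) F i * G i.
have H s t : 0 <= s ^+ 2 * A + 2 * s * t * B + t ^+ 2 * C.
  have -> : s ^+ 2 * A + 2 * s * t * B + t ^+ 2 * C =
      \sum_(i <- r | P i) (s * F i + t * G i) ^+ 2.
    by rewrite !mulr_sumr -!big_split /=; apply: eq_bigr => i _; ring.
  by apply: sumr_ge0 => i _; exact: sqr_ge0.
have C0 : 0 <= C by apply: sumr_ge0 => i _; exact: sqr_ge0.
case: (eqVneq C 0) => [Ce|Cn].
  have [->|Bn] := eqVneq B 0; first by rewrite expr0n /= Ce mulr0.
  (* For [C = 0] the form is affine in [t] at [s = 1]; this [t] would give it the value [- 1]. *)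
  have := H 1 (- (A + 1) / (2 * B)); rewrite Ce mulr0 addr0.
  have -> : 1 ^+ 2 * A + 2 * 1 * (- (A + 1) / (2 * B)) * B = - 1 by field.
  by rewrite ler0N1.
have Cp : 0 < C by rewrite lt_def Cn.
have := H C (- B).
rewrite [X in 0 <= X -> _](_ : _ = C * (A * C - B ^+ 2)); last ring.
by rewrite pmulr_rge0// subr_ge0.
Qed.

Section Trigonometric.
Variable R : realType.
Implicit Types (al f g : nat -> R) (th ph : R) (d k m n y M : nat).

(** The phase makes the sine sums a special case, at [ph = - pi / 2]. *)
Lemma dirichlet_cos th ph n :
  2 * sin (th / 2) * \sum_(k < n) cos (th * k%:R + ph) =
  sin (th * n%:R - th / 2 + ph) - sin (ph - th / 2).
Proof.
elim: n => [|n IH]; first by rewrite big_ord0 mulr0 mulr0 add0r [- _ + _]addrC subrr.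
rewrite big_ord_recr /= mulrDr IH -[n.+1%:R]natr1 [th * (_ + 1)]mulrDr mulr1.
have -> : th * n%:R + th - th / 2 + ph = (th * n%:R + ph) + th / 2 by field.
have -> : th * n%:R - th / 2 + ph = (th * n%:R + ph) - th / 2 by field.
move: (th * n%:R + ph) (sin (ph - th / 2)) => x y.
by rewrite sinB sinD; ring.
Qed.

Lemma cos_add2pin ph n : cos (ph + 2 * pi * n%:R) = cos ph :> R.
Proof.
rewrite -(periodicn (@cosD2pi R) n ph); congr cos; ring.
Qed.

Lemma sin_add2pin ph n : sin (ph + 2 * pi * n%:R) = sin ph :> R.
Proof.
rewrite -(periodicn (@sinD2pi R) n ph); congr sin; ring.
Qed.

Lemma sin_pi_frac_neq0 d t : (0 < d)%N -> ~~ (d %| t)%N ->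
  sin (pi * t%:R / d%:R) != 0 :> R.
Proof.
move=> d0 dt; have dR : (0 : R) < d%:R by rewrite ltr0n.
rewrite (divn_eq t d) natrD natrM mulrDr mulrDl mulrA mulfK ?(lt0r_neq0 dR)// addrC [pi * (t %/ d)%:R]mulr_natr.
rewrite (alternatingn (@sinDpi R)); apply: mulf_neq0; first by rewrite signr_eq0.
apply: lt0r_neq0; apply: sin_gt0_pi; apply/andP; split.
  by rewrite !mulr_gt0 ?pi_gt0 ?invr_gt0// ltr0n lt0n.
by rewrite ltr_pdivrMr// ltr_pM2l ?pi_gt0// ltr_nat ltn_mod.
Qed.

Lemma sum_cos_roots d t : (0 < d)%N ->
  \sum_(k < d) cos (2 * pi * t%:R / d%:R * k%:R) =
  (if (d %| t)%N then d%:R else 0 : R).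
Proof.
move=> d0; have dR : d%:R != 0 :> R by rewrite pnatr_eq0 -lt0n.
case: ifPn => dt.
  case/dvdnP: dt => s ->.
  rewrite (eq_bigr (fun=> 1)) ?sumr_const ?card_ord// => k _.
  rewrite natrM mulrA mulfK// -mulrA -natrM -[_ * _]add0r cos_add2pin cos0 //.
apply/eqP; have := dirichlet_cos (2 * pi * t%:R / d%:R) 0 d.
under eq_bigr do rewrite addr0.
rewrite divfK// addr0 [2 * pi * t%:R - _]addrC sin_add2pin sub0r subrr => /eqP.
rewrite !mulf_eq0 pnatr_eq0 /= => /orP[|//].
have -> : 2 * pi * t%:R / d%:R / 2 = pi * t%:R / d%:R :> R by field.
by rewrite (negPf (sin_pi_frac_neq0 d0 dt)).
Qed.

Lemma sum_cos_orth d m y : (0 < d)%N ->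
  \sum_(k < d) (cos (2 * pi / d%:R * k%:R * m%:R) * cos (2 * pi / d%:R * k%:R * y%:R) +
    sin (2 * pi / d%:R * k%:R * m%:R) * sin (2 * pi / d%:R * k%:R * y%:R)) =
  (if m == y %[mod d] then d%:R else 0 : R).
Proof.
move=> d0; wlog le : m y / (y <= m)%N.
  move=> H; case: (leqP y m) => [|/ltnW] le; first exact: H.
  rewrite eq_sym -H//; apply: eq_bigr => k _.
  by rewrite [cos _ * _]mulrC [sin _ * _]mulrC.
rewrite eqn_mod_dvd// -sum_cos_roots//; apply: eq_bigr => k _.
by rewrite -cosB natrB//; congr cos; ring.
Qed.

Definition trigC al M th : R := \sum_(n < M) al n * cos (th * n%:R).
Definition trigS al M th : R := \sum_(n < M) al n * sin (th * n%:R).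
Definition expEnergy al M th : R := trigC al M th ^+ 2 + trigS al M th ^+ 2.

Lemma expEnergy_ge0 al M th : 0 <= expEnergy al M th.
Proof. by rewrite addr_ge0 ?sqr_ge0. Qed.

Definition unitEnergy al M d : R :=
  \sum_(k < d | coprime k d) expEnergy al M (2 * pi / d%:R * k%:R).

Lemma unitEnergy_ge0 al M d : 0 <= unitEnergy al M d.
Proof. by apply: sumr_ge0 => k _; exact: expEnergy_ge0. Qed.

Lemma parseval_bilinear d f al M : (0 < d)%N -> (forall y, f (y %% d)%N = f y) ->
  \sum_(k < d) (trigC al M (2 * pi / d%:R * k%:R) * trigC f d (2 * pi / d%:R * k%:R)
    + trigS al M (2 * pi / d%:R * k%:R) * trigS f d (2 * pi / d%:R * k%:R)) =
  d%:R * \sum_(m < M) al m * f m.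
Proof.
move=> d0 fper; rewrite /trigC /trigS.
under eq_bigr do rewrite !big_distrlr -big_split /=.
rewrite exchange_big /= mulr_sumr; apply: eq_bigr => m _.
under eq_bigr do rewrite -big_split /=.
rewrite exchange_big /=.
transitivity (\sum_(y < d) al m * f y * (if m == y %[mod d] then d%:R else 0)).
  apply: eq_bigr => y _; rewrite -sum_cos_orth// mulr_sumr.
  by apply: eq_bigr => k _; ring.
rewrite (bigD1 (Ordinal (ltn_pmod m d0)))//= [X in _ + X]big1 => [|y ym].
  by rewrite addr0 fper modn_mod eqxx mulrC.
rewrite ifF ?mulr0//; apply: contraNF ym => /eqP h; apply/eqP/val_inj => /=.
by rewrite h modn_small.
Qed.

(* [f] plays the role of a combination of primitive characters mod [d]: its
   Fourier transform is supported on the units, whence the restriction to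
   reduced fractions [k / d] in [unitEnergy]. *)
Definition primitiveMod d f :=
  (forall y, f (y %% d)%N = f y) /\
  (forall p e (H : nat -> R), prime p -> d = (p * e)%N ->
    (forall c t, H (c + t * e)%N = H c) -> \sum_(y < d) f y * H y = 0).

(** If a prime [p] divides both [k] and [d], the waves of frequency [k / d] have period [d / p], and
    [f] is orthogonal to them. *)
Lemma trig_primitive_eq0 d f k : (0 < d)%N -> primitiveMod d f -> ~~ coprime k d ->
  trigC f d (2 * pi / d%:R * k%:R) = 0 /\ trigS f d (2 * pi / d%:R * k%:R) = 0.
Proof.
move=> d0 [_ fprim] ckd.
have g1 : (1 < gcdn k d)%N.
  by rewrite ltn_neqAle eq_sym ckd gcdn_gt0 d0 orbT.
have [p pp pg] := pdivP g1.
have /dvdnP[k' kE] := dvdn_trans pg (dvdn_gcdl k d).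
have /dvdnP[e dE] := dvdn_trans pg (dvdn_gcdr k d).
have e0 : e%:R != 0 :> R by rewrite pnatr_eq0; move: d0; rewrite dE muln_gt0; lia.
have p0 : p%:R != 0 :> R by rewrite pnatr_eq0 -lt0n prime_gt0.
have kd : 2 * pi / d%:R * k%:R = 2 * pi * k'%:R / e%:R :> R.
  rewrite dE kE !natrM; field; first by rewrite e0.
have per c t : 2 * pi * k'%:R / e%:R * (c + t * e)%:R =
    2 * pi * k'%:R / e%:R * c%:R + 2 * pi * (k' * t)%:R :> R.
  by rewrite natrD !natrM; field.
rewrite kd /trigC /trigS; split.
  apply: (fprim p e (fun y => cos (2 * pi * k'%:R / e%:R * y%:R))) => //.
    by rewrite mulnC.
  by move=> c t; rewrite per cos_add2pin.
apply: (fprim p e (fun y => sin (2 * pi * k'%:R / e%:R * y%:R))) => //.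
  by rewrite mulnC.
by move=> c t; rewrite per sin_add2pin.
Qed.

(** Parseval turns the pairing into a sum over frequencies [k / d], of which only the reduced ones
    survive. After Cauchy-Schwarz, Parseval for [f] with itself evaluates the other factor. *)
Lemma primitive_pairing_le d f al M : (0 < d)%N -> primitiveMod d f ->
  (\sum_(m < M) al m * f m) ^+ 2 <=
  (\sum_(y < d) f y ^+ 2) * (d%:R^-1 * unitEnergy al M d).
Proof.
move=> d0 fP; have fper := fP.1.
have dR : (0 : R) < d%:R by rewrite ltr0n.
set th := fun k : nat => 2 * pi / d%:R * k%:R : R.
have h1 : d%:R * \sum_(m < M) al m * f m =
  \sum_(k < d | coprime k d) (trigC al M (th k) * trigC f d (th k) + trigS al M (th k) * trigS f d (th k)).
  rewrite -parseval_bilinear// [RHS]big_mkcond /=; apply: eq_bigr => k _.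
  case: ifPn => // ck; have [-> ->] := trig_primitive_eq0 d0 fP ck.
  by rewrite !mulr0 addr0.
have h2 : \sum_(k < d | coprime k d) (trigC f d (th k) ^+ 2 + trigS f d (th k) ^+ 2) <=
    d%:R * \sum_(y < d) f y ^+ 2.
  under [X in _ <= _ * X]eq_bigr do rewrite expr2.
  rewrite -parseval_bilinear// big_mkcond /=; apply: ler_sum => k _.
  by case: ifP => _; rewrite -?expr2// addr_ge0 ?sqr_ge0.
have h3 : (d%:R * \sum_(m < M) al m * f m) ^+ 2 <=
   (\sum_(k < d | coprime k d) (trigC f d (th k) ^+ 2 + trigS f d (th k) ^+ 2)) *
   unitEnergy al M d.
  rewrite h1.
  (* Cosine and sine coefficients are put into one family, so that a single Cauchy-Schwarz covers
     both. *)
  pose F (kb : 'I_d * bool) := if kb.2 then trigC f d (th kb.1) else trigS f d (th kb.1).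
  pose G (kb : 'I_d * bool) := if kb.2 then trigC al M (th kb.1) else trigS al M (th kb.1).
  have split2 (X : 'I_d * bool -> R) :
      \sum_(kb : 'I_d * bool | coprime kb.1 d && true) X kb =
      \sum_(k < d | coprime k d) (X (k, true) + X (k, false)).
    rewrite [RHS](eq_bigr (fun k : 'I_d => \sum_(b : bool) X (k, b))); last first.
      by move=> k _; rewrite big_bool.
    by rewrite pair_big /=; apply: eq_big => [[k b]|[k b] _].
  have := CauchySchwarz_sum (index_enum _) (fun kb : 'I_d * bool => coprime kb.1 d && true) G F.
  by rewrite !split2 /F /G /= mulrC.
rewrite exprMn in h3.
have d2 : (0 : R) < d%:R ^+ 2 by rewrite exprn_gt0.
rewrite -(ler_pM2l d2); apply: le_trans h3 _.
rewrite [X in _ <= X](_ : _ = d%:R * (\sum_(y < d) f y ^+ 2) * unitEnergy al M d).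
  by rewrite ler_wpM2r// unitEnergy_ge0.
by field; rewrite gt_eqF.
Qed.
End Trigonometric.

(** * The large sieve *)

Section LargeSieve.
Variable R : realType.
Implicit Types (al : nat -> R).

(* Duality: writing the left side as [\sum_n al n * w n], Cauchy-Schwarz leaves
   [\sum_n w n ^+ 2], to which the square of the conjugate sum [v] is added so
   that only differences of the frequencies remain. *)
Lemma large_sieve_dual (I : finType) (P : pred I) (th : I -> R) (K : I -> I -> R)
    (Delta : R) al H : 0 <= Delta ->
  (forall i j, P i -> P j -> `|\sum_(n < H) cos ((th i - th j) * n%:R)| <= K i j) ->
  (forall i j, P i -> P j -> `|\sum_(n < H) sin ((th i - th j) * n%:R)| <= K i j) ->
  (forall i j, K i j = K j i) ->
  (forall i, P i -> \sum_(j | P j) K i j <= Delta) ->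
  \sum_(i | P i) expEnergy al H (th i) <= 2 * Delta * \sum_(n < H) al n ^+ 2.
Proof.
move=> D0 Kc Ks Ksym KD.
set c := fun i => trigC al H (th i); set s := fun i => trigS al H (th i).
set S := \sum_(i | P i) _; set A := \sum_(n < H) _.
pose w n := \sum_(i | P i) (c i * cos (th i * n%:R) + s i * sin (th i * n%:R)).
pose v n := \sum_(i | P i) (c i * sin (th i * n%:R) - s i * cos (th i * n%:R)).
have S0 : 0 <= S by apply: sumr_ge0 => i _; exact: expEnergy_ge0.
have A0 : 0 <= A by apply: sumr_ge0 => i _; exact: sqr_ge0.
have SE : S = \sum_(n < H) al n * w n.
  under [RHS]eq_bigr do rewrite mulr_sumr.
  rewrite exchange_big /=; apply: eq_bigr => i _.
  rewrite /expEnergy !expr2 -/(c i) -/(s i) {2}/c /trigC {2}/s /trigS !mulr_sumr -big_split /=.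
  by apply: eq_bigr => n _; ring.
have EE i : expEnergy al H (th i) = c i ^+ 2 + s i ^+ 2 by [].
clearbody c s.
have wv : \sum_(n < H) (w n ^+ 2 + v n ^+ 2) =
   \sum_(i | P i) \sum_(j | P j) ((c i * c j + s i * s j) * \sum_(n < H) cos ((th i - th j) * n%:R)
     + (s i * c j - c i * s j) * \sum_(n < H) sin ((th i - th j) * n%:R)).
  under [RHS]eq_bigr do under eq_bigr do rewrite !mulr_sumr -big_split /=.
  under [RHS]eq_bigr do rewrite exchange_big /=.
  rewrite [RHS]exchange_big /=; apply: eq_bigr => n _.
  rewrite !expr2 /w /v !big_distrlr -big_split /=; apply: eq_bigr => i _.
  rewrite -big_split /=; apply: eq_bigr => j _.
  by rewrite [(th i - th j) * _]mulrBl cosB sinB; ring.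
(* By the inequality between arithmetic and geometric means, the cosine sums and the sine sums
   contribute at most [Delta * S] each, whence the factor 2. *)
have le1 : \sum_(n < H) w n ^+ 2 <= 2 * Delta * S.
  apply: (@le_trans _ _ (\sum_(n < H) (w n ^+ 2 + v n ^+ 2))).
    by apply: ler_sum => n _; rewrite lerDl sqr_ge0.
  rewrite wv; set E := fun i => expEnergy al H (th i).
  apply: (@le_trans _ _ (\sum_(i | P i) \sum_(j | P j) (E i * K i j + E j * K i j))).
    apply: ler_sum => i Pi; apply: ler_sum => j Pj.
    have k0 : 0 <= K i j by apply: le_trans (Kc i j Pi Pj).
    have m (a b : R) : `|a| <= (E i + E j) / 2 -> `|b| <= K i j ->
        a * b <= (E i + E j) / 2 * K i j.
      by move=> ha hb; apply: le_trans (ler_norm _) _; rewrite normrM ler_pM.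
    have -> : E i * K i j + E j * K i j = (E i + E j) / 2 * K i j + (E i + E j) / 2 * K i j.
      by field.
    have q (a b a' b' : R) : `|a * a' + b * b'| <= (a ^+ 2 + b ^+ 2 + (a' ^+ 2 + b' ^+ 2)) / 2.
      have := sqr_ge0 (a - a'); have := sqr_ge0 (a + a').
      have := sqr_ge0 (b - b'); have := sqr_ge0 (b + b').
      by rewrite !expr2 ler_norml => *; apply/andP; split; nra.
    apply: lerD; apply: m; rewrite ?Kc ?Ks// /E !EE ?q//.
    by rewrite -mulNr [c i ^+ 2 + _]addrC -[in leRHS](sqrrN (c i)) q.
  under eq_bigr do rewrite big_split /=.
  rewrite big_split /= [X in _ + X]exchange_big /=.
  under [X in _ + X]eq_bigr do under eq_bigr do rewrite Ksym.
  rewrite -mulr2n -[X in X *+ 2](eq_bigr _ (fun i _ => mulr_sumr _ _ _ _)).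
  rewrite -[leLHS]mulr_natl -[leRHS]mulrA ler_pM2l// mulr_sumr; apply: ler_sum => i Pi.
  by rewrite mulrC ler_wpM2r ?expEnergy_ge0 ?KD.
have le2 : S ^+ 2 <= A * (2 * Delta * S).
  rewrite {1}SE; apply: le_trans (CauchySchwarz_sum _ _ _ _) _.
  by rewrite ler_wpM2l.
have [S1|S1] := ltP 0 S; first by rewrite -(ler_pM2r S1) -expr2; apply: le_trans le2 _; lra.
by apply: le_trans S1 _; rewrite mulr_ge0// mulr_ge0.
Qed.

Definition harmonicSum (J : nat) : R := \sum_(j < J) j.+1%:R^-1.

Lemma harmonicSum_ge0 J : 0 <= harmonicSum J.
Proof. by apply: sumr_ge0 => j _; rewrite invr_ge0. Qed.

(** The integer parts of [t i * J] are distinct elements of [1, ..., J], so the sum is compared with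
    the harmonic sum term by term. *)
Lemma sum_inv_spaced (I : finType) (P : pred I) (t : I -> R) (J : nat) : (0 < J)%N ->
  (forall i, P i -> J%:R^-1 <= t i <= 1) ->
  (forall i j, P i -> P j -> i != j -> J%:R^-1 <= `|t i - t j|) ->
  \sum_(i | P i) (t i)^-1 <= J%:R * harmonicSum J.
Proof.
case: J => // J _ tb tsp; set N := J.+1.
have N0 : (0 : R) < N%:R by rewrite ltr0n.
have tJ i : P i -> 1 <= t i * N%:R.
  by move=> /tb /andP[h _]; rewrite -ler_pdivrMr// mul1r.
have f1 i : P i -> (0 < Num.truncn (t i * N%:R))%N.
  by move=> Pi; rewrite truncn_gt0 tJ.
have fitv i : P i -> ((Num.truncn (t i * N%:R))%:R <= t i * N%:R < (Num.truncn (t i * N%:R)).+1%:R).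
  by move=> Pi; apply: truncn_itv; apply: le_trans (tJ _ Pi).
have fJ i : P i -> ((Num.truncn (t i * N%:R)).-1 < N)%N.
  move=> Pi; rewrite ltnS -ltnS prednK ?f1// -(ler_nat R).
  have /andP[h _] := fitv _ Pi; apply: le_trans h _.
  by have /andP[_ h] := tb _ Pi; rewrite -{2}[N%:R]mul1r ler_pM2r.
pose g i : 'I_N := inord (Num.truncn (t i * N%:R)).-1.
have gE i : P i -> (g i).+1 = Num.truncn (t i * N%:R).
  by move=> Pi; rewrite /g inordK ?fJ// prednK ?f1.
have ginj : {in [set i | P i] &, injective g}.
  move=> i j; rewrite !inE => Pi Pj gij; apply/eqP; apply: contraT => nij.
  have := tsp _ _ Pi Pj nij.
  have := fitv _ Pi; have := fitv _ Pj.
  rewrite -!gE// gij -[(g j).+2%:R]natr1 -natr1 => hj hi.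
  rewrite -/N => h; exfalso; move: h; apply/negP.
  rewrite -ltNge -(ltr_pM2r N0) mulVf ?gt_eqF//.
  by rewrite -(ger0_norm (ltW N0)) -normrM mulrBl ltr_norml; lra.
apply: (@le_trans _ _ (\sum_(i in [set i | P i]) N%:R * (g i).+1%:R^-1)).
  rewrite [leRHS](eq_bigl P) => [|i]; last by rewrite inE.
  apply: ler_sum => i Pi; rewrite gE//.
  have /andP[h _] := fitv _ Pi.
  have ti : 0 < t i by rewrite -(pmulr_lgt0 _ N0); apply: lt_le_trans (tJ _ Pi).
  have f0 : (0 : R) < (Num.truncn (t i * N%:R))%:R by rewrite ltr0n f1.
  by rewrite ler_pdivlMr// [leLHS]mulrC ler_pdivrMr// [leRHS]mulrC.
rewrite -mulr_sumr ler_pM2l// -(big_imset (fun j : 'I_N => j.+1%:R^-1) ginj) /= /harmonicSum.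
rewrite big_mkcond /=; apply: ler_sum => j _.
by case: ifP => // _; rewrite invr_ge0.
Qed.

(** The mean value theorem gives [sin (x / 2) >= cos (x / 2) * (x / 2)]. Then
    [sin x = 2 * cos (x / 2) * sin (x / 2)] is at least [(1 + cos x) * (x / 2)], and [cos x >= 0] in
    this range. *)
Lemma sin_ge_half (x : R) : 0 <= x -> x <= pi / 2 -> x / 2 <= sin x.
Proof.
move=> x0 xp; have pi0 := pi_gt0 R.
case: (eqVneq x 0) => [->|xn]; first by rewrite sin0 mul0r.
have s0 : 0 < x / 2 by rewrite divr_gt0// lt_def xn.
have [c cin E] : exists2 c, c \in `]0, (x / 2)[ & sin (x / 2) - sin 0 = cos c * (x / 2 - 0).
  by apply: MVT => //; apply: continuous_subspaceT; exact: continuous_sin.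
rewrite sin0 !subr0 in E.
move: cin; rewrite in_itv /= => /andP[c0 c1].
have cc : cos (x / 2) < cos c by rewrite ltr_cos// in_itv /=; lra.
have cs : 0 <= cos (x / 2) by apply: cos_ge0_pihalf; lra.
have cx : 0 <= cos x by apply: cos_ge0_pihalf; lra.
have -> : sin x = 2 * (cos (x / 2) * sin (x / 2)).
  by rewrite -[in LHS](divfK (_ : 2 != 0 :> R) x)// mulr_natr sin_mulr2n mulr_natl.
have -> : x = x / 2 * 2 by field.
have cxE : cos x = 2 * cos (x / 2) ^+ 2 - 1.
  by rewrite -[in LHS](divfK (_ : 2 != 0 :> R) x)// mulr_natr cos_mulr2n mulr_natl.
rewrite mulfK// E.
have : cos (x / 2) ^+ 2 * (x / 2) <= cos (x / 2) * (cos c * (x / 2)).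
  by rewrite expr2 -mulrA ler_wpM2l// ler_pM2r// ltW.
nra.
Qed.

(** The sum of the two inverses stands for the inverse distance to the nearest integer; its terms
    can be summed separately by [sum_inv_spaced]. *)
Lemma inv_sin_pi_le (t : R) : 0 < t < 1 -> 0 < sin (pi * t) /\ (sin (pi * t))^-1 <= t^-1 + (1 - t)^-1.
Proof.
move=> /andP[t0 t1]; have p2 := pi_ge2 R; have p0 := pi_gt0 R.
have st0 : 0 < sin (pi * t) by apply: sin_gt0_pi; nra.
split=> //; have i0 : 0 < t^-1 by rewrite invr_gt0.
have i1 : 0 < (1 - t)^-1 by rewrite invr_gt0; lra.
have [h|h] := leP t (2^-1).
  have : t <= sin (pi * t) by apply: le_trans (sin_ge_half _ _); nra.
  by rewrite -lef_pV2 ?posrE// => h1; lra.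
have : 1 - t <= sin (pi * t).
  have -> : sin (pi * t) = sin (pi * (1 - t)).
    rewrite mulrBr mulr1 sinB sinpi cospi mul0r sub0r; ring.
  apply: le_trans (sin_ge_half _ _); nra.
by rewrite -lef_pV2 ?posrE//; [move=> h1; lra|lra].
Qed.

Lemma trig_sum_bound (th ph : R) n : 0 < `|sin (th / 2)| ->
  `|\sum_(k < n) cos (th * k%:R + ph)| <= `|sin (th / 2)|^-1.
Proof.
move=> s0; rewrite -(ler_pM2l s0) mulfV ?gt_eqF// -normrM.
rewrite -(ler_pM2l (_ : 0 < 2 :> R))// -[X in X * `|_|]ger0_norm// -normrM mulrA dirichlet_cos.
apply: le_trans (ler_normB _ _) _; rewrite mulr1.
by have := sin_max (th * n%:R - th / 2 + ph); have := sin_max (ph - th / 2); lra.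
Qed.

(** The fractions [k / d] with [d <= D] are spaced by [1 / D^2], and [K i j] bounds the Dirichlet
    kernel at the difference of two of them. Each row of [K] off the diagonal is at most four
    harmonic sums: two sides of [rho i], and on each side the two inverses of [inv_sin_pi_le]. The
    logarithm lost here against the sharp inequality is harmless. *)
Lemma large_sieve (D H : nat) al : (0 < D)%N ->
  \sum_(d < D.+1 | (0 < d)%N) unitEnergy al H d <=
  2 * (H%:R + 4 * (D ^ 2)%:R * harmonicSum (D ^ 2)) * \sum_(n < H) al n ^+ 2.
Proof.
move=> D0; pose I := ('I_D.+1 * 'I_D.+1)%type.
pose P := [pred i : I | [&& (0 < i.1)%N, (i.2 < i.1)%N & coprime i.2 i.1]].
pose rho (i : I) : R := i.2%:R / i.1%:R.
pose th i := 2 * pi * rho i.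
have -> : \sum_(d < D.+1 | (0 < d)%N) unitEnergy al H d =
    \sum_(i | P i) expEnergy al H (th i).
  rewrite (eq_bigr (fun d : 'I_D.+1 => \sum_(k < D.+1 | (k < d)%N && coprime k d)
      expEnergy al H (th (d, k)))) => [|d d0].
    rewrite pair_big_dep /=; apply: eq_big => [[d k]|[d k] _] //=.
  rewrite /unitEnergy (big_ord_widen_cond _ (fun k => coprime k d)
    (fun k => expEnergy al H (2 * pi / d%:R * k%:R)) (ltnW (ltn_ord d))).
  apply: eq_big => [k|k _]; first by rewrite andbC.
  by congr expEnergy; rewrite /th /rho /=; ring.
have D2 : (0 < D ^ 2)%N by rewrite expn_gt0 D0.
(* The gap below 1 keeps [1 - |rho i - rho j|], the distance the other way round the circle, at
   least [1 / D^2]. *)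
have rho_itv i : P i -> 0 <= rho i /\ rho i <= 1 - (D ^ 2)%:R^-1.
  case: i => d k /and3P[/= d0 kd _]; rewrite /rho /=.
  have dR : (0 : R) < d%:R by rewrite ltr0n.
  split; first by rewrite divr_ge0.
  apply: (@le_trans _ _ (1 - d%:R^-1)).
    rewrite ler_pdivrMr// mulrBl mulVf ?gt_eqF// mul1r lerBrDr natr1 ler_nat//.
  rewrite lerD2l lerN2 lef_pV2 ?posrE ?ltr0n// ler_nat.
  have : (d <= D)%N by rewrite -ltnS ltn_ord.
  by rewrite -mulnn => h; apply: leq_trans h _; rewrite leq_pmulr.
have spaced i j : P i -> P j -> i != j -> (D ^ 2)%:R^-1 <= `|rho i - rho j|.
  case: i => d k; case: j => d' k' /and3P[/= d0 kd cop] /and3P[/= d0' kd' cop'] nij.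
  have dR : (0 : R) < d%:R by rewrite ltr0n.
  have dR' : (0 : R) < d'%:R by rewrite ltr0n.
  have ne : (k * d' != k' * d)%N.
    apply: contra nij => /eqP e.
    have dd : (d = d' :> nat).
      apply/eqP; rewrite eqn_dvd; apply/andP; split.
        by rewrite -(@Gauss_dvdr d k) 1?coprime_sym// e dvdn_mull.
      by rewrite -(@Gauss_dvdr d' k') 1?coprime_sym// -e dvdn_mull.
    move: e; rewrite dd => /eqP; rewrite eqn_pmul2r// => /eqP kk.
    by apply/eqP; congr (_, _); exact: val_inj.
  have -> : rho (d, k) - rho (d', k') = ((k * d')%:R - (k' * d)%:R) / (d * d')%:R.
    by rewrite /rho /= !natrM; field; rewrite !gt_eqF.
  rewrite normrM normfV normr_nat.
  have p : (0 : R) < (d * d')%:R by rewrite ltr0n muln_gt0 d0.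
  apply: (@le_trans _ _ (1 / (d * d')%:R)).
    have le : (d * d')%:R <= (D ^ 2)%:R :> R.
      by rewrite ler_nat -mulnn; apply: leq_mul; rewrite -ltnS ltn_ord.
    by rewrite div1r lef_pV2 ?posrE// (lt_le_trans p).
  rewrite ler_pM2r ?invr_gt0//.
  move: ne; rewrite neq_ltn => /orP[] lt.
    by rewrite distrC -natrB 1?ltnW// ger0_norm ?ler0n// ler1n subn_gt0.
  by rewrite -natrB 1?ltnW// ger0_norm ?ler0n// ler1n subn_gt0.
have N0 : (0 : R) < (D ^ 2)%:R by rewrite ltr0n.
have iN0 : (0 : R) < (D ^ 2)%:R^-1 by rewrite invr_gt0.
pose K i j : R := if i == j then H%:R else `|rho i - rho j|^-1 + (1 - `|rho i - rho j|)^-1.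
have dist i j : P i -> P j -> i != j ->
    `|sin ((th i - th j) / 2)| != 0 /\ `|sin ((th i - th j) / 2)|^-1 <= K i j.
  move=> Pi Pj nij; rewrite /K (negPf nij).
  have [a0 a1] := rho_itv _ Pi; have [b0 b1] := rho_itv _ Pj.
  have sp := spaced _ _ Pi Pj nij.
  have ab : 0 < `|rho i - rho j| < 1 by rewrite (lt_le_trans iN0 sp) ltr_norml; lra.
  have [h1 h2] := inv_sin_pi_le ab.
  have -> : (th i - th j) / 2 = pi * (rho i - rho j) by rewrite /th; field.
  suff -> : `|sin (pi * (rho i - rho j))| = sin (pi * `|rho i - rho j|) by rewrite gt_eqF.
  have [h|h] := leP 0 (rho i - rho j).
    by move: h1; rewrite ger0_norm// => h1; rewrite ger0_norm// ltW.
  by move: h1; rewrite ltr0_norm// mulrN sinN => h1; rewrite ltr0_norm// -oppr_gt0.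
apply: (@large_sieve_dual I P th K).
- by rewrite addr_ge0// mulr_ge0 ?harmonicSum_ge0// mulr_ge0.
- move=> i j Pi Pj; have [->|nij] := eqVneq i j.
    rewrite /K eqxx subrr; apply: le_trans (ler_norm_sum _ _ _) _.
    rewrite -[X in _ <= X%:R]card_ord -sumr_const; apply: ler_sum => n _.
    exact: cos_max.
  have [h1 h2] := dist _ _ Pi Pj nij; apply: le_trans h2.
  have := @trig_sum_bound (th i - th j) 0 H; rewrite normr_gt0 -normr_eq0 => /(_ h1).
  by under eq_bigr do rewrite addr0.
- move=> i j Pi Pj; have [->|nij] := eqVneq i j.
    rewrite /K eqxx subrr; apply: le_trans (ler_norm_sum _ _ _) _.
    rewrite -[X in _ <= X%:R]card_ord -sumr_const; apply: ler_sum => n _.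
    exact: sin_max.
  have [h1 h2] := dist _ _ Pi Pj nij; apply: le_trans h2.
  have := @trig_sum_bound (th i - th j) (- (pi / 2)) H; rewrite normr_gt0 -normr_eq0 => /(_ h1).
  by under eq_bigr do rewrite cosBpihalf.
- by move=> i j; rewrite /K eq_sym distrC.
move=> i Pi; rewrite (bigD1 i)//= {1}/K eqxx lerD2l.
rewrite (eq_bigr (fun j => `|rho i - rho j|^-1 + (1 - `|rho i - rho j|)^-1)); last first.
  by move=> j /andP[_ ji]; rewrite /K eq_sym (negPf ji).
have N1 : (D ^ 2)%:R^-1 <= 1 :> R by rewrite invf_le1// ler1n.
rewrite (bigID (fun j => rho j <= rho i)) /=.
set B := (D ^ 2)%:R * harmonicSum (D ^ 2).
(* On one side of [rho i] the distances to [rho i] differ exactly by the distances between the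
   points, so they and their complements to 1 inherit the spacing. *)
have half (b : bool) : \sum_(j | P j && (j != i) && ((rho j <= rho i) == b))
     (`|rho i - rho j|^-1 + (1 - `|rho i - rho j|)^-1) <= B + B.
  have sgE j : (rho j <= rho i) == b -> `|rho i - rho j| = (if b then 1 else -1) * (rho i - rho j).
    case: b => [/eqP h|/eqP/negbT]; first by rewrite mul1r ger0_norm// subr_ge0.
    by rewrite -ltNge => h; rewrite mulN1r ltr0_norm// subr_lt0.
  have sg1 : `|(if b then 1 else -1 : R)| = 1 by case: b {sgE}; rewrite ?normrN normr1.
  rewrite big_split /=; apply: lerD; apply: sum_inv_spaced => //.
  - move=> j /andP[/andP[Pj ji] _].
    rewrite spaced//; last by rewrite eq_sym.
    have [a0 a1] := rho_itv _ Pi; have [b0 b1] := rho_itv _ Pj.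
    by rewrite ler_norml; lra.
  - move=> j k /andP[/andP[Pj ji] bj] /andP[/andP[Pk ki] bk] jk.
    rewrite !sgE// -mulrBr normrM sg1 mul1r opprB addrC addrA subrK distrC spaced//.
  - move=> j /andP[/andP[Pj ji] _].
    have [a0 a1] := rho_itv _ Pi; have [b0 b1] := rho_itv _ Pj.
    apply/andP; split; last by rewrite lerBlDr lerDl.
    by rewrite lerBrDr addrC -lerBrDr ler_norml; lra.
  move=> j k /andP[/andP[Pj ji] bj] /andP[/andP[Pk ki] bk] jk.
  have -> : 1 - `|rho i - rho j| - (1 - `|rho i - rho k|) = `|rho i - rho k| - `|rho i - rho j| by ring.
  rewrite !sgE// -mulrBr normrM sg1 mul1r opprB addrC addrA subrK spaced//.
have h1 := half true; have h2 := half false.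
have -> : 4 * (D ^ 2)%:R * harmonicSum (D ^ 2) = (B + B) + (B + B) by rewrite /B; ring.
apply: lerD.
  by apply: le_trans h1; rewrite le_eqVlt; apply/predU1P; left; apply: eq_bigl => j; rewrite eqb_id.
by apply: le_trans h2; rewrite le_eqVlt; apply/predU1P; left; apply: eq_bigl => j; rewrite eqbF_neg.
Qed.

End LargeSieve.

(** * Bilinear forms in arithmetic progressions *)

(** Splitting [phi(q)] along [q = d * e] needs this for factors that may share primes. *)
Lemma leq_totient_mul d e : (0 < d)%N -> (0 < e)%N ->
  (totient d * totient e <= totient (d * e))%N.
Proof.
move=> d0; have [m] := ubnP e; elim: m e => // m IH e em e0.
have [e1|e1] := leqP e 1.
  have -> : e = 1%N by apply/eqP; rewrite eqn_leq e1.
  by rewrite (_ : totient 1 = 1%N)// !muln1.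
have [p pp /dvdnP[e' eE]] := pdivP e1.
have e'0 : (0 < e')%N by move: e0; rewrite eE muln_gt0 => /andP[].
have e'e : (e' < e)%N by rewrite eE ltn_Pmulr// prime_gt1.
rewrite eE [(e' * p)%N]mulnC mulnCA [totient (p * e')]totient_prime_mul//.
rewrite [totient (p * _)]totient_prime_mul ?muln_gt0 ?d0//.
rewrite mulnCA; apply: leq_mul; last by apply: IH => //; exact: leq_trans e'e em.
case: ifPn => [h|_]; first by rewrite dvdn_mull.
by case: ifP => // _; exact: leq_pred.
Qed.

Lemma totient_dvd_leq d e : (0 < e)%N -> (d %| e)%N -> (totient d <= totient e)%N.
Proof.
move=> e0 /dvdnP[h eE]; move: e0; rewrite eE muln_gt0 => /andP[h0 d0].
apply: leq_trans (leq_totient_mul h0 d0).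
by rewrite leq_pmull// totient_gt0.
Qed.

Section DivisorSums.
Variable R : realType.

Lemma sum_divisor_pairs_le (Q : nat) (F : nat -> nat -> R) :
  (forall d e, 0 <= F d e) ->
  \sum_(q < Q.+1 | (0 < q)%N) \sum_(d < q.+1 | (d %| q)%N) F d (q %/ d)%N <=
  \sum_(d < Q.+1 | (0 < d)%N) \sum_(e < Q.+1 | (0 < e)%N) F d e.
Proof.
move=> F0.
apply: (@le_trans _ _ (\sum_(q < Q.+1 | (0 < q)%N) \sum_(d < Q.+1 | (0 < d)%N)
    \sum_(e < Q.+1 | (0 < e)%N) (if q == (d * e)%N :> nat then F d e else (0 : R)))).
  apply: ler_sum => q q0.
  rewrite (big_ord_widen_cond _ (fun d => d %| q)%N (fun d => F d (q %/ d)%N) (ltn_ord q)).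
  rewrite big_mkcond [leRHS]big_mkcond /=; apply: ler_sum => d _.
  case: ifP => [/andP[dq dq1]|_]; last first.
    case: ifP => // _; apply: sumr_ge0 => e _; by case: ifP.
  have d0 : (0 < d)%N by rewrite (dvdn_gt0 q0).
  rewrite d0; case/dvdnP: (dq) => e qE.
  have eQ : (e < Q.+1)%N.
    by apply: leq_ltn_trans (ltn_ord q); rewrite qE leq_pmulr.
  have e0 : (0 < e)%N by move: q0; rewrite qE muln_gt0 => /andP[].
  rewrite (bigD1 (Ordinal eQ))//= {1 2}qE mulnC eqxx mulKn//.
  by rewrite lerDl sumr_ge0// => i _; case: ifP.
rewrite exchange_big /=; apply: ler_sum => d d0.
rewrite exchange_big /=; apply: ler_sum => e e0.
have [le|gt] := ltnP (d * e) Q.+1; last first.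
  rewrite big1// => q _; case: eqP => // qE.
  by have := ltn_ord q; rewrite qE ltnNge gt.
rewrite -big_mkcondr /= (big_pred1 (Ordinal le)) => [|q]; first by [].
rewrite inE -val_eqE /=; case: eqP => [->|]; rewrite ?andbF//.
by rewrite muln_gt0 d0 e0.
Qed.

(** From [e], the sum of [phi(d)] over [d] dividing [e], being at most [tau(e) * phi(e)] with [tau]
    the number of divisors, one gets [1 / phi(e) <= tau(e) / e], the Dirichlet convolution of
    [1 / n] with itself. *)
Lemma sum_inv_totient_le Q :
  \sum_(e < Q.+1 | (0 < e)%N) (totient e)%:R^-1 <= harmonicSum R Q ^+ 2.
Proof.
have hE : harmonicSum R Q = \sum_(d < Q.+1 | (0 < d)%N) d%:R^-1.
  by rewrite big_mkcond big_ord_recl /= add0r.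
rewrite expr2 {1 2}hE big_distrlr /=.
apply: le_trans (sum_divisor_pairs_le Q (F := fun d e => d%:R^-1 * e%:R^-1) _); last first.
  by move=> d e; rewrite mulr_ge0 ?invr_ge0.
apply: ler_sum => e e0.
have tp : (0 : R) < (totient e)%:R by rewrite ltr0n totient_gt0.
have ep : (0 : R) < e%:R by rewrite ltr0n.
rewrite -[leLHS]mul1r ler_pdivrMr// mulr_suml.
rewrite -{1}(mulfV (lt0r_neq0 ep)) -{1}(sum_totient_dvd e) natr_sum mulr_suml.
apply: ler_sum => d de.
have d0 : (0 < d)%N by rewrite (dvdn_gt0 e0).
rewrite -invfM -natrM [(d * _)%N]mulnC divnK// mulrC ler_wpM2l ?invr_ge0//.
by rewrite ler_nat totient_dvd_leq.
Qed.
End DivisorSums.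

Section Bilinear.
Variable R : realType.
Implicit Types (al be f g : nat -> R) (d e q m n a M Y : nat).

(* [T] bounds the squared norm of the projection of [al] to the functions on
   (Z/d)^* spanned by primitive characters. *)
Definition primitiveBound d al M (T : R) := forall g : nat -> R,
  primitiveMod d g -> (forall y, ~~ coprime y d -> g y = 0) ->
  (\sum_(m < M) al m * g m) ^+ 2 <= (\sum_(y < d) g y ^+ 2) * T.

Lemma primitiveBound_unitEnergy d al M : (0 < d)%N ->
  primitiveBound d al M (d%:R^-1 * unitEnergy al M d).
Proof. by move=> d0 g gP _; exact: primitive_pairing_le. Qed.

(** For [d > 1] the function [g] is orthogonal to constants, so a main term [mu] common to all
    reduced classes can be subtracted for free. Siegel-Walfisz enters through this bound. *)
Lemma primitiveBound_variance d al M (mu : R) : (1 < d)%N ->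
  primitiveBound d al M
    (\sum_(c < d | coprime c d) (\sum_(m < M | m == c %[mod d]) al m - mu) ^+ 2).
Proof.
move=> d1 g [gper gprim] gcop.
have d0 : (0 < d)%N by lia.
have g0 : \sum_(c < d) g c = 0.
  have [p pp /dvdnP[e dE]] := pdivP d1.
  transitivity (\sum_(y < d) g y * 1); last first.
    exact: (gprim p e (fun=> 1) pp (etrans dE (mulnC e p)) (fun _ _ => erefl)).
  by apply: eq_bigr => c _; rewrite mulr1.
have -> : \sum_(m < M) al m * g m =
    \sum_(c < d | coprime c d) (\sum_(m < M | m == c %[mod d]) al m - mu) * g c.
  rewrite [RHS]big_mkcond /=.
  rewrite [RHS](eq_bigr (fun c : 'I_d => \sum_(m < M | m == c %[mod d]) al m * g m - mu * g c)).
    rewrite sumrB -mulr_sumr g0 mulr0 subr0.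
    rewrite (exchange_big_dep predT) //=; apply: eq_bigr => m _.
    rewrite (big_pred1 (Ordinal (ltn_pmod m d0)))// => c.
    by rewrite inE -val_eqE /= (modn_small (ltn_ord c)) eq_sym.
  move=> c _; case: ifPn => cd.
    rewrite mulrBl mulr_suml; congr (_ - _); apply: eq_bigr => m /eqP mc.
    by rewrite -(gper m) mc gper.
  rewrite gcop// mulr0 subr0 big1// => m /eqP mc.
  by rewrite -(gper m) mc gper gcop// mulr0.
apply: le_trans (CauchySchwarz_sum _ _ _ _) _.
rewrite mulrC ler_wpM2r//; first by apply: sumr_ge0 => c _; exact: sqr_ge0.
by rewrite [leRHS](bigID (fun c : 'I_d => coprime c d)) /= lerDl sumr_ge0// => c _; exact: sqr_ge0.
Qed.

Definition kernelSum d al M be Y a : R :=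
  \sum_(m < M | coprime m d) \sum_(n < Y | coprime n d)
     al m * be n * primKernel R d (m * n) a.

(** With characters, [Psi] would be the sum of [|sum be * chi|^2] over primitive [chi]. The
    reproducing property gives [f] and [g] the same energy [phi(d) * Psi], while [kernelSum] is the
    pairing of [al] with [f] and [Psi] that of [be] with [g]. The second pairing yields
    [Psi <= phi(d) * T], and the first then gives the claim, with no trace of [a]. *)
Lemma kernelSum_le d al M be Y a (S T : R) : (0 < d)%N -> coprime a d ->
  0 <= S -> 0 <= T -> primitiveBound d al M S -> primitiveBound d be Y T ->
  kernelSum d al M be Y a ^+ 2 <= (totient d)%:R ^+ 2 * (S * T).
Proof.
move=> d0 ca S0 T0 Sal Tbe.
have tp : (0 : R) < (totient d)%:R by rewrite ltr0n totient_gt0.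
pose f y := if coprime y d then \sum_(n < Y | coprime n d) be n * primKernel R d (n * y) a else 0.
(* The factor [1 *] gives [g] the same shape as [f], so that [prim] and [energy] serve both. *)
pose g z := if coprime z d then \sum_(n < Y | coprime n d) be n * primKernel R d (1 * z) n else 0.
pose Psi := \sum_(n < Y | coprime n d) \sum_(n' < Y | coprime n' d)
    be n * be n' * primKernel R d n n'.
have prim (c k : nat -> nat) : (forall n, coprime n d -> coprime (c n) d) ->
    (forall n, coprime n d -> coprime (k n) d) ->
    primitiveMod d (fun y => if coprime y d then
      \sum_(n < Y | coprime n d) be n * primKernel R d (c n * y) (k n) else 0).
  move=> cc ck; split=> [y|p e H pp dE Hper].
    rewrite /coprime gcdn_modl; case: ifP => // _.
    apply: eq_bigr => n _; congr (_ * _); apply: primKernel_mod => //.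
    by rewrite modnMmr.
  transitivity (\sum_(n < Y | coprime n d) be n *
      \sum_(y < d | coprime y d) primKernel R d (c n * y) (k n) * H y).
    under [RHS]eq_bigr do rewrite mulr_sumr.
    rewrite exchange_big /= [RHS]big_mkcond /=; apply: eq_bigr => y _.
    case: ifP => _; last by rewrite mul0r.
    by rewrite mulr_suml; apply: eq_bigr => n _; rewrite mulrA.
  rewrite big1// => n cn.
  have e0 : (0 < e)%N by move: d0; rewrite dE muln_gt0 => /andP[].
  have := @primKernel_orth R p e (c n) (k n) H pp e0; rewrite -dE => -> //; rewrite ?mulr0//.
    exact: cc.
  exact: ck.
have fP : primitiveMod d f by exact: (prim id (fun=> a)).
have gP : primitiveMod d g by apply: (prim (fun=> 1%N) id) => // n _; exact: coprime1n.
have energy (h : nat -> nat -> R) :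
    (forall n n', coprime n d -> coprime n' d ->
       \sum_(y < d | coprime y d) h n y * h n' y = (totient d)%:R * primKernel R d n n') ->
    \sum_(y < d) (if coprime y d then \sum_(n < Y | coprime n d) be n * h n y else 0) ^+ 2 =
    (totient d)%:R * Psi.
  move=> hh; rewrite /Psi.
  transitivity (\sum_(y < d | coprime y d) (\sum_(n < Y | coprime n d) be n * h n y) ^+ 2).
    rewrite [RHS]big_mkcond; apply: eq_bigr => y _; case: ifP => // _.
    by rewrite expr0n.
  under eq_bigr do rewrite expr2 big_distrlr /=.
  rewrite exchange_big mulr_sumr /=; apply: eq_bigr => n cn.
  rewrite exchange_big mulr_sumr /=; apply: eq_bigr => n' cn'.
  rewrite mulrCA -hh// mulr_sumr; apply: eq_bigr => y _; ring.
have fE : \sum_(y < d) f y ^+ 2 = (totient d)%:R * Psi.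
  apply: (energy (fun n y => primKernel R d (n * y) a)) => n n' cn cn'.
  have [y0 hy0] := modn_lin_solve 0 a d0 cn'.
  have h1 : n' * y0 = a %[mod d] by apply/eqP; rewrite mulnC -[(_ * _)%N]add0n hy0.
  have cy0 : coprime y0 d.
    have : coprime (n' * y0) d by rewrite /coprime -gcdn_modl h1 gcdn_modl.
    by rewrite coprimeMl => /andP[].
  rewrite (primKernel_reproducing R d0 cn cn' ca cy0 h1); congr (_ * _).
  by rewrite -(primKernel_scale R n n' d0 cy0); apply: primKernel_mod.
have gE : \sum_(y < d) g y ^+ 2 = (totient d)%:R * Psi.
  apply: (energy (fun n y => primKernel R d (1 * y) n)) => n n' cn cn'.
  rewrite (primKernel_reproducing R (y0 := n') d0) ?coprime1n// ?mul1n//.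
  by rewrite primKernel_sym.
have WE : kernelSum d al M be Y a = \sum_(m < M) al m * f m.
  rewrite /kernelSum big_mkcond; apply: eq_bigr => m _; rewrite /f.
  case: ifP => _; last by rewrite mulr0.
  by rewrite mulr_sumr; apply: eq_bigr => n _; rewrite mulrA [(m * n)%N]mulnC.
have PE : Psi = \sum_(n < Y) be n * g n.
  rewrite /Psi big_mkcond; apply: eq_bigr => n _; rewrite /g.
  case: ifP => _; last by rewrite mulr0.
  by rewrite mulr_sumr; apply: eq_bigr => n' _; rewrite mulrA mul1n.
have f0 y : ~~ coprime y d -> f y = 0 by rewrite /f => /negPf ->.
have g0 y : ~~ coprime y d -> g y = 0 by rewrite /g => /negPf ->.
have Psi0 : 0 <= Psi.
  by rewrite -(pmulr_rge0 _ tp) -fE sumr_ge0// => y _; exact: sqr_ge0.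
have h1 := Sal f fP f0; rewrite fE -WE in h1.
have h2 := Tbe g gP g0; rewrite gE -PE in h2.
have h3 : Psi <= (totient d)%:R * T.
  have [P1|P1] := ltP 0 Psi; last by apply: le_trans P1 _; rewrite mulr_ge0// ltW.
  by rewrite -(ler_pM2r P1) -expr2; apply: le_trans h2 _; rewrite mulrAC.
apply: le_trans h1 _.
rewrite expr2 -!mulrA ler_pM2l// [S * T]mulrC mulrA.
by rewrite ler_wpM2r.
Qed.
End Bilinear.

Section Discrepancy.
Variable R : realType.
Implicit Types (al be : nat -> R) (d e q m n a M Y : nat).

Definition restrictCoprime e al m : R := if coprime m e then al m else 0.

Definition bilinearDiscrepancy al M be Y q a : R :=
  \sum_(m < M) \sum_(n < Y) al m * be n *
    ((if coprime (m * n) q then (totient q)%:R^-1 else 0) -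
     (if (m * n == a %[mod q])%N then 1 else 0)).

(** The kernel of [d = 1] is constantly 1 and cancels the expected value. Coprimality to [q] splits
    into coprimality to [d], built into [kernelSum], and to [q / d], imposed on the coefficients. *)
Lemma bilinearDiscrepancyE al M be Y q a : (0 < q)%N -> coprime a q ->
  bilinearDiscrepancy al M be Y q a =
  - (totient q)%:R^-1 * \sum_(d < q.+1 | (d %| q)%N && (1 < d)%N)
      kernelSum d (restrictCoprime (q %/ d) al) M (restrictCoprime (q %/ d) be) Y a.
Proof.
move=> q0 ca.
have tp : (totient q)%:R != 0 :> R by rewrite pnatr_eq0 -lt0n totient_gt0.
have kE m n : (if coprime (m * n) q then (totient q)%:R^-1 else 0) -
     (if (m * n == a %[mod q])%N then 1 else 0) =
   - (totient q)%:R^-1 * \sum_(d < q.+1 | (d %| q)%N && (1 < d)%N)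
      (if coprime (m * n) q then primKernel R d (m * n) a else 0).
  case: ifPn => cmn; last first.
    rewrite ifF ?subrr ?big1 ?mulr0//; apply: contraNF cmn => /eqP h.
    by rewrite /coprime -gcdn_modl h gcdn_modl.
  have q1 : (1 < q.+1)%N by rewrite ltnS.
  have : \sum_(d < q.+1 | (d %| q)%N && (1 < d)%N) primKernel R d (m * n) a =
      residueKernel R q (m * n) a - 1.
    rewrite -sum_primKernel// [in RHS](bigD1 (Ordinal q1)) ?dvd1n//= primKernel1 addrAC subrr add0r.
    apply: eq_bigl => d; case dq: (d %| q)%N => //=.
    rewrite -val_eqE /= ltn_neqAle eq_sym; case: (posnP d) => [d0|_]; last by rewrite andbT.
    by move: dq; rewrite d0 dvd0n => /eqP q0'; rewrite q0' in q0.
  move=> ->; rewrite /residueKernel; case: ifP => _; first by field.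
  by rewrite sub0r subr0 mulrN1 opprK.
rewrite /bilinearDiscrepancy mulr_sumr.
under eq_bigr do under eq_bigr do rewrite kE mulrCA mulr_sumr.
under eq_bigr do under eq_bigr do rewrite mulr_sumr.
under eq_bigr do rewrite exchange_big /=.
rewrite exchange_big /=; apply: eq_bigr => d /andP[dq _].
rewrite /kernelSum mulr_sumr [in RHS]big_mkcond /=; apply: eq_bigr => m _.
have cq z : coprime z q = coprime z (q %/ d) && coprime z d.
  by rewrite -coprimeMr divnK.
case: ifPn => cm; last first.
  rewrite big1// => n _; rewrite ifF ?mulr0 ?mulr0//.
  by apply: contraNF cm; rewrite coprimeMl cq => /andP[/andP[]].
rewrite mulr_sumr [in RHS]big_mkcond /=; apply: eq_bigr => n _.
rewrite /restrictCoprime coprimeMl !cq cm !andbT.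
by case: (coprime n d); case: (coprime m _); case: (coprime n _); rewrite /= ?(mulr0, mul0r, mulr0).
Qed.

Lemma bilinearDiscrepancy_le al M be Y q a (S T : nat -> nat -> R) :
  (0 < q)%N -> coprime a q ->
  (forall d, (d %| q)%N -> (1 < d)%N ->
     [/\ 0 <= S d (q %/ d)%N, 0 <= T d (q %/ d)%N,
       primitiveBound d (restrictCoprime (q %/ d) al) M (S d (q %/ d)%N ^+ 2) &
       primitiveBound d (restrictCoprime (q %/ d) be) Y (T d (q %/ d)%N ^+ 2)]) ->
  `|bilinearDiscrepancy al M be Y q a| <=
  \sum_(d < q.+1 | (d %| q)%N && (1 < d)%N)
    (totient (q %/ d))%:R^-1 * (S d (q %/ d)%N * T d (q %/ d)%N).
Proof.
move=> q0 ca H; rewrite bilinearDiscrepancyE// normrM normrN normfV normr_nat.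
rewrite -ler_pdivlMl ?invr_gt0 ?ltr0n ?totient_gt0// invrK mulr_sumr.
apply: le_trans (ler_norm_sum _ _ _) _; apply: ler_sum => d /andP[dq d1].
have [S0 T0 Sb Tb] := H d dq d1.
have d0 : (0 < d)%N by exact: ltnW.
have e0 : (0 < q %/ d)%N by rewrite divn_gt0// dvdn_leq.
apply: (@le_trans _ _ ((totient d)%:R * (S d (q %/ d)%N * T d (q %/ d)%N))).
  rewrite -(ler_pXn2r (n := 2))// ?nnegrE//; last by rewrite !mulr_ge0.
  rewrite real_normK ?num_real// [leRHS]exprMn [in leRHS]exprMn.
  apply: kernelSum_le; rewrite ?sqr_ge0//.
  by apply: coprime_dvdr dq _.
rewrite [leRHS]mulrA ler_wpM2r ?mulr_ge0// ler_pdivlMr ?ltr0n ?totient_gt0//.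
by rewrite -natrM ler_nat; apply: leq_trans (leq_totient_mul d0 e0) _; rewrite mulnC divnK.
Qed.

Lemma sum_bilinearDiscrepancy_le al M be Y Q B (S T : nat -> nat -> R) :
  (forall d e, 0 <= S d e) -> (forall d e, 0 <= T d e) ->
  (forall d e, (1 < d <= Q)%N -> (0 < e <= Q)%N -> coprime d B ->
      primitiveBound d (restrictCoprime e al) M (S d e ^+ 2) /\
      primitiveBound d (restrictCoprime e be) Y (T d e ^+ 2)) ->
  \sum_(q < Q.+1 | (0 < q)%N && coprime q B)
    \big[Num.max/0]_(a < q | coprime a q) `|bilinearDiscrepancy al M be Y q a| <=
  \sum_(e < Q.+1 | (0 < e)%N) (totient e)%:R^-1 *
    \sum_(d < Q.+1 | (1 < d)%N && coprime d B) S d e * T d e.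
Proof.
move=> S0 T0 H.
pose F d e : R := if (1 < d)%N && coprime d B then
  (totient e)%:R^-1 * (S d e * T d e) else 0.
have F0 d e : 0 <= F d e by rewrite /F; case: ifP => // _; rewrite !mulr_ge0 ?invr_ge0.
apply: (@le_trans _ _ (\sum_(q < Q.+1 | (0 < q)%N) \sum_(d < q.+1 | (d %| q)%N) F d (q %/ d)%N)).
  rewrite big_mkcondr /=; apply: ler_sum => q q0; case: ifP => qB; last first.
    by apply: sumr_ge0.
  apply: bigmax_le => [|a ca]; first by apply: sumr_ge0.
  apply: le_trans (bilinearDiscrepancy_le (S := S) (T := T) q0 ca _) _.
    move=> d dq d1; have dle := dvdn_leq q0 dq.
    have qQ : (q <= Q)%N by rewrite -ltnS.
    have [|||h1 h2] := H d (q %/ d)%N; rewrite ?S0 ?T0//.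
    - by rewrite d1 (leq_trans dle).
    - by rewrite divn_gt0 ?(ltnW d1)// dle/= (leq_trans (leq_div _ _)).
    - exact: coprime_dvdl dq qB.
  rewrite big_mkcondr /=; apply: ler_sum => d dq.
  by rewrite /F (coprime_dvdl dq qB) andbT.
apply: le_trans (sum_divisor_pairs_le Q F0) _.
rewrite exchange_big /=; apply: ler_sum => e e0.
rewrite mulr_sumr big_mkcond [leRHS]big_mkcond /=; apply: ler_sum => d _.
by rewrite /F; case: (posnP d) => [->//|d0].
Qed.
End Discrepancy.

(** * Products of primes in an interval *)

Section AlmostPrimesIn.
Variables (R : realType) (P : set nat).
Implicit Types (lo hi x y : R) (p m n s q a : nat).

Definition primeIn lo hi p : bool := [&& p \in P, lo <= p%:R & p%:R < hi].

(** That [n] equals the product of its distinct primes says that [n] is squarefree. *)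
Definition almostPrimeIn lo hi s n : bool :=
  [&& (0 < n)%N, size (primes n) == s, n == (\prod_(p <- primes n) p)%N &
   all (primeIn lo hi) (primes n)].

Lemma primes_mul_prime p m : prime p -> (0 < m)%N ->
  perm_eq (primes (p * m)) (if (p %| m)%N then primes m else p :: primes m).
Proof.
move=> pp m0; have p0 := prime_gt0 pp.
apply: uniq_perm; first exact: primes_uniq.
  by case: ifPn => h; rewrite /= primes_uniq ?andbT// mem_primes (negPf h) !andbF.
move=> l; rewrite primesM// primes_prime// inE.
case: ifPn => h; rewrite ?inE//; case: eqP => //= ->.
by rewrite mem_primes pp m0.
Qed.

Lemma almostPrimeIn_mul lo hi s p m : prime p -> (0 < m)%N ->
  almostPrimeIn lo hi s.+1 (p * m) =
  [&& ~~ (p %| m)%N, primeIn lo hi p & almostPrimeIn lo hi s m].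
Proof.
move=> pp m0; have p0 := prime_gt0 pp; have pe := primes_mul_prime pp m0.
rewrite /almostPrimeIn muln_gt0 p0 m0 /= (perm_size pe) (perm_all _ pe) (perm_big _ pe) /=.
case: ifPn => h /=; last first.
  rewrite eqSS big_cons eqn_pmul2l//.
  by rewrite [RHS]andbCA; congr (_ && _); rewrite [RHS]andbCA.
(* If [p] divides [m], the distinct primes of [p * m] are those of [m], and their product is at most
   [m < p * m]. *)
apply/negbTE; rewrite !negb_and; apply/orP; right; apply/orP; left.
rewrite neq_ltn; apply/orP; right.
apply: (@leq_ltn_trans m); last by rewrite ltn_Pmull// prime_gt1.
rewrite {2}(prod_prime_decomp m0) prime_decompE big_map /=.
rewrite big_seq [leqRHS]big_seq; apply: leq_prod => l; rewrite mem_primes => /and3P[lp _ lm].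
by rewrite -{1}(expn1 l) leq_exp2l ?prime_gt1// logn_gt0 mem_primes lp m0.
Qed.

Lemma almostPrimeIn_gt0 lo hi s n : almostPrimeIn lo hi s n -> (0 < n)%N.
Proof. by case/and4P. Qed.

Lemma almostPrimeIn_ge lo hi s n : almostPrimeIn lo hi s.+1 n -> lo <= n%:R.
Proof.
case/and4P => n0; case E: (primes n) => [//|p l] _ _ /= /andP[/and3P[_ h _] _].
apply: le_trans h _; rewrite ler_nat dvdn_leq//.
have : p \in primes n by rewrite E inE eqxx.
by rewrite mem_primes => /and3P[].
Qed.

(* Marking one prime factor of [n] counts each product of [s + 1] primes
   [s + 1] times; the surplus comes from [n] divisible by [p ^ 2]. *)
Lemma almostPrimeIn_marked lo hi s n : (0 < n)%N ->
  s.+1%:R * (almostPrimeIn lo hi s.+1 n)%:R =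
  \sum_(p <- primes n) (primeIn lo hi p && almostPrimeIn lo hi s (n %/ p))%:R -
  \sum_(p <- primes n)
     [&& primeIn lo hi p, almostPrimeIn lo hi s (n %/ p) & (p ^ 2 %| n)%N]%:R :> R.
Proof.
move=> n0; rewrite -sumrB.
transitivity (\sum_(p <- primes n) (almostPrimeIn lo hi s.+1 n)%:R : R).
  case A: (almostPrimeIn lo hi s.+1 n); last by rewrite mulr0 big1.
  rewrite mulr1 big_const_seq count_predT iter_addr_0.
  by case/and4P: A => _ /eqP ->.
rewrite big_seq [RHS]big_seq; apply: eq_bigr => p; rewrite mem_primes => /and3P[pp _ pn].
have [m nE] : exists m, n = (p * m)%N by case/dvdnP: pn => m ->; exists m; rewrite mulnC.
have p0 := prime_gt0 pp.
have m0 : (0 < m)%N by move: n0; rewrite nE muln_gt0 => /andP[].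
rewrite nE almostPrimeIn_mul// mulKn// -mulnn dvdn_pmul2l//.
by case: (p %| m)%N; case: primeIn; case: almostPrimeIn; rewrite /= ?subrr ?subr0.
Qed.

Lemma size_primes_marked lo hi s p n : (0 < n)%N -> prime p -> (p %| n)%N ->
  almostPrimeIn lo hi s (n %/ p) -> (size (primes n) <= s.+1)%N.
Proof.
move=> n0 pp /dvdnP[m nE]; rewrite nE mulnK ?prime_gt0// => /and4P[m0 /eqP sm _ _].
rewrite mulnC (perm_size (primes_mul_prime pp m0)).
by case: ifP => _ /=; rewrite sm.
Qed.

Definition apWeight q a n : R :=
  (if coprime n q then (totient q)%:R^-1 else 0) - (if n == a %[mod q] then 1 else 0).

Definition discrepancy x (h : nat -> R) q a : R :=
  \sum_(n < (Num.truncn x).+1 | (0 < n)%N && (n%:R < x)) h n * apWeight q a n.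

Definition apSum x (h : nat -> R) q a : R :=
  \sum_(n < (Num.truncn x).+1 | [&& (0 < n)%N, n%:R < x & n == a %[mod q]]) h n.

(** The discrepancy is the mean of [apSum] over the reduced classes minus one of its values, and all
    these lie between 0 and [W]. *)
Lemma discrepancy_le x h q a (W : R) : (0 < q)%N -> coprime a q ->
  (forall n, 0 <= h n) -> (forall c, coprime c q -> apSum x h q c <= W) ->
  `|discrepancy x h q a| <= W.
Proof.
move=> q0 ca h0 hW.
have tp : (0 : R) < (totient q)%:R by rewrite ltr0n totient_gt0.
have ap0 c : 0 <= apSum x h q c by apply: sumr_ge0.
have -> : discrepancy x h q a =
    (totient q)%:R^-1 * (\sum_(c < q | coprime c q) apSum x h q c) - apSum x h q a.
  rewrite /discrepancy /apWeight.
  under eq_bigr do rewrite mulrBr.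
  rewrite sumrB; congr (_ - _); last first.
    rewrite /apSum big_mkcond [RHS]big_mkcond; apply: eq_bigr => n _.
    case: (0 < n)%N => //=; case: (_ < x) => //=.
    by case: ifP; rewrite ?mulr1 ?mulr0.
  rewrite /apSum (exchange_big_dep (fun n : 'I_(Num.truncn x).+1 => (0 < n)%N && (n%:R < x))) /=; last first.
    by move=> c n _ /and3P[-> ->].
  rewrite mulr_sumr; apply: eq_bigr => n /andP[n0 nx].
  rewrite n0 nx /=; case: ifPn => cn.
    rewrite (big_pred1 (Ordinal (ltn_pmod n q0))) => [|c]; first by rewrite [LHS]mulrC.
    rewrite inE -val_eqE /= -[in RHS](modn_small (ltn_ord c)) [RHS]eq_sym.
    case: eqVneq => [e|]; rewrite ?andbF// andbT.
    by rewrite /coprime -gcdn_modl -e gcdn_modl.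
  rewrite mulr0 big_pred0 ?mulr0// => c; apply/negbTE; apply: contra cn => /andP[cc /eqP e].
  by rewrite /coprime -gcdn_modl e gcdn_modl.
have b1 : (totient q)%:R^-1 * (\sum_(c < q | coprime c q) apSum x h q c) <= W.
  rewrite ler_pdivrMl//.
  apply: (@le_trans _ _ (\sum_(c < q | coprime c q) W)).
    by apply: ler_sum => c; exact: hW.
  rewrite sumr_const -[leLHS]mulr_natl.
  suff -> : #|[pred c : 'I_q | coprime c q]| = totient q by [].
  rewrite totient_count_coprime big_mkord -sum1_card big_mkcond /=.
  by apply: eq_bigr => c _; rewrite inE coprime_sym; case: coprime.
have b2 : 0 <= (totient q)%:R^-1 * (\sum_(c < q | coprime c q) apSum x h q c).
  by rewrite mulr_ge0 ?invr_ge0// sumr_ge0.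
have := hW a ca; have := ap0 a; rewrite ler_norml; lra.
Qed.

(** Dividing the distance to the least element by [m] is injective on [S]. Only differences are
    constrained, so congruences to several moduli can be combined without naming a residue. *)
Lemma card_progression_le (U m : nat) (S : pred 'I_U) y x : (0 < m)%N -> y <= x ->
  (forall n : 'I_U, S n -> y <= n%:R < x) ->
  (forall n n' : 'I_U, S n -> S n' -> (n <= n')%N -> (m %| n' - n)%N) ->
  (#|S|%:R : R) <= (x - y) / m%:R + 1.
Proof.
move=> m0 yx Sb Sd.
have mR : (0 : R) < m%:R by rewrite ltr0n.
have xy0 : 0 <= (x - y) / m%:R by rewrite divr_ge0// subr_ge0.
have [S0|[i0 Si0]] := set_0Vmem [set i | S i].
  rewrite (_ : #|S| = 0%N) ?addr_ge0//; apply/eqP; rewrite -cardsE.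
  by rewrite cards_eq0; apply/eqP.
rewrite inE in Si0; case: (@arg_minnP _ i0 S (fun i => i : nat) Si0) => n0 Sn0 n0min.
set K := (Num.truncn ((x - y) / m%:R)).+1.
pose f (n : 'I_U) : 'I_K := inord ((n - n0) %/ m).
have fE (n : 'I_U) : S n -> f n = ((n - n0) %/ m)%N :> nat.
  move=> Sn; rewrite /f inordK// ltnS truncn_ge_nat// ler_pdivlMr//.
  rewrite -natrM divnK ?Sd ?n0min// natrB ?n0min//.
  by have /andP[h1 h2] := Sb _ Sn; have /andP[h3 h4] := Sb _ Sn0; lra.
have finj : {in S &, injective f}.
  move=> n n' Sn Sn' /(congr1 val) /=; rewrite !fE// => e.
  apply: val_inj => /=.
  have d1 := Sd _ _ Sn0 Sn (n0min _ Sn); have d2 := Sd _ _ Sn0 Sn' (n0min _ Sn').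
  by rewrite -(subnK (n0min _ Sn)) -(divnK d1) e divnK// subnK// n0min.
have : (#|S| <= K)%N.
  by rewrite -[K]card_ord -(card_in_image finj) max_card.
rewrite -(ler_nat R) => h; apply: le_trans h _.
by rewrite /K -natr1 lerD2r; have /andP[] := truncn_itv xy0.
Qed.
End AlmostPrimesIn.

(** * Cutting the primes into short intervals *)

Lemma sum_ord_support (V : nmodType) (M U : nat) (F : nat -> V) :
  (forall m, (M <= m)%N -> F m = 0) -> (forall m, (U <= m)%N -> F m = 0) ->
  \sum_(m < M) F m = \sum_(m < U) F m.
Proof.
wlog le : M U / (M <= U)%N.
  move=> H; case: (leqP M U) => [|/ltnW] le hM hU; first exact: H.
  by rewrite -(H U M).
move=> hM _; rewrite (big_ord_widen _ F le) [RHS](bigID (fun m : 'I_U => (m < M)%N)) /=.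
by rewrite [X in _ + X]big1 ?addr0// => m; rewrite -leqNgt => /hM.
Qed.

Lemma sum_seq_ord (V : nmodType) (r : seq nat) (K : nat) (F : nat -> V) : uniq r ->
  (forall p, p \in r -> (p < K)%N) ->
  \sum_(p <- r) F p = \sum_(p < K | val p \in r) F p.
Proof.
move=> ur rK; rewrite -(big_mkord (fun p => p \in r)) -big_filter.
apply: perm_big; apply: uniq_perm => //; first by rewrite filter_uniq ?iota_uniq.
move=> p; rewrite mem_filter mem_index_iota /=.
by case pr: (p \in r) => //=; rewrite rK.
Qed.

(** Telescoping with [1 / p^2 <= 1 / (p - 1) - 1 / p]; finally [1 / (lo - 1) <= 2 / lo] because
    [lo >= 2]. *)
Lemma sum_inv_sq_tail (R : realFieldType) (lo : R) (V : nat) : 2 <= lo ->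
  \sum_(p < V | lo <= p%:R) (p%:R ^+ 2)^-1 <= 2 / lo.
Proof.
move=> lo2; have lo0 : 0 < lo by lra.
have [h1 h2] : (lo <= V%:R -> \sum_(p < V | lo <= p%:R) (p%:R ^+ 2)^-1 <=
      (lo - 1)^-1 - (V%:R - 1)^-1) /\
    (V%:R <= lo -> \sum_(p < V | lo <= p%:R) (p%:R ^+ 2)^-1 = 0 :> R).
  elim: V => [|V [IH1 IH2]].
    by split=> [h|_]; rewrite big_ord0//; move: h; rewrite mulr0n; lra.
  rewrite big_mkcond big_ord_recr -big_mkcond /= -[V.+1%:R]natr1.
  split=> [h|h]; last by rewrite IH2 ?add0r ?ifF//; [apply/negbTE; rewrite -ltNge|]; lra.
  have [le|lt] := leP lo V%:R; last first.
    rewrite (IH2 (ltW lt)) addr0 addrK subr_ge0 lef_pV2 ?posrE; lra.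
  have V0 : 0 < V%:R :> R by lra.
  have V1 : 0 < V%:R - 1 :> R by lra.
  apply: (@le_trans _ _ ((lo - 1)^-1 - (V%:R - 1)^-1 + (V%:R ^+ 2)^-1)).
    by rewrite lerD2r IH1.
  rewrite addrK -addrA lerD2l -subr_ge0.
  have -> : - V%:R^-1 - (- (V%:R - 1)^-1 + (V%:R ^+ 2)^-1) = (V%:R ^+ 2 * (V%:R - 1))^-1 :> R.
    by field; rewrite !gt_eqF.
  by rewrite invr_ge0 mulr_ge0 ?sqr_ge0// ltW.
have b : (lo - 1)^-1 <= 2 / lo.
  by rewrite ler_pdivlMr// ler_pdivrMl; lra.
have [le|lt] := leP lo V%:R.
  by apply: le_trans (h1 le) _; apply: le_trans b; rewrite gerDl oppr_le0 invr_ge0; lra.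
by rewrite (h2 (ltW lt)) divr_ge0// ltW.
Qed.

Section Blocks.
Variables (R : realType) (P : set nat).
Hypothesis hP : forall p, p \in P -> prime p.
Implicit Types (p m n q a j : nat).
Variables (x lo z : R) (s T : nat).
Hypotheses (T0 : (0 < T)%N) (x1 : 1 <= x).

Definition blockLo j : R := expR (j%:R / T%:R).
Definition blockHi j : R := blockLo j.+1.

Definition blockPrime j p : R :=
  (primeIn P (Num.max lo (blockLo j)) (Num.min z (blockHi j)) p)%:R.

(** The condition [m * p < x] is tested at the upper end of the block, so that it no longer involves
    [p]. *)
Definition blockCofactor j m : R :=
  (almostPrimeIn P lo z s m && (m%:R * blockHi j < x))%:R.

Definition blockDiscrepancy j q a : R :=
  bilinearDiscrepancy (blockCofactor j) (Num.truncn (x / blockHi j)).+1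
    (blockPrime j) (Num.truncn (blockHi j)).+1 q a.

Let TR : (0 : R) < T%:R. Proof. by rewrite ltr0n. Qed.

Lemma blockLo_gt0 j : 0 < blockLo j. Proof. exact: expR_gt0. Qed.

Lemma blockLo_ge1 j : 1 <= blockLo j.
Proof. by rewrite -expR0 ler_expR divr_ge0. Qed.

Lemma blockHiE j : blockHi j = blockLo j * expR (T%:R^-1).
Proof. by rewrite /blockHi /blockLo -expRD -natr1 mulrDl mul1r. Qed.

Definition blockIndex p : nat := Num.truncn (T%:R * ln (p%:R : R)).

Lemma blockIndexP j p : (0 < p)%N ->
  (blockLo j <= p%:R < blockHi j) = (blockIndex p == j).
Proof.
move=> p0; have pR : (0 : R) < p%:R by rewrite ltr0n.
have l0 : 0 <= ln (p%:R : R) by rewrite ln_ge0// ler1n.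
rewrite truncn_eq ?mulr_ge0// /blockHi /blockLo.
rewrite -{1 2}[p%:R](lnK (_ : p%:R \in Num.pos)) ?posrE// ler_expR ltr_expR.
by rewrite ler_pdivrMr// ltr_pdivlMr// mulrC.
Qed.

Lemma blockPrimeE j p : blockPrime j p = (primeIn P lo z p && (blockIndex p == j))%:R.
Proof.
rewrite /blockPrime /primeIn; case pP: (p \in P) => //=.
rewrite -blockIndexP ?prime_gt0 ?hP// ge_max lt_min.
by congr (_%:R); congr nat_of_bool; rewrite -!andbA; case: (lo <= _); case: (_ < z); rewrite ?andbF ?andbT//= andbA andbF.
Qed.

Lemma blockPrime_prime j p : blockPrime j p != 0 -> prime p /\ p%:R < blockHi j.
Proof.
rewrite /blockPrime; case: (boolP (primeIn _ _ _ _)); rewrite ?eqxx// => /and3P[pP _].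
by rewrite lt_min => /andP[_ h] _; split; first exact: hP.
Qed.

Definition blockConv j n : R :=
  \sum_(p <- primes n) blockPrime j p * blockCofactor j (n %/ p).

Lemma blockCofactor_neq0 j m : blockCofactor j m != 0 ->
  (0 < m)%N /\ m%:R * blockHi j < x.
Proof.
rewrite /blockCofactor; case: (boolP (_ && _)); rewrite ?eqxx// => /andP[h1 h2] _.
by split=> //; exact: almostPrimeIn_gt0 h1.
Qed.

Lemma ltn_truncnS n : (n%:R < x) -> (n < (Num.truncn x).+1)%N.
Proof. by rewrite ltnS truncn_ge_nat ?(le_trans ler01 x1)// => /ltW. Qed.

Lemma discrepancy_blockConv j q a :
  discrepancy x (blockConv j) q a = blockDiscrepancy j q a.
Proof.
set U := (Num.truncn x).+1.
have hi1 : 1 <= blockHi j by exact: blockLo_ge1.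
have hi0 : 0 < blockHi j by exact: blockLo_gt0.
(* A non-zero product lies in all the summation ranges at once, so these can be exchanged freely
   below. *)
have nz m p : blockCofactor j m * blockPrime j p != 0 ->
    [/\ (0 < m)%N, prime p, (m * p)%:R < x & [&& (m < (Num.truncn (x / blockHi j)).+1)%N,
       (m < U)%N, (p < (Num.truncn (blockHi j)).+1)%N & (p < U)%N]].
  rewrite mulf_eq0 negb_or => /andP[/blockCofactor_neq0[m0 mx] /blockPrime_prime[pp ph]].
  have mR : (1 : R) <= m%:R by rewrite ler1n.
  have mpx : (m * p)%:R < x.
    by rewrite natrM; apply: le_lt_trans mx; rewrite ler_wpM2l// ltW.
  split=> //; apply/and4P; split.
  - by rewrite ltnS truncn_ge_nat ?divr_ge0 ?(le_trans ler01 x1) ?(ltW hi0)// ler_pdivlMr// ltW.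
  - apply: ltn_truncnS; apply: le_lt_trans mx; rewrite ler_peMr//.
  - by rewrite ltnS truncn_ge_nat ltW.
  - by apply: ltn_truncnS; apply: le_lt_trans mpx; rewrite ler_nat leq_pmull.
transitivity (\sum_(m < U) \sum_(p < U) blockCofactor j m * blockPrime j p * apWeight R q a (m * p)).
  transitivity (\sum_(n < U | (0 < n)%N && (n%:R < x)) \sum_(p < U) \sum_(m < U | (m * p)%N == n)
     blockCofactor j m * blockPrime j p * apWeight R q a n).
    apply: eq_bigr => n /andP[n0 nx].
    rewrite /blockConv (@sum_seq_ord _ _ U) ?primes_uniq//; last first.
      move=> p; rewrite mem_primes => /and3P[pp _ pn].
      by apply: leq_ltn_trans (ltn_ord n); exact: dvdn_leq.
    rewrite mulr_suml big_mkcond; apply: eq_bigr => p _ /=.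
    case: ifPn => pn.
      move: pn; rewrite mem_primes => /and3P[pp _ pn].
      have mU : (n %/ p < U)%N by apply: leq_ltn_trans (ltn_ord n); exact: leq_div.
      rewrite (big_pred1 (Ordinal mU)) => [|m] /=; first by rewrite [blockPrime j p * _]mulrC.
      rewrite -val_eqE /=.
      by apply/eqP/eqP => [<-|->]; rewrite ?mulnK ?divnK ?prime_gt0.
    rewrite big1// => m /eqP mp; apply/eqP; rewrite mulf_eq0; apply/orP; left.
    apply: contraNT pn => /nz[m0 pp _ _].
    by rewrite mem_primes pp n0 -mp dvdn_mull.
  rewrite exchange_big /= [RHS]exchange_big /=; apply: eq_bigr => p _.
  rewrite (exchange_big_dep predT)//=; apply: eq_bigr => m _.
  have [c0|cn] := eqVneq (blockCofactor j m * blockPrime j p) 0.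
    by rewrite c0 mul0r big1// => n _; rewrite mul0r.
  have [m0 pp mpx _] := nz _ _ cn.
  rewrite (big_pred1 (Ordinal (ltn_truncnS mpx)))// => n.
  rewrite inE -val_eqE /= eq_sym andbC; case: eqVneq => //= ->.
  by rewrite muln_gt0 m0 prime_gt0.
rewrite /blockDiscrepancy /bilinearDiscrepancy.
have z0 m p : ~~ [&& (m < (Num.truncn (x / blockHi j)).+1)%N,
       (m < U)%N, (p < (Num.truncn (blockHi j)).+1)%N & (p < U)%N] ->
    blockCofactor j m * blockPrime j p * apWeight R q a (m * p) = 0.
  move=> h; apply/eqP; rewrite mulf_eq0; apply/orP; left.
  by apply: contraNT h => /nz[].
transitivity (\sum_(m < U) \sum_(p < (Num.truncn (blockHi j)).+1)
    blockCofactor j m * blockPrime j p * apWeight R q a (m * p)).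
  apply: eq_bigr => m _.
  apply: (sum_ord_support (F := fun p => blockCofactor j m * blockPrime j p * apWeight R q a (m * p))) => p h;
    apply: z0; rewrite ltnNge [(_ < (Num.truncn (blockHi j)).+1)%N]ltnNge [(p < U)%N]ltnNge h ?andbF//.
apply: (sum_ord_support (F := fun m => \sum_(p < (Num.truncn (blockHi j)).+1)
   blockCofactor j m * blockPrime j p * apWeight R q a (m * p))) => m h;
  rewrite big1// => p _; apply: z0.
  by rewrite [(m < U)%N]ltnNge h andbF.
by rewrite ltnNge h.
Qed.

(* Pairs [(m, p)] with [m * p < x] discarded by the condition
   [m * blockHi j < x]: then [n = m * p] lies in [[x * (1 - 1 / T), x[]. *)
Definition edgeTerm n : R :=
  \sum_(p <- primes n) [&& primeIn P lo z p, almostPrimeIn P lo z s (n %/ p) &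
     x <= (n %/ p)%:R * blockHi (blockIndex p)]%:R.

Definition squareTerm n : R :=
  \sum_(p <- primes n)
     [&& primeIn P lo z p, almostPrimeIn P lo z s (n %/ p) & (p ^ 2 %| n)%N]%:R.

Lemma almostPrimeIn_blocks J n : (0 < n)%N -> n%:R < x -> T%:R * ln x < J%:R ->
  s.+1%:R * (almostPrimeIn P lo z s.+1 n)%:R =
  \sum_(j < J) blockConv j n + edgeTerm n - squareTerm n.
Proof.
move=> n0 nx hJ; rewrite almostPrimeIn_marked//; congr (_ - _).
rewrite /blockConv exchange_big -big_split /= big_seq [RHS]big_seq.
apply: eq_bigr => p; rewrite mem_primes => /and3P[pp _ pn].
have p0 := prime_gt0 pp.
have px : p%:R < x by apply: le_lt_trans nx; rewrite ler_nat dvdn_leq.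
have pR : (0 : R) < p%:R by rewrite ltr0n.
have iJ : (blockIndex p < J)%N.
  rewrite /blockIndex truncn_lt_nat; last by rewrite mulr_ge0// ln_ge0// ler1n.
  apply: le_lt_trans hJ; rewrite ler_pM2l// ler_ln ?posrE// ?ltW//.
  exact: lt_trans px.
rewrite (bigD1 (Ordinal iJ))//= big1 ?addr0 => [|j ji]; last first.
  rewrite blockPrimeE (_ : (blockIndex p == j) = false) ?andbF ?mul0r//.
  by apply: contraNF ji => /eqP e; apply/eqP/val_inj; rewrite /= e.
rewrite blockPrimeE eqxx andbT /blockCofactor leNgt.
by case: primeIn; case: almostPrimeIn; case: (_ < x); rewrite /= ?mul1r ?mul0r ?addr0 ?add0r.
Qed.

(** A block has ratio [exp(1/T)], so a discarded [n] is at least [x * exp(-1/T) >= x * (1 - 1/T)].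
    Since [n / p] has [s] prime factors, [n] has at most [s + 1], which bounds the number of
    terms. *)
Lemma edgeTerm_le n : (0 < n)%N ->
  edgeTerm n <= (if x * (1 - T%:R^-1) <= n%:R then s.+1%:R else 0).
Proof.
move=> n0; have [h|h] := boolP (has (fun p => [&& primeIn P lo z p, almostPrimeIn P lo z s (n %/ p) &
     x <= (n %/ p)%:R * blockHi (blockIndex p)]) (primes n)); last first.
  rewrite /edgeTerm big_seq big1; first by case: ifP.
  by move=> p pn; move/hasPn: h => /(_ p pn) /negPf ->.
have [p pn /and3P[h1 h2 h3]] := hasP h.
move: pn; rewrite mem_primes => /and3P[pp _ pn].
have p0 := prime_gt0 pp.
have sz := size_primes_marked n0 pp pn h2.
have m0 := almostPrimeIn_gt0 h2.
have -> : x * (1 - T%:R^-1) <= n%:R.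
  have /andP[lop _] : blockLo (blockIndex p) <= p%:R < blockHi (blockIndex p).
    by rewrite blockIndexP.
  have e1 : 1 - T%:R^-1 <= expR (- T%:R^-1) :> R by exact: expR_ge1Dx.
  have x0 : 0 < x by exact: lt_le_trans ltr01 x1.
  apply: (@le_trans _ _ (x * expR (- T%:R^-1))); first by rewrite ler_pM2l.
  rewrite expRN ler_pdivrMr ?expR_gt0//; apply: le_trans h3 _.
  rewrite blockHiE mulrA ler_pM2r ?expR_gt0//.
  by rewrite -{2}(divnK pn) natrM ler_wpM2l.
apply: (@le_trans _ _ (\sum_(l <- primes n) 1)).
  by apply: ler_sum => l _; rewrite (ler_nat _ _ 1) leq_b1.
by rewrite big_const_seq count_predT iter_addr_0 ler_nat.
Qed.

Lemma apSum_edgeTerm_le q c : (0 < q)%N ->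
  apSum x edgeTerm q c <= s.+1%:R * (x / (T%:R * q%:R) + 1).
Proof.
move=> q0; have x0 : 0 < x by exact: lt_le_trans ltr01 x1.
have qR : (0 : R) < q%:R by rewrite ltr0n.
set S := [pred n : 'I_(Num.truncn x).+1 | [&& (0 < n)%N, n%:R < x, n == c %[mod q] & x * (1 - T%:R^-1) <= n%:R]].
apply: (@le_trans _ _ (\sum_(n in S) s.+1%:R)).
  rewrite /apSum big_mkcond [leRHS]big_mkcond /=; apply: ler_sum => n _.
  rewrite inE; case: (posnP n) => //= n0; case: (n%:R < x) => //=; case: eqP => //= _.
  exact: edgeTerm_le.
rewrite sumr_const -[leLHS]mulr_natl [leLHS]mulrC ler_pM2l ?ltr0n//.
have := @card_progression_le R (Num.truncn x).+1 q S (x * (1 - T%:R^-1)) x q0.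
have -> : (x - x * (1 - T%:R^-1)) / q%:R = x / (T%:R * q%:R).
  by field; rewrite !gt_eqF.
apply.
- by rewrite ler_piMr// ?ltW// lerBlDr lerDl invr_ge0.
- by move=> n /and4P[_ h _ h']; rewrite h h'.
by move=> n n' /and4P[_ _ /eqP h _] /and4P[_ _ /eqP h' _] le; rewrite -eqn_mod_dvd// h h'.
Qed.

(** As [c] is coprime to [q], so is [p]; hence [n] runs through a progression mod [q * p^2], with at
    most [x / (q * p^2) + 1] terms. The terms 1 add up to about [sqrt x], because [p^2 <= n < x]. *)
Lemma apSum_squareTerm_le q c : (0 < q)%N -> coprime c q -> 2 <= lo ->
  apSum x squareTerm q c <= x / q%:R * (2 / lo) + (Num.truncn (Num.sqrt x)).+1%:R.
Proof.
move=> q0 cq lo2; have x0 : 0 < x by exact: lt_le_trans ltr01 x1.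
have qR : (0 : R) < q%:R by rewrite ltr0n.
set V := (Num.truncn (Num.sqrt x)).+1.
pose S (p : nat) := [pred n : 'I_(Num.truncn x).+1 | [&& (0 < n)%N, n%:R < x, n == c %[mod q] & (p ^ 2 %| n)%N]].
apply: (@le_trans _ _ (\sum_(p < V | prime p && (lo <= p%:R)) (#|S p|%:R : R))).
  apply: (@le_trans _ _ (\sum_(n < (Num.truncn x).+1 | [&& (0 < n)%N, n%:R < x & n == c %[mod q]])
      \sum_(p < V | prime p && (lo <= p%:R)) (p ^ 2 %| n)%N%:R)).
    apply: ler_sum => n /and3P[n0 nx _].
    rewrite /squareTerm.
    rewrite (@sum_seq_ord _ _ n.+1) ?primes_uniq//; last first.
      by move=> p; rewrite mem_primes => /and3P[pp _ pn]; rewrite ltnS dvdn_leq.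
    rewrite big_mkcond /= (@sum_ord_support _ n.+1 (maxn n.+1 V) (fun p => if p \in primes n then
        [&& primeIn P lo z p, almostPrimeIn P lo z s (n %/ p) & (p ^ 2 %| n)%N]%:R else 0)).
    - rewrite (big_ord_widen_cond (maxn n.+1 V) (fun p => prime p && (lo <= p%:R))
         (fun p => (p ^ 2 %| n)%N%:R)) ?leq_maxr//.
      rewrite [leRHS]big_mkcond /=; apply: ler_sum => p _.
      case: ifPn => pn; last by case: ifP.
      have [/and3P[/and3P[_ h1 _] _ h2]|] := boolP [&& _, _ & _]; last by case: ifP.
      move: pn; rewrite mem_primes => /and3P[-> _ _]; rewrite h1 h2 /=.
      have -> : (p < V)%N => //.
      rewrite ltnS truncn_ge_nat ?sqrtr_ge0//.
      rewrite -(ler_pXn2r (n := 2)) ?nnegrE ?sqrtr_ge0// sqr_sqrtr ?(ltW x0)//.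
      by rewrite -natrX (le_trans _ (ltW nx))// ler_nat dvdn_leq.
    - by move=> p; case: ifP => //; rewrite mem_primes => /and3P[_ _ /(dvdn_leq n0)]; rewrite leqNgt => /negPf->.
    - move=> p; rewrite geq_max => /andP[h _]; move: h; case: ifP => //.
      by rewrite mem_primes => /and3P[_ _ /(dvdn_leq n0)]; rewrite leqNgt => /negPf->.
  rewrite exchange_big /=; apply: ler_sum => p _.
  rewrite -sum1_card natr_sum big_mkcond [leRHS]big_mkcond /=; apply: ler_sum => n _.
  rewrite inE; case: (0 < n)%N => //=; case: (_ < x) => //=; case: (n == c %[mod q]) => //=.
  by case: (p ^ 2 %| n)%N.
apply: (@le_trans _ _ (\sum_(p < V | lo <= p%:R) (x / q%:R * (p%:R ^+ 2)^-1 + 1))).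
  rewrite big_mkcondl [leRHS]big_mkcond /= [leLHS]big_mkcond /=; apply: ler_sum => p _.
  case: ifP => // lop.
  have pl : (0 : R) < p%:R by apply: lt_le_trans lop; lra.
  have pos : 0 <= x / q%:R * (p%:R ^+ 2)^-1 by rewrite mulr_ge0 ?invr_ge0 ?sqr_ge0// divr_ge0 ?ltW.
  case: ifP => pp; last by rewrite addr_ge0.
  have [cpq|ncpq] := boolP (coprime p q); last first.
    rewrite (_ : #|S p| = 0%N) ?addr_ge0//; apply: eq_card0 => n; rewrite inE.
    apply: contraNF ncpq => /and4P[_ _ /eqP h pn].
    have : coprime n q by rewrite /coprime -gcdn_modl h gcdn_modl.
    by apply: coprime_dvdl; apply: dvdn_trans pn; rewrite dvdn_exp.
  have := @card_progression_le R (Num.truncn x).+1 (q * p ^ 2) (S p) 0 x.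
  have -> : (x - 0) / (q * p ^ 2)%:R = x / q%:R * (p%:R ^+ 2)^-1.
    by rewrite natrM natrX subr0 invfM mulrA.
  apply.
  - by rewrite muln_gt0 q0 expn_gt0 prime_gt0.
  - exact: ltW.
  - by move=> n /and4P[_ h _ _]; rewrite h andbT.
  move=> n n' /and4P[_ _ /eqP h d1] /and4P[_ _ /eqP h' d2] le.
  rewrite Gauss_dvd; last by rewrite coprime_sym coprimeXl.
  by rewrite (dvdn_sub d2 d1) andbT -eqn_mod_dvd// h h'.
rewrite big_split /= -mulr_sumr; apply: lerD.
  by rewrite ler_pM2l ?divr_gt0// sum_inv_sq_tail.
rewrite sumr_const ler_nat; apply: leq_trans (max_card _) _.
by rewrite card_ord.
Qed.

Lemma discrepancy_almostPrimeIn_le J q a : (0 < q)%N -> coprime a q -> 2 <= lo ->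
  T%:R * ln x < J%:R ->
  `|discrepancy x (fun n => (almostPrimeIn P lo z s.+1 n)%:R) q a| <=
  \sum_(j < J) `|blockDiscrepancy j q a| +
  (s.+1%:R * (x / (T%:R * q%:R) + 1) +
   (x / q%:R * (2 / lo) + (Num.truncn (Num.sqrt x)).+1%:R)).
Proof.
move=> q0 ca lo2 hJ.
have E : s.+1%:R * discrepancy x (fun n => (almostPrimeIn P lo z s.+1 n)%:R) q a =
   \sum_(j < J) blockDiscrepancy j q a + discrepancy x edgeTerm q a - discrepancy x squareTerm q a.
  under eq_bigr do rewrite -discrepancy_blockConv.
  rewrite /discrepancy exchange_big mulr_sumr -big_split -sumrB /=.
  apply: eq_bigr => n /andP[n0 nx].
  by rewrite mulrA (almostPrimeIn_blocks n0 nx hJ) mulrBl mulrDl mulr_suml.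
set D := discrepancy _ _ _ _ in E *.
(* The multiplicity [s.+1] is at least 1 and is simply given away. *)
have h1 : `|D| <= `|s.+1%:R * D|.
  by rewrite normrM normr_nat ler_peMl// ler1n.
apply: le_trans h1 _; rewrite E.
have e1 : `|discrepancy x edgeTerm q a| <= s.+1%:R * (x / (T%:R * q%:R) + 1).
  apply: discrepancy_le => // [n|c _]; last exact: apSum_edgeTerm_le.
  by apply: sumr_ge0.
have e2 : `|discrepancy x squareTerm q a| <= x / q%:R * (2 / lo) + (Num.truncn (Num.sqrt x)).+1%:R.
  apply: discrepancy_le => // [n|c cc]; last exact: apSum_squareTerm_le.
  by apply: sumr_ge0.
apply: le_trans (ler_normB _ _) _; rewrite addrA; apply: lerD => //.
by apply: le_trans (ler_normD _ _) _; apply: lerD => //; exact: ler_norm_sum.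
Qed.
End Blocks.

(** * The estimate for one block *)

Lemma sum_ord_sub_le (R : numDomainType) (U V : nat) (P P' : pred nat) (F : nat -> R) :
  (forall d, 0 <= F d) -> (forall d, P d -> (d < V)%N && P' d) ->
  \sum_(d < U | P d) F d <= \sum_(d < V | P' d) F d.
Proof.
move=> F0 H.
rewrite (big_ord_widen_cond (maxn U V) P F) ?leq_maxl//.
rewrite [leRHS](big_ord_widen_cond (maxn U V) P' F) ?leq_maxr//.
rewrite big_mkcond [leRHS]big_mkcond /=; apply: ler_sum => d _.
case: ifP => [/andP[/H/andP[-> ->]]//|_]; by case: ifP.
Qed.

Section DyadicBlocks.
Variable R : realType.
Implicit Types (al be : nat -> R) (d e q m n a M Y D Q B : nat).

Definition unitInterval al := forall n, 0 <= al n <= 1.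

Lemma unitInterval_restrict al e : unitInterval al -> unitInterval (restrictCoprime e al).
Proof. by move=> h n; rewrite /restrictCoprime; case: ifP; rewrite ?lexx ?ler01. Qed.

Lemma primitiveBoundW d al M (T T' : R) : T <= T' ->
  primitiveBound d al M T -> primitiveBound d al M T'.
Proof.
move=> le H g g1 g2; apply: le_trans (H g g1 g2) _.
by rewrite ler_wpM2l// sumr_ge0// => y _; exact: sqr_ge0.
Qed.

Lemma unitEnergy_le d al M : unitInterval al ->
  unitEnergy al M d <= d%:R * (2 * M%:R) ^+ 2.
Proof.
move=> h.
have tb (f : R -> R) th : (forall y, `|f y| <= 1) ->
    (\sum_(n < M) al n * f (th * n%:R)) ^+ 2 <= M%:R ^+ 2.
  move=> f1; rewrite -[leLHS](real_normK (num_real _)) ler_pXn2r ?nnegrE//.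
  apply: le_trans (ler_norm_sum _ _ _) _.
  rewrite -[X in _ <= X%:R]card_ord -sumr_const; apply: ler_sum => n _.
  have /andP[h0 h1] := h n.
  by rewrite normrM (ger0_norm h0) mulr_ile1.
rewrite -[X in X%:R * _]card_ord mulr_natl -sumr_const /unitEnergy big_mkcond /=.
apply: ler_sum => k _; case: ifP => _; last exact: sqr_ge0.
rewrite /expEnergy; have t1 := tb _ (2 * pi / d%:R * k%:R) (@cos_max R).
have t2 := tb _ (2 * pi / d%:R * k%:R) (@sin_max R).
rewrite exprMn; apply: le_trans (lerD t1 t2) _.
by have := sqr_ge0 (M%:R : R); nra.
Qed.

(** The product of two bounds of [sum_unitEnergy_block], multiplied out:
    [(M + D^2) * (Y + D^2) / D^2] is [M * Y / D^2 + M + Y + D^2], made uniform in [D0 <= D <= Q].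
    The constant is [32^2]. *)
Definition blockBound (ell : R) M Y D0 Q : R :=
  1024 * ell ^+ 2 * (M%:R * Y%:R) *
    (M%:R * Y%:R / D0%:R ^+ 2 + M%:R + Y%:R + Q%:R ^+ 2).

(** The large sieve up to [2 * D] has the factor [2 * (M + 4 * (2 * D)^2 * h)], which is at most
    [32 * ell * (M + D^2)]. *)
Lemma sum_unitEnergy_block al M D (ell : R) (P : pred nat) U : (0 < D)%N -> unitInterval al ->
  1 <= ell -> harmonicSum R ((2 * D) ^ 2) <= ell ->
  (forall d, P d -> (D <= d < 2 * D)%N) ->
  \sum_(d < U | P d) d%:R^-1 * unitEnergy al M d <=
  32 * ell * (M%:R + D%:R ^+ 2) * M%:R / D%:R.
Proof.
move=> D0 al01 ell1 hell PD; have DR : (0 : R) < D%:R by rewrite ltr0n.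
apply: (@le_trans _ _ (\sum_(d < U | P d) D%:R^-1 * unitEnergy al M d)).
  apply: ler_sum => d /PD /andP[h _]; rewrite ler_wpM2r ?unitEnergy_ge0//.
  by rewrite lef_pV2 ?posrE ?ler_nat// ltr0n (leq_trans D0).
rewrite -mulr_sumr mulrC ler_pM2r ?invr_gt0//.
apply: (@le_trans _ _ (\sum_(d < (2 * D).+1 | (0 < d)%N) unitEnergy al M d)).
  apply: (@sum_ord_sub_le _ U (2 * D).+1 P (fun d => 0 < d)%N (fun d => unitEnergy al M d)).
    by move=> d; exact: unitEnergy_ge0.
  by move=> d /PD /andP[h1 h2]; rewrite ltnW//= (leq_trans D0).
have D20 : (0 < 2 * D)%N by rewrite muln_gt0.
apply: le_trans (large_sieve _ _ D20) _.
have a2 : \sum_(n < M) al n ^+ 2 <= M%:R.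
  rewrite -[X in _ <= X%:R]card_ord -sumr_const; apply: ler_sum => n _.
  by have /andP[h0 h1] := al01 n; rewrite expr2 mulr_ile1.
have h0 := harmonicSum_ge0 R ((2 * D) ^ 2).
apply: ler_pM => //.
- by rewrite mulr_ge0// addr_ge0// mulr_ge0// mulr_ge0.
- by apply: sumr_ge0 => n _; exact: sqr_ge0.
rewrite natrX natrM; set h := harmonicSum _ _ in hell h0 *.
have M0 : (0 : R) <= M%:R by [].
have D2 : (0 : R) <= D%:R ^+ 2 by exact: sqr_ge0.
have e1 : D%:R ^+ 2 * h <= D%:R ^+ 2 * ell by rewrite ler_wpM2l.
have e2 : M%:R <= M%:R * ell :> R by rewrite ler_peMr.
nra.
Qed.

Lemma sum_dyadic_le (F : nat -> R) (P : pred nat) U D0 I (E : R) : (0 < D0)%N ->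
  (forall d, P d -> (D0 <= d < 2 ^ I * D0)%N) ->
  (forall i, (i < I)%N ->
     \sum_(d < U | P d && (2 ^ i * D0 <= d < 2 ^ i.+1 * D0)%N) F d <= E) ->
  \sum_(d < U | P d) F d <= I%:R * E.
Proof.
move=> D00; elim: I P => [|I IH] P HP HE.
  by rewrite big_pred0 ?mul0r// => d; apply/negP => /HP; rewrite expn0 mul1n ltnNge andbN.
rewrite (bigID (fun d : 'I_U => (d < 2 ^ I * D0)%N)) /= -natr1 mulrDl mul1r; apply: lerD.
  apply: (IH (fun d => P d && (d < 2 ^ I * D0)%N)) => [d /andP[/HP/andP[-> _] ->]//|i iI].
  apply: le_trans (HE i (ltnW iI)); rewrite le_eqVlt; apply/predU1P; left.
  apply: eq_bigl => d; case: (P d) => //=; apply/idP/idP => [/andP[_ ->]//|/andP[-> h]].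
  rewrite h !andbT /=; apply: leq_trans h _.
  by rewrite leq_mul2r leq_exp2l// iI orbT.
apply: le_trans (HE I (ltnSn I)); rewrite le_eqVlt; apply/predU1P; left.
apply: eq_bigl => d; rewrite -leqNgt; case Pd: (P d) => //=.
by have /andP[_ ->] := HP _ Pd; rewrite andbT.
Qed.

Lemma sum_bilinear_le al M be Y Q B D0 I (b ell E : R) :
  unitInterval al -> unitInterval be -> (0 < D0)%N -> (Q < 2 ^ I * D0)%N -> 0 <= b ->
  1 <= ell -> (forall n, (n <= 4 * Q ^ 2)%N -> harmonicSum R n <= ell) ->
  0 <= E -> blockBound ell M Y D0 Q <= E ^+ 2 ->
  (forall d e, (1 < d < D0)%N -> (0 < e <= Q)%N -> coprime d B -> exists mu : R,
     forall c, coprime c d ->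
       `|\sum_(n < Y | n == c %[mod d]) restrictCoprime e be n - mu| <= b) ->
  \sum_(q < Q.+1 | (0 < q)%N && coprime q B)
    \big[Num.max/0]_(a < q | coprime a q) `|bilinearDiscrepancy al M be Y q a| <=
  ell ^+ 2 * (2 * M%:R * b * D0%:R ^+ 2 + I%:R * E).
Proof.
move=> al01 be01 D00 QI b0 ell1 hell E0 hE hSW.
pose en f M d : R := d%:R^-1 * unitEnergy f M d.
have en0 f N d : 0 <= en f N d by rewrite mulr_ge0 ?invr_ge0 ?unitEnergy_ge0.
(* For [d < D0] the coefficient [al] gets the trivial bound and the saving comes from [be], whose
   variance is at most [d * b ^+ 2]; this is relaxed to [(d * b) ^+ 2] to avoid a root. *)
pose S d e : R := if (d < D0)%N then 2 * M%:R else Num.sqrt (en (restrictCoprime e al) M d).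
pose T d e : R := if (d < D0)%N then d%:R * b else Num.sqrt (en (restrictCoprime e be) Y d).
have S0 d e : 0 <= S d e by rewrite /S; case: ifP => _; rewrite ?mulr_ge0 ?sqrtr_ge0.
have T0 d e : 0 <= T d e by rewrite /T; case: ifP => _; rewrite ?mulr_ge0 ?sqrtr_ge0.
apply: le_trans (sum_bilinearDiscrepancy_le (S := S) (T := T) S0 T0 _) _.
  move=> d e /andP[d1 dQ] eQ dB; have d0 : (0 < d)%N by exact: ltnW.
  have dR : (0 : R) < d%:R by rewrite ltr0n.
  rewrite /S /T; case: ifPn => dD; last first.
    by rewrite !sqr_sqrtr ?en0//; split; exact: primitiveBound_unitEnergy.
  split.
    apply: primitiveBoundW (primitiveBound_unitEnergy _ _ d0).
    by rewrite ler_pdivrMl// unitEnergy_le//; exact: unitInterval_restrict.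
  have [|mu hmu] := hSW d e _ eQ dB; first by rewrite d1.
  apply: primitiveBoundW (primitiveBound_variance _ _ mu d1).
  apply: (@le_trans _ _ (\sum_(c < d) b ^+ 2)).
    rewrite big_mkcond /=; apply: ler_sum => c _; case: ifP => [cc|_]; last exact: sqr_ge0.
    by rewrite -[leLHS](real_normK (num_real _)) ler_pXn2r ?nnegrE// hmu.
  rewrite sumr_const card_ord -[leLHS]mulr_natl exprMn ler_wpM2r ?sqr_ge0//.
  by rewrite expr2 ler_peMl// ler1n.
have ell0 : 0 <= ell by exact: le_trans ler01 ell1.
have Bb0 : 0 <= 2 * M%:R * b * D0%:R ^+ 2 + I%:R * E.
  by rewrite addr_ge0 ?mulr_ge0// sqr_ge0.
have inner e : (0 < e)%N -> \sum_(d < Q.+1 | (1 < d)%N && coprime d B) S d e * T d e <=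
    2 * M%:R * b * D0%:R ^+ 2 + I%:R * E.
  move=> e0; rewrite (bigID (fun d : 'I_Q.+1 => (d < D0)%N)) /=; apply: lerD.
    apply: (@le_trans _ _ (\sum_(d < D0) 2 * M%:R * b * D0%:R)).
      apply: (@le_trans _ _ (\sum_(d < D0 | predT d) 2 * M%:R * (d%:R * b))).
        rewrite (eq_bigr (fun d : 'I_Q.+1 => 2 * M%:R * (d%:R * b))); last first.
          by move=> d /andP[_ dD]; rewrite /S /T dD.
        apply: (@sum_ord_sub_le _ Q.+1 D0 (fun d => ((1 < d)%N && coprime d B) && (d < D0)%N) predT
          (fun d => 2 * M%:R * (d%:R * b))) => [d|d /andP[_ ->]//].
        by rewrite !mulr_ge0.
      apply: ler_sum => d _; rewrite -!mulrA ler_wpM2l// ler_wpM2l// mulrC ler_wpM2l//.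
      by rewrite ler_nat ltnW.
    by rewrite sumr_const card_ord -[leLHS]mulr_natl expr2; nra.
  rewrite (eq_bigr (fun d : 'I_Q.+1 => Num.sqrt (en (restrictCoprime e al) M d) *
      Num.sqrt (en (restrictCoprime e be) Y d))); last first.
    by move=> d /andP[_ dD]; rewrite /S /T (negPf dD).
  pose P d := [&& (1 < d)%N, coprime d B, ~~ (d < D0)%N & (d <= Q)%N].
  rewrite (eq_bigl (fun d : 'I_Q.+1 => P d)); last first.
    by move=> d; rewrite /P -andbA; have := ltn_ord d; rewrite ltnS => ->; rewrite andbT.
  apply: (sum_dyadic_le (P := P) (F := fun d => Num.sqrt (en (restrictCoprime e al) M d) *
      Num.sqrt (en (restrictCoprime e be) Y d)) D00).
    by move=> d /and4P[_ _ h1 h2]; rewrite leqNgt h1 (leq_ltn_trans h2).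
  move=> i iI; set D := (2 ^ i * D0)%N.
  have Dp : (0 < D)%N by rewrite muln_gt0 expn_gt0.
  have DR : (0 : R) < D%:R by rewrite ltr0n.
  have [DQ|QD] := leqP D Q; last first.
    rewrite big_pred0// => d; apply/negP => /andP[/and4P[_ _ _ h1] /andP[h2 _]].
    by have := leq_trans QD h2; rewrite ltnNge h1.
  set PD := fun d => P d && (D <= d < 2 ^ i.+1 * D0)%N.
  have PDb d : PD d -> (D <= d < 2 * D)%N.
    by case/andP => _; rewrite /D mulnA -expnS.
  have hD : harmonicSum R ((2 * D) ^ 2) <= ell.
    by apply: hell; rewrite expnMn leq_mul2l /= leq_sqr.
  have h1 := sum_unitEnergy_block M Q.+1 Dp (unitInterval_restrict e al01) ell1 hD PDb.
  have h2 := sum_unitEnergy_block Y Q.+1 Dp (unitInterval_restrict e be01) ell1 hD PDb.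
  rewrite -(ler_pXn2r (n := 2)) ?nnegrE//; last first.
    by apply: sumr_ge0 => d _; rewrite mulr_ge0 ?sqrtr_ge0.
  apply: le_trans (CauchySchwarz_sum _ _ _ _) _.
  under eq_bigr do rewrite sqr_sqrtr ?en0//.
  under [X in _ * X]eq_bigr do rewrite sqr_sqrtr ?en0//.
  apply: le_trans hE; rewrite /blockBound.
  have D0R : (0 : R) < D0%:R by rewrite ltr0n.
  have dd : M%:R * Y%:R / D%:R ^+ 2 <= M%:R * Y%:R / D0%:R ^+ 2 :> R.
    rewrite ler_wpM2l ?mulr_ge0// lef_pV2 ?posrE ?exprn_gt0//.
    by rewrite ler_pXn2r ?nnegrE// ler_nat leq_pmull// expn_gt0.
  have dq : D%:R ^+ 2 <= Q%:R ^+ 2 :> R by rewrite ler_pXn2r ?nnegrE// ler_nat.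
  apply: (@le_trans _ _ ((32 * ell * (M%:R + D%:R ^+ 2) * M%:R / D%:R) *
      (32 * ell * (Y%:R + D%:R ^+ 2) * Y%:R / D%:R))).
    by apply: ler_pM => //; apply: sumr_ge0 => d _; exact: en0.
  have -> : (32 * ell * (M%:R + D%:R ^+ 2) * M%:R / D%:R) *
      (32 * ell * (Y%:R + D%:R ^+ 2) * Y%:R / D%:R) =
    1024 * ell ^+ 2 * (M%:R * Y%:R) * (M%:R * Y%:R / D%:R ^+ 2 + M%:R + Y%:R + D%:R ^+ 2).
    by field; rewrite gt_eqF.
  apply: ler_wpM2l.
    apply: mulr_ge0; last exact: mulr_ge0 (ler0n _ _) (ler0n _ _).
    exact: mulr_ge0 (ler0n _ _) (sqr_ge0 _).
  by apply: lerD dq; rewrite !lerD2r.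
apply: (@le_trans _ _ (\sum_(e < Q.+1 | (0 < e)%N) (totient e)%:R^-1 *
    (2 * M%:R * b * D0%:R ^+ 2 + I%:R * E))).
  by apply: ler_sum => e e0; rewrite ler_wpM2l ?invr_ge0// inner.
rewrite -mulr_suml ler_wpM2r//; apply: le_trans (sum_inv_totient_le _ _) _.
rewrite ler_pXn2r ?nnegrE ?harmonicSum_ge0//; apply: hell.
by rewrite -mulnn; nia.
Qed.
End DyadicBlocks.

(** * Siegel-Walfisz in short intervals *)

Lemma expR_half_le2 (R : realType) : expR (2^-1) <= 2 :> R.
Proof.
have h : 2^-1 <= expR (- 2^-1) :> R.
  by apply: le_trans (expR_ge1Dx _); lra.
by rewrite -[expR _]invrK -expRN invf_ple ?posrE ?expR_gt0.
Qed.

(** An integer with [k] prime factors is at least [2^k >= exp(k/2)]. *)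
Lemma size_primes_ln (R : realType) (e : nat) : (0 < e)%N ->
  (size (primes e))%:R <= 2 * ln (e%:R : R).
Proof.
move=> e0; have eR : (0 : R) < e%:R by rewrite ltr0n.
have h : (2 ^ size (primes e) <= e)%N.
  rewrite [leqRHS](prod_prime_decomp e0) prime_decompE big_map /=.
  have -> : (2 ^ size (primes e) = \prod_(p <- primes e) 2)%N.
    by rewrite big_const_seq count_predT iter_muln_1.
  rewrite big_seq [leqRHS]big_seq; apply: leq_prod => p pe.
  have [pp _ _] : [/\ prime p, (0 < e)%N & (p %| e)%N].
    by move: pe; rewrite mem_primes => /and3P.
  apply: leq_trans (prime_gt1 pp) _.
  by rewrite -{1}(expn1 p) leq_exp2l ?prime_gt1// logn_gt0.
have : expR (2^-1 * (size (primes e))%:R) <= e%:R :> R.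
  rewrite mulrC expRM_natl; apply: (@le_trans _ _ (2 ^+ size (primes e))).
    by apply: lerXn2r; rewrite ?nnegrE ?expR_ge0 ?expR_half_le2.
  by rewrite -natrX ler_nat.
rewrite -{1}[e%:R](lnK (_ : e%:R \in Num.pos)) ?posrE// ler_expR; lra.
Qed.

Lemma sum_ord_cond_support (V : nmodType) (U W : nat) (Q : pred nat) (F : nat -> V) :
  (forall n, Q n -> (n < U)%N && (n < W)%N) ->
  \sum_(n < U | Q n) F n = \sum_(n < W | Q n) F n.
Proof.
move=> H; rewrite big_mkcond [RHS]big_mkcond /=.
apply: (sum_ord_support (F := fun n => if Q n then F n else 0)) => n h; case: ifP => // /H.
  by rewrite ltnNge h.
by rewrite [(n < W)%N]ltnNge h andbF.
Qed.

Section SiegelWalfiszBlocks.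
Variables (R : realType) (P : set nat).
Hypothesis hP : forall p, p \in P -> prime p.
Implicit Types (d e c n : nat).

(** Siegel-Walfisz at the two ends costs [2 * C * w * y], the end points themselves at most 1, and
    the primes dividing [e] at most [2 * ln Q]. The number [w] stands for a bound of the inverse
    power of [ln t] valid for all [t >= lo]. *)
Lemma primeIn_count_le (lo hi : R) (y : R) (Y d c e B Q : nat) (C w : R) : 0 <= C -> 0 <= w ->
  (forall t, lo <= t -> forall d c, (0 < d)%N -> coprime d B -> coprime c d ->
     `|primeCountAP P t d c - primeCount P t / (totient d)%:R| <= C * (t * w)) ->
  hi <= y -> y < Y%:R -> 0 <= y -> (0 < d)%N -> coprime d B -> (0 < e <= Q)%N ->
  lo <= hi -> coprime c d ->
  `|\sum_(n < Y | n == c %[mod d]) restrictCoprime e (fun p => (primeIn P lo hi p)%:R) n -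
      (primeCount P hi - primeCount P lo) / (totient d)%:R| <=
  2 * C * w * y + 1 + 2 * ln (Q%:R : R).
Proof.
move=> C0 w0 hSW hy yY y0 d0 dB /andP[e0 eQ] lohi cd.
pose cnt (t : R) : R := \sum_(n < Y | [&& n%:R < t,  (n : nat) \in P & n == c %[mod d]]) 1.
(* [primeCountAP] counts [p <= t], whereas [primeIn] excludes its upper end; the two counts differ
   by the possible prime [p = t]. *)
have ap t : t <= hi -> 0 <= primeCountAP P t d c - cnt t <= 1.
  move=> th; rewrite /primeCountAP big_mkord.
  rewrite (@sum_ord_cond_support _ _ Y (fun p => [&& p%:R <= t, p \in P & p == c %[mod d]])
    (fun=> 1)); last first.
    move=> n /and3P[nt _ _]; apply/andP; split.
      by rewrite ltnS truncn_ge_nat// (le_trans _ nt).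
    by rewrite -(ltr_nat R); apply: le_lt_trans nt _; apply: le_lt_trans th _; exact: le_lt_trans yY.
  have -> : \sum_(n < Y | [&& n%:R <= t,  (n : nat) \in P & n == c %[mod d]]) 1 - cnt t =
      \sum_(n < Y | [&& n%:R == t,  (n : nat) \in P & n == c %[mod d]]) (1 : R).
    apply/eqP; rewrite subr_eq; apply/eqP.
    rewrite /cnt big_mkcond [X in _ = X + _]big_mkcond [X in _ = _ + X]big_mkcond -big_split /=.
    apply: eq_bigr => n _; rewrite le_eqVlt.
    have [->|ne] := eqVneq n%:R t; first by rewrite ltxx /= addr0.
    by rewrite /= add0r.
  rewrite sumr_ge0//=; have [k /and3P[/eqP kt _ _]|none] :=
      pickP [pred n : 'I_Y | [&& n%:R == t,  (n : nat) \in P & n == c %[mod d]]].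
    rewrite -[leRHS](big_pred1_eq +%R k (fun=> 1)) [leRHS]big_mkcond [leLHS]big_mkcond /=.
    apply: ler_sum => n _; case: ifP => [/and3P[/eqP nt _ _]|_]; last by case: ifP.
    by rewrite ifT//; apply/eqP/val_inj/eqP; rewrite -(eqr_nat R) nt kt.
  by rewrite big_pred0.
have bE : \sum_(n < Y | n == c %[mod d]) (primeIn P lo hi n)%:R = cnt hi - cnt lo.
  apply/eqP; rewrite eq_sym subr_eq; apply/eqP.
  rewrite /cnt big_mkcond [X in _ = X + _]big_mkcond [X in _ = _ + X]big_mkcond -big_split /=.
  apply: eq_bigr => n _; rewrite /primeIn.
  case: (n == c %[mod d]); rewrite ?andbF ?addr0//= !andbT.
  case: ((n : nat) \in P); rewrite ?andbF ?addr0//= !andbT.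
  have [h1|h1] := ltP n%:R lo; first by rewrite (lt_le_trans h1 lohi) add0r.
  by rewrite addr0; case: ifP.
have h1 := ap _ (lexx hi); have h2 := ap _ lohi.
have s1 := hSW hi lohi d c d0 dB cd; have s2 := hSW lo (lexx lo) d c d0 dB cd.
have m1 : C * (hi * w) <= C * (y * w) by rewrite ler_wpM2l// ler_wpM2r.
have m2 : C * (lo * w) <= C * (y * w).
  by rewrite ler_wpM2l// ler_wpM2r// (le_trans lohi).
have r0 : 0 <= \sum_(n < Y | n == c %[mod d]) (((primeIn P lo hi n)%:R : R) -
     restrictCoprime e (fun p => (primeIn P lo hi p)%:R : R) n) <= 2 * ln (Q%:R : R).
  apply/andP; split.
    by apply: sumr_ge0 => n _; rewrite /restrictCoprime; case: ifP; rewrite ?subrr ?subr0.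
  apply: (@le_trans _ _ (size (primes e))%:R); last first.
    apply: le_trans (size_primes_ln R e0) _.
    by rewrite ler_pM2l// ler_ln ?posrE ?ltr0n ?(leq_trans e0)// ler_nat.
  have -> : (size (primes e))%:R = \sum_(p <- primes e) (1 : R).
    by rewrite big_const_seq count_predT iter_addr_0.
  rewrite (@sum_seq_ord _ _ e.+1) ?primes_uniq//; last first.
    by move=> p; rewrite mem_primes => /and3P[_ _ /(dvdn_leq e0)].
  apply: (@le_trans _ _ (\sum_(n < Y | (n : nat) \in primes e) 1)).
    rewrite big_mkcond [leRHS]big_mkcond /=; apply: ler_sum => n _.
    case: ifP => _; last by case: ifP.
    rewrite /restrictCoprime; case: ifPn => ne; first by rewrite subrr; case: ifP.
    rewrite subr0; case pI: (primeIn _ _ _ _) => /=; last by case: ifP.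
    have pp : prime n by case/and3P: pI => /hP.
    by rewrite mem_primes pp e0 -[(n %| e)%N]negbK -prime_coprime// ne.
  apply: (@sum_ord_sub_le _ Y e.+1 (fun n => n \in primes e) (fun n => n \in primes e) (fun=> 1)) => // n ne.
  by rewrite ne andbT ltnS; move: ne; rewrite mem_primes => /and3P[_ _ /(dvdn_leq e0)].
rewrite sumrB bE in r0.
move: h1 h2 r0 s1 s2 m1 m2; rewrite mulrBl !ler_norml => /andP[? ?] /andP[? ?] /andP[? ?] /andP[? ?] /andP[? ?] ? ?.
by apply/andP; split; lra.
Qed.

Lemma blockPrime_count_le (lo z : R) (T j B Q : nat) (C w : R) : 0 <= C -> 0 <= w ->
  (forall t, lo <= t -> forall d c, (0 < d)%N -> coprime d B -> coprime c d ->
     `|primeCountAP P t d c - primeCount P t / (totient d)%:R| <= C * (t * w)) ->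
  (0 < Q)%N -> forall d e, (0 < d)%N -> (0 < e <= Q)%N -> coprime d B ->
  exists mu : R, forall c, coprime c d ->
  `|\sum_(n < (Num.truncn (blockHi R T j)).+1 | n == c %[mod d])
      restrictCoprime e (blockPrime P lo z T j) n - mu| <=
  2 * C * w * blockHi R T j + 1 + 2 * ln (Q%:R : R).
Proof.
move=> C0 w0 hSW Q0 d e d0 eQ dB.
have hi0 : 0 < blockHi R T j by exact: expR_gt0.
set lo' := Num.max lo (blockLo R T j); set hi' := Num.min z (blockHi R T j).
have [le|lt] := leP lo' hi'.
  exists ((primeCount P hi' - primeCount P lo') / (totient d)%:R) => c cd.
  apply: (primeIn_count_le (B := B)) => //.
  - by move=> t ht; apply: hSW; apply: le_trans ht; rewrite le_max lexx.
  - by rewrite ge_min lexx orbT.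
  - by have /andP[] := truncn_itv (ltW hi0).
  - exact: ltW.
exists 0 => c cd; rewrite subr0 big1 ?normr0; last first.
  move=> n _; rewrite /restrictCoprime; case: ifP => // _; rewrite /blockPrime.
  case: (boolP (primeIn _ _ _ _)) => // /and3P[_ h1 h2].
  by have := le_lt_trans h1 h2; rewrite ltNge (ltW lt).
by rewrite !addr_ge0 ?mulr_ge0 ?(ltW hi0)// ln_ge0// ler1n.
Qed.
End SiegelWalfiszBlocks.

(** * Summing over the blocks *)

Lemma truncnS_le_double (R : realType) (t : R) : 1 <= t -> (Num.truncn t).+1%:R <= 2 * t.
Proof.
move=> t1; have t0 : 0 <= t by exact: le_trans ler01 t1.
by rewrite -natr1; have /andP[h _] := truncn_itv t0; lra.
Qed.

Section Assembly.
Variables (R : realType) (P : set nat) (B : nat).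
Hypothesis hP : forall p, p \in P -> prime p.

Lemma bilinearDiscrepancy_eq0 (al be : nat -> R) M Y q a :
  (forall m n, al m * be n = 0) -> bilinearDiscrepancy al M be Y q a = 0.
Proof.
by move=> h; rewrite /bilinearDiscrepancy big1// => m _; rewrite big1// => n _; rewrite h mul0r.
Qed.

(** A block contains no prime if [hi <= lo], and no cofactor if [x / hi <= lo], because a cofactor
    has [s + 1 >= 1] prime factors, each at least [lo]. Otherwise [M] and [Y] are at most
    [2 * x / lo] and their product at most [4 * x], which explains [4 * x / lo] and
    [4096 = 4 * 1024]. *)
Lemma sum_block_le (x lo z : R) (s T j Q D0 I : nat) (C w ell E K1 : R) :
  1 <= x -> 2 <= lo -> 0 <= C -> 0 <= w -> (0 < Q)%N -> (0 < D0)%N -> (Q < 2 ^ I * D0)%N ->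
  (forall t, lo <= t -> forall d c, (0 < d)%N -> coprime d B -> coprime c d ->
     `|primeCountAP P t d c - primeCount P t / (totient d)%:R| <= C * (t * w)) ->
  1 <= ell -> (forall n, (n <= 4 * Q ^ 2)%N -> harmonicSum R n <= ell) ->
  0 <= E -> 4096 * ell ^+ 2 * x * (4 * x / D0%:R ^+ 2 + 4 * x / lo + Q%:R ^+ 2) <= E ^+ 2 ->
  4 * C * w * x + 2 * x / lo * (1 + 2 * ln Q%:R) <= K1 ->
  \sum_(q < Q.+1 | (0 < q)%N && coprime q B)
    \big[Num.max/0]_(a < q | coprime a q) `|blockDiscrepancy P x lo z s.+1 T j q a| <=
  ell ^+ 2 * (2 * K1 * D0%:R ^+ 2 + I%:R * E).
Proof.
move=> x1 lo2 C0 w0 Q0 D00 QI hSW ell1 hell E0 hE hK1.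
have x0 : 0 < x by exact: lt_le_trans ltr01 x1.
have lo0 : 0 < lo by exact: lt_le_trans lo2.
have hi0 : 0 < blockHi R T j by exact: expR_gt0.
have hi1 : 1 <= blockHi R T j by exact: blockLo_ge1.
have lnQ0 : 0 <= ln (Q%:R : R) by rewrite ln_ge0// ler1n.
set hi := blockHi R T j in hi0 hi1 *.
have K10 : 0 <= K1.
  apply: le_trans hK1; apply: addr_ge0; first by rewrite !mulr_ge0// ltW.
  apply: mulr_ge0; last by lra.
  by rewrite divr_ge0 ?mulr_ge0// ltW.
have rhs0 : 0 <= ell ^+ 2 * (2 * K1 * D0%:R ^+ 2 + I%:R * E).
  by rewrite mulr_ge0 ?sqr_ge0// addr_ge0// ?mulr_ge0// sqr_ge0.
have [trivial|big] := boolP ((x / hi <= lo) || (hi <= lo)).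
  rewrite big1// => q _; apply/le_anti/andP; split.
    apply: bigmax_le => // a _; rewrite /blockDiscrepancy bilinearDiscrepancy_eq0 ?normr0//.
    move=> m p; apply/eqP; rewrite mulf_eq0; case/orP: trivial => h; apply/orP.
      left; rewrite /blockCofactor; case: (boolP (_ && _)); rewrite ?eqxx// => /andP[/almostPrimeIn_ge h1 h2].
      have : m%:R * hi < lo * hi by apply: lt_le_trans h2 _; rewrite -ler_pdivrMr.
      by rewrite ltr_pM2r// ltNge h1.
    right; rewrite /blockPrime; case: (boolP (primeIn _ _ _ _)); rewrite ?eqxx// => /and3P[_].
    rewrite ge_max lt_min => /andP[h1 _] /andP[_ h2].
    by have := lt_le_trans (le_lt_trans h1 h2) h; rewrite ltxx.
  by apply: (big_ind (fun v => 0 <= v)) => // u v hu hv; rewrite le_max hu.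
move: big; rewrite negb_or -!ltNge => /andP[xh hlo].
have xhi1 : 1 <= x / hi.
  by apply: ltW; apply: lt_trans xh; apply: lt_le_trans lo2; rewrite ltr1n.
have xhi0 : 0 < x / hi by exact: lt_le_trans ltr01 xhi1.
set M := (Num.truncn (x / hi)).+1; set Y := (Num.truncn hi).+1.
have M2 : M%:R <= 2 * (x / hi) by exact: truncnS_le_double.
have Y2 : Y%:R <= 2 * hi by exact: truncnS_le_double.
have M0 : 0 <= M%:R :> R by [].
have Y0 : 0 <= Y%:R :> R by [].
have hix : x / hi * hi = x by rewrite divfK// gt_eqF.
have MY : M%:R * Y%:R <= 4 * x :> R.
  apply: (@le_trans _ _ (2 * (x / hi) * (2 * hi))); first exact: ler_pM.
  by rewrite -[in leRHS]hix le_eqVlt; apply/predU1P; left; ring.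
have xhlo : x / hi <= x / lo by rewrite ler_pM2l// lef_pV2 ?posrE// ltW.
have hxlo : hi <= x / lo.
  by rewrite ler_pdivlMr// mulrC -ler_pdivlMr// ltW.
have b0 : 0 <= 2 * C * w * hi + 1 + 2 * ln (Q%:R : R).
  by rewrite !addr_ge0 ?mulr_ge0// ltW.
apply: le_trans (sum_bilinear_le (D0 := D0) (I := I) (b := 2 * C * w * hi + 1 + 2 * ln Q%:R)
   (ell := ell) (E := E) _ _ D00 QI b0 ell1 hell E0 _ _) _.
- by move=> n; rewrite /blockCofactor ler0n (ler_nat _ _ 1) leq_b1.
- by move=> n; rewrite /blockPrime ler0n (ler_nat _ _ 1) leq_b1.
- apply: le_trans hE; rewrite /blockBound.
  have -> : 4096 * ell ^+ 2 * x * (4 * x / D0%:R ^+ 2 + 4 * x / lo + Q%:R ^+ 2) =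
    1024 * ell ^+ 2 * (4 * x) * (4 * x / D0%:R ^+ 2 + 4 * x / lo + Q%:R ^+ 2) by ring.
  have c0 : 0 <= 1024 * ell ^+ 2 by exact: mulr_ge0 (ler0n _ _) (sqr_ge0 _).
  have i0 : 0 <= M%:R * Y%:R / D0%:R ^+ 2 + M%:R + Y%:R + Q%:R ^+ 2 :> R.
    by rewrite !addr_ge0 ?sqr_ge0// divr_ge0 ?mulr_ge0// sqr_ge0.
  move: (1024 * ell ^+ 2) c0 => c c0.
  apply: ler_pM => //; first exact: mulr_ge0 c0 (mulr_ge0 M0 Y0).
    by rewrite ler_wpM2l.
  rewrite lerD2r -addrA; apply: lerD.
    by rewrite ler_wpM2r// invr_ge0 sqr_ge0.
  have -> : 4 * x / lo = 2 * (x / lo) + 2 * (x / lo) by field; rewrite gt_eqF.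
  rewrite -/hi -/M -/Y; apply: lerD; [apply: le_trans M2 _|apply: le_trans Y2 _];
    by rewrite ler_wpM2l.
- move=> d e /andP[d1 _] eQ dB.
  exact: (@blockPrime_count_le R P hP lo z T j B Q C w C0 w0 hSW Q0 d e (ltnW d1) eQ dB).
rewrite ler_wpM2l ?sqr_ge0// lerD2r ler_wpM2r ?sqr_ge0// -mulrA ler_wpM2l//.
apply: le_trans hK1.
apply: (@le_trans _ _ (2 * (x / hi) * (2 * C * w * hi + 1 + 2 * ln Q%:R))).
  by rewrite ler_wpM2r.
rewrite -[2 * C * w * hi + 1 + _]addrA mulrDr; apply: lerD.
  rewrite -[X in _ <= 4 * C * w * X]hix le_eqVlt; apply/predU1P; left; ring.
rewrite ler_wpM2r ?addr_ge0 ?mulr_ge0//.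
by rewrite -mulrA ler_wpM2l.
Qed.

Lemma sum_discrepancy_le (x lo z : R) (s T J Q D0 I : nat) (C w ell E K1 : R) :
  (0 < T)%N -> T%:R * ln x < J%:R ->
  1 <= x -> 2 <= lo -> 0 <= C -> 0 <= w -> (0 < Q)%N -> (0 < D0)%N -> (Q < 2 ^ I * D0)%N ->
  (forall t, lo <= t -> forall d c, (0 < d)%N -> coprime d B -> coprime c d ->
     `|primeCountAP P t d c - primeCount P t / (totient d)%:R| <= C * (t * w)) ->
  1 <= ell -> (forall n, (n <= 4 * Q ^ 2)%N -> harmonicSum R n <= ell) ->
  0 <= E -> 4096 * ell ^+ 2 * x * (4 * x / D0%:R ^+ 2 + 4 * x / lo + Q%:R ^+ 2) <= E ^+ 2 ->
  4 * C * w * x + 2 * x / lo * (1 + 2 * ln Q%:R) <= K1 ->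
  \sum_(q < Q.+1 | (0 < q)%N && coprime q B)
    \big[Num.max/0]_(a < q | coprime a q)
      `|discrepancy x (fun n => (almostPrimeIn P lo z s.+2 n)%:R) q a| <=
  J%:R * (ell ^+ 2 * (2 * K1 * D0%:R ^+ 2 + I%:R * E)) +
  (s.+2%:R * (x * ell / T%:R + Q%:R) + (2 * x * ell / lo + Q%:R * (Num.sqrt x + 1))).
Proof.
move=> T0 hJ x1 lo2 C0 w0 Q0 D00 QI hSW ell1 hell E0 hE hK1.
have x0 : 0 < x by exact: lt_le_trans ltr01 x1.
have lo0 : 0 < lo by exact: lt_le_trans lo2.
have TR : (0 : R) < T%:R by rewrite ltr0n.
pose W (q : nat) : R := s.+2%:R * (x / (T%:R * q%:R) + 1) +
   (x / q%:R * (2 / lo) + (Num.sqrt x + 1)).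
have W0 (q : nat) : 0 <= W q.
  have i0 : 0 <= x / q%:R by rewrite divr_ge0// ltW.
  have i1 : 0 <= x / (T%:R * q%:R) by rewrite divr_ge0 ?mulr_ge0// ltW.
  by rewrite /W !addr_ge0 ?mulr_ge0 ?addr_ge0 ?sqrtr_ge0 ?invr_ge0// ltW.
pose mx j (q : nat) : R := \big[Num.max/0]_(a < q | coprime a q) `|blockDiscrepancy P x lo z s.+1 T j q a|.
have mx0 j q : 0 <= mx j q.
  by apply: (big_ind (fun v => 0 <= v)) => // u v hu hv; rewrite le_max hu.
apply: (@le_trans _ _ (\sum_(q < Q.+1 | (0 < q)%N && coprime q B) (\sum_(j < J) mx j q + W q))).
  apply: ler_sum => q /andP[q0 qB]; apply: bigmax_le => [|a ca].
    by rewrite addr_ge0// sumr_ge0.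
  apply: le_trans (discrepancy_almostPrimeIn_le hP z s.+1 T0 x1 q0 ca lo2 hJ) _.
  apply: lerD.
    by apply: ler_sum => j _; rewrite /mx (le_bigmax_cond _ _ ca).
  rewrite /W lerD2l lerD2l -natr1 lerD2r.
  by have /andP[] := truncn_itv (sqrtr_ge0 x).
rewrite big_split /=; apply: lerD.
  rewrite exchange_big /=.
  apply: (@le_trans _ _ (\sum_(j < J) (ell ^+ 2 * (2 * K1 * D0%:R ^+ 2 + I%:R * E)))).
    by apply: ler_sum => j _; exact: (@sum_block_le x lo z s T j Q D0 I C w ell E K1).
  by rewrite sumr_const card_ord [leRHS]mulr_natl.
apply: (@le_trans _ _ (\sum_(q < Q.+1 | (0 < q)%N) W q)).
  by rewrite big_mkcondr /=; apply: ler_sum => q _; case: ifP.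
have hQ : harmonicSum R Q <= ell.
  by apply: hell; apply: leq_trans (leq_pmull _ (ltn0Sn 3)); rewrite -mulnn leq_pmulr.
have hE' : harmonicSum R Q = \sum_(q < Q.+1 | (0 < q)%N) q%:R^-1.
  by rewrite big_mkcond big_ord_recl /= add0r.
have one : \sum_(q < Q.+1 | (0 < q)%N) (1 : R) = Q%:R.
  by rewrite big_mkcond big_ord_recl /= add0r sumr_const card_ord.
have -> : \sum_(q < Q.+1 | (0 < q)%N) W q =
    \sum_(q < Q.+1 | (0 < q)%N) ((s.+2%:R * x / T%:R + 2 * x / lo) * q%:R^-1 +
       (s.+2%:R + (Num.sqrt x + 1)) * 1).
  apply: eq_bigr => q q0; rewrite /W; field.
  by rewrite !gt_eqF// ltr0n.
rewrite big_split /= -!mulr_sumr one -hE'.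
have c0 : 0 <= s.+2%:R * x / T%:R + 2 * x / lo by rewrite addr_ge0 ?divr_ge0 ?mulr_ge0// ltW.
apply: (@le_trans _ _ ((s.+2%:R * x / T%:R + 2 * x / lo) * ell + (s.+2%:R + (Num.sqrt x + 1)) * Q%:R)).
  by rewrite lerD2r ler_wpM2l.
by rewrite le_eqVlt; apply/predU1P; left; field; rewrite !gt_eqF.
Qed.
End Assembly.

(** * Choice of the parameters *)

Section Asymptotics.
Variable R : realType.
Implicit Types (x tau : R).

(** The term of degree [n + 1] of the exponential series at [tau * ln x] has one logarithm to spare,
    which absorbs the constant. *)
Lemma ln_pow_le_powR (n : nat) tau : 0 < tau ->
  exists2 L0 : R, 0 <= L0 & forall x, L0 <= ln x -> 0 < x -> ln x ^+ n <= x `^ tau.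
Proof.
move=> t0; have tp : 0 < tau ^+ n.+1 by rewrite exprn_gt0.
exists (n.+1`!%:R / tau ^+ n.+1) => [|x]; first by rewrite divr_ge0// ltW.
rewrite ler_pdivrMr// => h x0.
have f0 : (0 : R) < n.+1`!%:R by rewrite ltr0n fact_gt0.
have L0 : 0 <= ln x.
  by rewrite -(pmulr_lge0 _ tp); apply: le_trans h.
rewrite /powR gt_eqF//.
have tL : 0 <= tau * ln x by rewrite mulr_ge0// ltW.
apply: le_trans (expR_ge1Dxn n tL).
apply: (@le_trans _ _ ((tau * ln x) ^+ n.+1 / n.+1`!%:R)); last by rewrite lerDr.
rewrite ler_pdivlMr// [leRHS](_ : _ = ln x ^+ n * (ln x * tau ^+ n.+1)); last first.
  by rewrite exprMn [ln x ^+ n.+1]exprSr; ring.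
by rewrite ler_wpM2l// exprn_ge0.
Qed.

Lemma harmonicSum_le_ln (n : nat) : harmonicSum R n.+1 <= 1 + ln (n.+1%:R : R).
Proof.
elim: n => [|n IH].
  by rewrite /harmonicSum big_ord1 invr1 ln1 addr0.
rewrite /harmonicSum big_ord_recr /=.
have h1 : (0 : R) < n.+1%:R by [].
have h2 : (0 : R) < n.+2%:R by [].
have : ln (1 + - (n.+2%:R)^-1) <= - (n.+2%:R)^-1 :> R.
  by apply: le_ln1Dx; rewrite ltrN2 invf_lt1// ltr1n.
have -> : 1 + - (n.+2%:R)^-1 = n.+1%:R / n.+2%:R :> R.
  by rewrite -[n.+1%:R](addrK 1) natr1 mulrBl mulfV ?gt_eqF// mul1r.
rewrite ln_div ?posrE// => h3.
move: h3 IH; rewrite -/(harmonicSum R n.+1).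
move: (ln _) (ln _) (n.+2%:R^-1) (harmonicSum _ _) => u v i h; lra.
Qed.

Variables (P : set nat) (B : nat).
Hypothesis hP : forall p, p \in P -> prime p.

(* Parameters, with [L = ln x] and [G = L ^ k]: the moduli below [D0 ~ G^2 L^6]
   are left to Siegel-Walfisz with exponent [6 k + 18], and the primes are cut
   into [J ~ G L^2] blocks of relative length [1 / T ~ 1 / (G L)]. *)
Lemma sum_discrepancy_asymp (x lo z c C L G : R) (s k : nat) : 0 < c -> 0 <= C ->
  L = ln x -> G = L ^+ k -> 1 <= L -> 0 < x -> 2 <= lo -> ln lo = c * L ->
  (forall t, lo <= t -> forall d a, (0 < d)%N -> coprime d B -> coprime a d ->
     `|primeCountAP P t d a - primeCount P t / (totient d)%:R| <=
       C * (t / ln t ^+ (6 * k + 18))) ->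
  G ^+ 6 * L ^+ 19 <= lo ->
  forall Q : nat, Q%:R ^+ 2 * (G ^+ 4 * L ^+ 12) <= x ->
  \sum_(q < Q.+1 | (0 < q)%N && coprime q B)
    \big[Num.max/0]_(a < q | coprime a q)
      `|discrepancy x (fun n => (almostPrimeIn P lo z s.+2 n)%:R) q a| <=
  (48 * (8 * (4 * C * c ^- (6 * k + 18) + 6) + 2304) + 5 * s.+2%:R + 10) * (x / G).
Proof.
move=> c0 C0 LE GE L1 x0 lo2 lnlo hSW hlo Q hQ.
have L0 : 0 < L by exact: lt_le_trans ltr01 L1.
have G1 : 1 <= G by rewrite GE exprn_ege1.
have G0 : 0 < G by exact: lt_le_trans ltr01 G1.
have xG0 : 0 < x / G by rewrite divr_gt0.
set cA := c ^- (6 * k + 18); have cA0 : 0 <= cA by rewrite invr_ge0 exprn_ge0// ltW.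
set C1 := 4 * C * cA + 6; have C10 : 0 <= C1 by rewrite addr_ge0// !mulr_ge0.
have rhs0 : 0 <= (48 * (8 * C1 + 2304) + 5 * s.+2%:R + 10) * (x / G).
  apply: mulr_ge0; last exact: ltW.
  have : (0 : R) <= s.+2%:R by []. lra.
have [Q0|Q0] := posnP Q.
  rewrite big_pred0// => q; rewrite Q0 in q *; by case: q => [[|m]].
have QR : (1 : R) <= Q%:R by rewrite ler1n.
have x1 : 1 <= x.
  have : expR 0 <= expR L by rewrite ler_expR ltW.
  by rewrite expR0 LE lnK// posrE.
pose T := (Num.truncn (G * L)).+1; pose J := (Num.truncn (T%:R * L)).+1.
(* [I] is chosen so that [2 ^ I >= exp (I / 2) >= exp L = x >= Q]. *)
pose D0 := (Num.truncn (G ^+ 2 * L ^+ 6)).+1; pose I := (Num.truncn (2 * L)).+1.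
have GL1 : 1 <= G * L by rewrite mulr_ege1.
have GL0 : 0 <= G * L by exact: le_trans ler01 GL1.
have T1 : G * L < T%:R by have /andP[] := truncn_itv GL0.
have T2 : T%:R <= 2 * (G * L).
  exact: truncnS_le_double.
have TL0 : 0 <= T%:R * L by rewrite mulr_ge0// ltW.
have J1 : T%:R * L < J%:R by have /andP[] := truncn_itv TL0.
have J2 : J%:R <= 3 * (G * L ^+ 2).
  rewrite /J -natr1; have /andP[h _] := truncn_itv TL0.
  clear -h T2 G1 L1 L0; have h1 : T%:R * L <= 2 * (G * L) * L by rewrite ler_wpM2r// ltW.
  have h2 : 1 <= G * L ^+ 2 by rewrite mulr_ege1// exprn_ege1.
  have h3 : 2 * (G * L) * L = 2 * (G * L ^+ 2) by ring.
  lra.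
set DL := G ^+ 2 * L ^+ 6.
have DL1 : 1 <= DL by rewrite mulr_ege1// exprn_ege1.
have DL0 : 0 < DL by exact: lt_le_trans ltr01 DL1.
have D1 : DL < D0%:R by have /andP[] := truncn_itv (ltW DL0).
have D2 : D0%:R <= 2 * DL.
  exact: truncnS_le_double.
have L20 : 0 <= 2 * L by rewrite mulr_ge0// ltW.
have I1 : 2 * L < I%:R by have /andP[] := truncn_itv L20.
have I2 : I%:R <= 3 * L.
  by rewrite /I -natr1; have /andP[h _] := truncn_itv L20; lra.
have G4L12 : 1 <= G ^+ 4 * L ^+ 12 by rewrite mulr_ege1// exprn_ege1.
have Q2x : Q%:R ^+ 2 <= x.
  by apply: le_trans hQ; rewrite ler_peMr// sqr_ge0.
have Qx : Q%:R <= x by apply: le_trans Q2x; rewrite expr2 ler_peMr.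
have lnQ : ln (Q%:R : R) <= L by rewrite LE ler_ln ?posrE// ltr0n.
have D00 : (0 < D0)%N by [].
have QI : (Q < 2 ^ I * D0)%N.
  rewrite -(ltr_nat R) natrM natrX.
  have h1 : x <= 2 ^+ I.
    have -> : x = expR L by rewrite LE lnK.
    apply: (@le_trans _ _ (expR (2^-1 * I%:R))); first by rewrite ler_expR; lra.
    rewrite mulrC expRM_natl; apply: lerXn2r; rewrite ?nnegrE ?expR_ge0 ?expR_half_le2//.
  have h2 : 1 < D0%:R :> R by exact: le_lt_trans DL1 D1.
  apply: le_lt_trans Qx _; apply: le_lt_trans h1 _.
  by rewrite ltr_pMr// exprn_gt0.
have lo0 : 0 < lo by exact: lt_le_trans lo2.
have lnlo0 : 0 < ln lo by rewrite lnlo mulr_gt0.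
pose w := (ln lo ^+ (6 * k + 18))^-1.
have w0 : 0 <= w by rewrite invr_ge0 exprn_ge0// ltW.
have LA : L ^+ (6 * k + 18) = G ^+ 6 * L ^+ 18.
  by rewrite GE -exprM -exprD mulnC.
have wE : w = cA / (G ^+ 6 * L ^+ 18).
  by rewrite /w lnlo exprMn LA invfM.
clearbody cA.
have hSW' t : lo <= t -> forall d a, (0 < d)%N -> coprime d B -> coprime a d ->
     `|primeCountAP P t d a - primeCount P t / (totient d)%:R| <= C * (t * w).
  move=> lot d a d0 dB ad; apply: le_trans (hSW t lot d a d0 dB ad) _.
  have t0 : 0 < t by exact: lt_le_trans lot.
  rewrite ler_wpM2l// ler_pM2l// lef_pV2 ?posrE ?exprn_gt0//; last first.
    by apply: lt_le_trans lnlo0 _; rewrite ler_ln.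
  apply: lerXn2r; rewrite ?nnegrE ?(ltW lnlo0)//.
    by apply: le_trans (ltW lnlo0) _; rewrite ler_ln.
  by rewrite ler_ln.
(* [4 * L] dominates [1 + ln (4 * x)], as [ln 2 <= 1] and [L >= 1]. *)
have ell1 : 1 <= 4 * L by lra.
have hell n : (n <= 4 * Q ^ 2)%N -> harmonicSum R n <= 4 * L.
  case: n => [_|n nQ]; first by rewrite /harmonicSum big_ord0 mulr_ge0// ltW.
  apply: le_trans (harmonicSum_le_ln n) _.
  have n0 : (0 : R) < n.+1%:R by [].
  have nx : n.+1%:R <= 2 ^+ 2 * x :> R.
    apply: (@le_trans _ _ (4 * Q ^ 2)%N%:R); first by rewrite ler_nat.
    have -> : 2 ^+ 2 * x = 4 * x by ring.
    by rewrite natrM natrX; exact: ler_wpM2l.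
  have : ln (n.+1%:R : R) <= ln (2 ^+ 2 * x) by rewrite ler_ln ?posrE ?mulr_gt0.
  rewrite lnM ?posrE// lnXn// -LE => h.
  have ln2 : ln 2 <= 1 :> R.
    by have := @le_ln1Dx R 1; rewrite (_ : 1 + 1 = 2 :> R)//; apply; lra.
  by rewrite mulr2n in h; lra.
(* [768^2 = 4096 * 16 * 9]: each term of the bracket is compared with [x / DL ^+ 2], in the
   proportions [4 + 4 + 1]. *)
set E := 768 * x * L / DL.
have E0 : 0 <= E.
  apply: divr_ge0; last exact: ltW.
  by apply: mulr_ge0; [apply: mulr_ge0; [exact: ler0n|exact: ltW]|exact: ltW].
have DL2 : DL ^+ 2 = G ^+ 4 * L ^+ 12 by rewrite /DL; ring.
have hE : 4096 * (4 * L) ^+ 2 * x * (4 * x / D0%:R ^+ 2 + 4 * x / lo + Q%:R ^+ 2) <= E ^+ 2.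
  have -> : E ^+ 2 = 4096 * (4 * L) ^+ 2 * x * (4 * x / DL ^+ 2 + 4 * x / DL ^+ 2 + x / DL ^+ 2).
    by rewrite /E; field; rewrite !gt_eqF.
  have c1 : 0 <= 4096 * (4 * L) ^+ 2 * x.
    by apply: mulr_ge0; [apply: mulr_ge0; [exact: ler0n|exact: sqr_ge0]|exact: ltW].
  apply: (ler_wpM2l c1).
  have DL20 : 0 < DL ^+ 2 by rewrite exprn_gt0.
  apply: lerD; last by rewrite ler_pdivlMr// DL2.
  apply: lerD; rewrite ler_pM2l ?mulr_gt0// lef_pV2 ?posrE ?exprn_gt0// ?(lt_trans DL0)//.
    by apply: lerXn2r; rewrite ?nnegrE ?(ltW DL0) ?(ltW D1).
  apply: le_trans hlo; rewrite DL2.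
  apply: ler_pM; rewrite ?exprn_ge0 ?(ltW G0) ?(ltW L0)//; exact: ler_weXn2l.
(* The part [4 * C * cA] of [C1] comes from Siegel-Walfisz, as
   [L ^+ (6 * k + 18) = G ^+ 6 * L ^+ 18]. The part 6 comes from [1 + 2 * ln Q <= 3 * L], whose
   factor [L] is paid by the 19th power in [hlo]. *)
set K1 := C1 * x / (G ^+ 6 * L ^+ 18).
have GL18 : 0 < G ^+ 6 * L ^+ 18 by rewrite mulr_gt0// exprn_gt0.
have hK1 : 4 * C * w * x + 2 * x / lo * (1 + 2 * ln Q%:R) <= K1.
  have -> : K1 = 4 * C * w * x + 6 * x / (G ^+ 6 * L ^+ 18).
    by rewrite /K1 /C1 wE; field; rewrite !gt_eqF.
  rewrite lerD2l.
  apply: (@le_trans _ _ (2 * x / lo * (3 * L))).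
    by apply: ler_wpM2l; [rewrite divr_ge0// ?mulr_ge0// ltW|lra].
  have -> : 2 * x / lo * (3 * L) = 6 * x * (L / lo) by field; rewrite !gt_eqF.
  rewrite -mulrA [leRHS]mulrC [leRHS]mulrC -mulrA.
  apply: ler_wpM2l => //; apply: ler_wpM2l; first exact: ltW.
  rewrite ler_pdivrMr// ler_pdivlMl//.
  by apply: le_trans hlo; rewrite [L ^+ 19]exprSr mulrA.
have JT : T%:R * ln x < J%:R by rewrite -LE.
have TS : (0 < T)%N by [].
apply: le_trans (sum_discrepancy_le hP z s TS JT x1 lo2 C0 w0 Q0 D00 QI hSW' ell1 hell E0 hE hK1) _.
have -> : (48 * (8 * C1 + 2304) + 5 * s.+2%:R + 10) * (x / G) =
   48 * (8 * C1 + 2304) * (x / G) +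
   (s.+2%:R * (4 * (x / G) + x / G) + (8 * (x / G) + 2 * (x / G))) by ring.
have QxG : Q%:R * Num.sqrt x <= x / G.
  rewrite -(ler_pXn2r (n := 2)) ?nnegrE ?(ltW xG0)//.
  rewrite exprMn sqr_sqrtr ?(ltW x0)// exprMn [x ^+ 2]expr2 mulrC -mulrA ler_pM2l//.
  rewrite exprVn ler_pdivlMr ?exprn_gt0//; apply: le_trans hQ.
  rewrite ler_wpM2l ?sqr_ge0// -[leLHS]mulr1.
  apply: ler_pM; rewrite ?exprn_ge0 ?(ltW G0) ?exprn_ege1//; exact: ler_weXn2l.
have sx1 : 1 <= Num.sqrt x by rewrite -[leLHS]sqrtr1; exact: ler_wsqrtr.
have QG : Q%:R <= x / G by apply: le_trans QxG; rewrite ler_peMr.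
apply: lerD.
  have K10 : 0 <= K1.
    by apply: divr_ge0; [apply: mulr_ge0 => //; exact: ltW|exact: ltW].
  have t1 : 2 * K1 * D0%:R ^+ 2 <= 2 * K1 * (2 * DL) ^+ 2.
    apply: ler_wpM2l; first exact: mulr_ge0.
    by apply: lerXn2r; rewrite ?nnegrE// mulr_ge0// ltW.
  have t2 : I%:R * E <= 3 * L * E by rewrite ler_wpM2r.
  have t3 : 0 <= 2 * K1 * D0%:R ^+ 2 + I%:R * E.
    by apply: addr_ge0; [rewrite mulr_ge0 ?sqr_ge0// mulr_ge0|rewrite mulr_ge0].
  (* The factor [J * ell ^+ 2] costs [G * L ^+ 4]. The large-sieve term is of size
     [x * L ^+ 2 / DL], so [DL = G ^+ 2 * L ^+ 6] is exactly enough; the Siegel-Walfisz term keeps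
     [L ^- 2]. *)
  apply: (@le_trans _ _ (3 * (G * L ^+ 2) * ((4 * L) ^+ 2 * (2 * K1 * (2 * DL) ^+ 2 + 3 * L * E)))).
    apply: ler_pM => //; first by rewrite mulr_ge0// sqr_ge0.
    by apply: ler_wpM2l; [exact: sqr_ge0|exact: lerD].
  have -> : 3 * (G * L ^+ 2) * ((4 * L) ^+ 2 * (2 * K1 * (2 * DL) ^+ 2 + 3 * L * E)) =
      48 * (8 * C1) * (x / G) * L ^- 2 + 48 * 2304 * (x / G).
    by rewrite /K1 /E /DL; field; rewrite !gt_eqF.
  rewrite [48 * (8 * C1 + 2304)]mulrDr mulrDl lerD2r.
  have c48 : 0 <= 48 * (8 * C1) * (x / G).
    apply: mulr_ge0; last exact: ltW.
    by apply: mulr_ge0; [exact: ler0n|apply: mulr_ge0 => //; exact: ler0n].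
  by rewrite ler_piMr// invf_le1 ?exprn_gt0// exprn_ege1.
apply: lerD.
  apply: ler_wpM2l => //; apply: lerD => //.
  rewrite ler_pdivrMr ?(lt_trans _ T1) ?mulr_gt0//.
  have -> : x * (4 * L) = 4 * (x / G) * (G * L) by field; rewrite !gt_eqF.
  by apply: ler_wpM2l; [rewrite mulr_ge0// ltW|exact: ltW].
apply: lerD.
  rewrite ler_pdivrMr//.
  have -> : 2 * x * (4 * L) = 8 * (x / G) * (G * L) by field; rewrite !gt_eqF.
  apply: ler_wpM2l; first by apply: mulr_ge0; [exact: ler0n|exact: ltW].
  apply: le_trans hlo; apply: ler_pM; rewrite ?(ltW G0) ?(ltW L0)//.
    by rewrite -{1}[G]expr1; exact: ler_weXn2l.
  by rewrite -{1}[L]expr1; exact: ler_weXn2l.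
by rewrite mulrDr mulr1 [leRHS](_ : _ = x / G + x / G); [exact: lerD|ring].
Qed.
End Asymptotics.

(** * The theorem *)

Lemma primes_prod_sorted (s : seq nat) : all prime s -> sorted ltn s ->
  primes (\prod_(p <- s) p) = s.
Proof.
move=> sp ss; apply: (irr_sorted_eq ltn_trans ltnn (sorted_primes _) ss).
elim: s sp {ss} => [|p s IH] /=; first by rewrite big_nil.
move=> /andP[pp sp] q; rewrite big_cons.
have s0 : (0 < \prod_(l <- s) l)%N.
  rewrite big_seq; apply: (big_ind (fun m => 0 < m)%N) => // [m m' m0 m'0|l /(allP sp)/prime_gt0//].
  by rewrite muln_gt0 m0.
rewrite primesM ?(prime_gt0 pp)//.
by rewrite primes_prime// !inE IH.
Qed.

Lemma sorted_ltn_le_last (s : seq nat) (p : nat) : sorted ltn s -> p \in s ->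
  (p <= last 0 s)%N.
Proof.
elim/last_ind: s => // s x _; rewrite (sorted_pairwise ltn_trans) pairwise_rcons last_rcons.
move=> /andP[h _]; rewrite mem_rcons inE => /predU1P[->//|/(allP h)].
exact: ltnW.
Qed.

Section Final.
Variable R : realType.

(** The largest prime is below [N^(1/2)] exactly when all are. For [n < x] every prime factor is
    below [x], so both indicators have the same shape and differ only in the upper end of the
    interval. *)
Lemma beta_almostPrimeIn (P : set nat) (r : nat) (eta N x : R) (n : nat) :
  (forall p, p \in P -> prime p) -> (0 < r)%N -> (0 < n)%N -> n%:R < x ->
  beta P r eta N n = (almostPrimeIn P (N `^ eta) x r n)%:R -
    (almostPrimeIn P (N `^ eta) (N `^ (1 / 2)) r n)%:R.
Proof.
move=> hP r0 n0 nx; rewrite /beta indicE.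
have sub : almostPrimeIn P (N `^ eta) (N `^ (1 / 2)) r n ->
    almostPrimeIn P (N `^ eta) x r n.
  case/and4P => _ h1 h2 h3; apply/and4P; split=> //.
  apply/allP => p pn; have /and3P[h4 h5 _] := allP h3 p pn.
  apply/and3P; split=> //; apply: le_lt_trans nx; rewrite ler_nat.
  by move: pn; rewrite mem_primes => /and3P[_ _ /(dvdn_leq n0)].
suff -> : n \in almostPrimes P r eta N =
    almostPrimeIn P (N `^ eta) x r n && ~~ almostPrimeIn P (N `^ eta) (N `^ (1 / 2)) r n.
  move: sub; case: (almostPrimeIn P (N `^ eta) (N `^ (1 / 2)) r n); case: almostPrimeIn => //= h.
  - by rewrite subrr.
  - by have := h isT.
  - by rewrite subr0.
  - by rewrite subr0.
apply/idP/idP => [|/andP[/and4P[_ /eqP sz /eqP nE all1] nall]].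
  rewrite inE => -[p [pP psort phead plast pn]].
  have pr : all prime p.
    by apply/allP => q /tnthP[i ->]; apply: hP; rewrite inE; exact: pP.
  have nE : n = (\prod_(q <- p) q)%N by rewrite pn big_tuple.
  have prE : primes n = p by rewrite nE primes_prod_sorted.
  have rp : (0 < size p)%N by rewrite size_tuple.
  have lastp : last 0%N p \in (p : seq nat).
    by case: (tval p) rp => // q l _; rewrite /= mem_last.
  apply/andP; split; last first.
    apply/negP => /and4P[_ _ _]; rewrite prE => /allP /(_ _ lastp) /and3P[_ _].
    by rewrite ltNge plast.
  apply/and4P; split=> //; rewrite prE ?size_tuple//; first exact/eqP.
  apply/allP => q qp; apply/and3P; split.
  - by case/tnthP: qp => i ->; rewrite inE; exact: pP.
  - apply: le_trans phead _; rewrite ler_nat.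
    case: (tval p) psort qp => //= h l hl; rewrite inE => /predU1P[->//|ql].
    by apply: ltnW; exact: (allP (order_path_min ltn_trans hl)).
  apply: le_lt_trans nx; rewrite ler_nat dvdn_leq//.
  have : q \in primes n by rewrite prE.
  by rewrite mem_primes => /and3P[].
have szr : size (primes n) == r by apply/eqP.
have mp (i : 'I_r) : tnth (Tuple szr) i \in primes n by exact: mem_tnth.
rewrite inE; exists (Tuple szr); split.
- by move=> i; have /and3P[] := allP all1 _ (mp i); rewrite inE.
- exact: sorted_primes.
- have hin : head 0%N (primes n) \in primes n.
    by move: r0; rewrite -sz; case: (primes n) => // h l _; rewrite inE eqxx.
  by have /and3P[] := allP all1 _ hin.
- rewrite leNgt; apply: contra nall => lt; apply/and4P; split=> //; first exact/eqP.
  apply/allP => q qn; have /and3P[h1 h2 _] := allP all1 _ qn.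
  apply/and3P; split=> //; apply: le_lt_trans lt; rewrite ler_nat.
  by apply: sorted_ltn_le_last => //; exact: sorted_primes.
by rewrite {1}nE -(big_tuple _ _ (Tuple szr) xpredT (fun q => q)).
Qed.

(** Uniformity in [z] matters: the result is applied with [z = x] and with [z = N^(1/2)]. *)
Lemma sum_discrepancy_near (P : set nat) (B : nat) (c eps : R) (s k : nat) :
  (forall p, p \in P -> prime p) -> @siegelWalfisz R P B -> 0 < c -> 0 < eps ->
  exists C X0 : R, [/\ 0 <= C, 1 <= X0 & forall x z, X0 < x ->
    \sum_(q < (Num.truncn (x `^ (1 / 2 - eps))).+1 | (0 < q)%N && coprime q B)
      \big[Num.max/0]_(a < q | coprime a q)
        `|discrepancy x (fun n => (almostPrimeIn P (x `^ c) z s.+2 n)%:R) q a| <=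
    C * (x / ln x ^+ k)].
Proof.
move=> hP hSW c0 eps0.
have A0 : 0 < (6 * k + 18)%N%:R :> R by rewrite ltr0n addnC.
have [C1 [M [_ hM]]] := hSW _ A0.
have [L1 L10 hL1] := ln_pow_le_powR (6 * k + 19) c0.
have eps20 : 0 < 2 * eps by rewrite mulr_gt0.
have [L2 L20 hL2] := ln_pow_le_powR (4 * k + 12) eps20.
(* Siegel-Walfisz provides a constant of unknown sign. *)
pose C := Num.max C1 0; have C0 : 0 <= C by rewrite le_max lexx orbT.
(* [L1] yields [G^6 * L^19 <= x^c]; [L2] yields [G^4 * L^12 <= x^(2 * eps)], the room left by [Q^2];
   the last summand puts [x^c] above 2 and above the threshold [M] of Siegel-Walfisz. *)
pose L3 : R := 1 + L1 + L2 + (`|M| + 2) / c.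
have M0 : 0 <= `|M| := normr_ge0 M.
have Mc0 : 0 <= (`|M| + 2) / c by rewrite divr_ge0 ?addr_ge0// ltW.
have L31 : 1 <= L3 by rewrite /L3 -!addrA lerDl !addr_ge0.
pose K := 48 * (8 * (4 * C * c ^- (6 * k + 18) + 6) + 2304) + 5 * s.+2%:R + 10 : R.
exists K, (expR L3); split.
- have h : 0 <= 4 * C * c ^- (6 * k + 18) by rewrite !mulr_ge0// invr_ge0 exprn_ge0// ltW.
  have h2 : 0 <= s.+2%:R :> R by [].
  by rewrite /K; move: (4 * C * c ^- (6 * k + 18)) (s.+2%:R : R) h h2 => u v hu hv; lra.
- by rewrite -expR0 ler_expR (le_trans ler01).
move=> x z hx.
have x0 : 0 < x by apply: lt_trans hx; exact: expR_gt0.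
have Lx : L3 <= ln x by rewrite -ler_expR lnK ?posrE// ltW.
have Lx1 : 1 <= ln x by exact: le_trans Lx.
have lnlo : ln (x `^ c) = c * ln x by rewrite ln_powR.
have loE : x `^ c = expR (c * ln x) by rewrite /powR gt_eqF.
have lo2 : `|M| + 2 < x `^ c.
  rewrite loE; apply: (@lt_le_trans _ _ (1 + c * ln x)); last exact: expR_ge1Dx.
  have : (`|M| + 2) / c <= ln x.
    by apply: le_trans Lx; rewrite /L3 lerDr !addr_ge0.
  by rewrite ler_pdivrMr// mulrC => h; apply: le_lt_trans h _; rewrite ltrDr.
apply: (sum_discrepancy_asymp hP z s c0 C0 erefl erefl Lx1 x0 _ lnlo).
- by apply: le_trans (ltW lo2); rewrite lerDr.
- move=> t lot d a d0 dB ad.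
  have Mt : M < t.
    by apply: lt_le_trans lot; apply: le_lt_trans lo2; rewrite (le_trans (ler_norm M))// lerDl.
  have t1 : 1 <= t.
    apply: le_trans lot; apply: le_trans (ltW lo2).
    by apply: (@le_trans _ _ 2); [rewrite ler1n|rewrite lerDr].
  apply: le_trans (hM t Mt d a d0 dB ad) _.
  rewrite powR_mulrn ?ln_ge0//; apply: ler_wpM2r; last by rewrite le_max lexx.
  by rewrite divr_ge0 ?exprn_ge0 ?ln_ge0// (le_trans ler01).
- rewrite -exprM -exprD; apply: le_trans (hL1 x _ x0).
    by rewrite mulnC.
  apply: le_trans Lx; move: L10 L20 Mc0; rewrite /L3; move: ((`|M| + 2) / c) => m.
  by move=> ? ? ?; lra.
set Q := Num.truncn _; have Q1 : Q%:R <= x `^ (1 / 2 - eps).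
  by have /andP[] := truncn_itv (powR_ge0 x (1 / 2 - eps)).
have h : ln x ^+ (4 * k + 12) <= x `^ (2 * eps).
  apply: hL2 => //; apply: le_trans Lx.
  move: L10 L20 Mc0; rewrite /L3; move: ((`|M| + 2) / c) => m.
  by move=> ? ? ?; lra.
rewrite -exprM -exprD mulnC.
apply: (@le_trans _ _ ((x `^ (1 / 2 - eps)) ^+ 2 * x `^ (2 * eps))).
  apply: ler_pM => //; rewrite ?sqr_ge0// ?exprn_ge0 ?(le_trans ler01)//.
  by apply: lerXn2r; rewrite ?nnegrE ?powR_ge0.
rewrite -powR_mulrn ?powR_ge0// -powRrM -powRD; last by apply/implyP => _; rewrite gt_eqF.
have -> : (1 / 2 - eps) * 2 + 2 * eps = 1 by field.
by rewrite powRr1// ltW.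
Qed.
End Final.

Local Open Scope classical_set_scope.
Local Open Scope ring_scope.

Theorem theorem2p4 (R : realType) (P : set nat) (delta : R) (B : nat)
    (theta1 : R) (r : nat) (eta eps : R)
    (hP : P `<=` [set p | prime p])
    (hdelta : 0 < delta) (hdens : hasPrimeDensity P delta)
    (hB0 : (0 < B)%N) (hB : squarefree B) (hSW : @siegelWalfisz R P B)
    (htheta1 : 0 < theta1) (hlevel : levelOfDistribution P B theta1)
    (hr : (2 <= r)%N) (heta0 : 0 < eta) (heta1 : eta < r%:R^-1)
    (heps : 0 < eps) :
  exists C : R -> R -> R, forall u A : R, 0 < A ->
    \forall N \near +oo_R,
      \sum_(1 <= q < (Num.truncn (N `^ (u * (1 / 2 - eps)))).+1
          | (q%:R <= N `^ (u * (1 / 2 - eps))) && coprime q B)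
        \big[Num.max/0]_(a < q | coprime a q)
          `|\sum_(1 <= n < (Num.truncn (N `^ u)).+1 | n%:R < N `^ u)
              ((totient q)%:R^-1 * betaCoprime P r eta N n q
               - betaAP P r eta N n q a)|
      <= C u A * (N `^ u / ln N `^ A).
Proof.
have hPm p : p \in P -> prime p by rewrite inE => /hP.
(* The constant is found for each pair [u], [A] before [0 < A] is known, so that [cid] can turn the
   choice into a function. *)
suff H (u A : R) : exists C : R, 0 < A -> \forall N \near +oo_R,
      \sum_(1 <= q < (Num.truncn (N `^ (u * (1 / 2 - eps)))).+1
          | (q%:R <= N `^ (u * (1 / 2 - eps))) && coprime q B)
        \big[Num.max/0]_(a < q | coprime a q)
          `|\sum_(1 <= n < (Num.truncn (N `^ u)).+1 | n%:R < N `^ u)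
              ((totient q)%:R^-1 * betaCoprime P r eta N n q
               - betaAP P r eta N n q a)|
      <= C * (N `^ u / ln N `^ A).
  exists (fun u A => projT1 (cid (H u A))) => u A A0.
  exact: (projT2 (cid (H u A)) A0).
(* For [u <= 0] and [N > 1] no [n >= 1] lies below [N^u], so the left side is zero. *)
have [u0|u0] := leP u 0.
  exists 1 => _; exists 1; split=> // N N1.
  rewrite [leRHS]mul1r big1 ?divr_ge0 ?powR_ge0// => q _.
  apply/le_anti/andP; split; last first.
    by apply: (big_ind (fun v => 0 <= v)) => // v w hv hw; rewrite le_max hv.
  apply: bigmax_le => // a _; rewrite big_nat_cond big_pred0 ?normr0// => n.
  apply/negP => /andP[/andP[n1 _] nN].
  have : N `^ u <= 1 by rewrite -(powRr0 N); apply: ler_powR => //; exact: ltW.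
  by move=> /(lt_le_trans nN); rewrite ltNge ler1n n1.
(* In terms of [x = N^u] the lower bound [N^eta] for the primes is [x^(eta / u)]. *)
have c0 : 0 < eta / u by rewrite divr_gt0.
pose k := (Num.truncn A).+1; pose s := (r - 2)%N.
have rE : r = s.+2 by rewrite /s -addn2 subnK.
have [C [X0 [C0 X1 hC]]] := sum_discrepancy_near s k hPm hSW c0 heps.
(* The 2 counts the two indicators composing [beta], and [u ^+ k] comes from [ln x = u * ln N]. *)
exists (2 * C / u ^+ k) => A0.
exists (Num.max (X0 `^ u^-1) (expR 1)); split; first by rewrite num_real.
move=> N; rewrite gt_max => /andP[NX Ne].
have N0 : 0 < N by apply: lt_trans Ne; exact: expR_gt0.
have lnN1 : 1 <= ln N by rewrite -ler_expR lnK ?posrE// ltW.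
set x := N `^ u.
have Xx : X0 < x.
  rewrite /x -[X0]powRr1 ?(le_trans ler01)// -(mulVf (lt0r_neq0 u0)) powRrM.
  by apply: gt0_ltr_powR; rewrite ?nnegrE ?powR_ge0// ltW.
have x0 : 0 < x by rewrite powR_gt0.
have loE : N `^ eta = x `^ (eta / u).
  by rewrite /x -powRrM mulrC divfK// gt_eqF.
have QE : N `^ (u * (1 / 2 - eps)) = x `^ (1 / 2 - eps) by rewrite powRrM.
have inner q a : \sum_(1 <= n < (Num.truncn x).+1 | n%:R < x)
              ((totient q)%:R^-1 * betaCoprime P r eta N n q - betaAP P r eta N n q a) =
    discrepancy x (fun n => (almostPrimeIn P (x `^ (eta / u)) x s.+2 n)%:R) q a -
    discrepancy x (fun n => (almostPrimeIn P (x `^ (eta / u)) (N `^ (1 / 2)) s.+2 n)%:R) q a.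
  rewrite /discrepancy -sumrB big_geq_mkord; apply: eq_big => [n|n /andP[nx n0]].
    by rewrite andbC.
  rewrite -loE -rE -mulrBl -(beta_almostPrimeIn eta N hPm (ltnW hr) n0 nx).
  rewrite /betaCoprime /betaAP /apWeight mulrBr.
  by case: ifP => _; case: ifP => _; rewrite ?mulr0 ?mulr1 // mulrC.
have main z := hC x z Xx.
have -> : 2 * C / u ^+ k * (x / ln N `^ A) = (C * (u ^- k * (x / ln N `^ A))) + (C * (u ^- k * (x / ln N `^ A))).
  by ring.
have step : x / ln x ^+ k <= u ^- k * (x / ln N `^ A).
  rewrite /x ln_powR exprMn invfM mulrCA ler_wpM2l ?invr_ge0 ?exprn_ge0 ?(ltW u0)//.
  rewrite ler_pM2l// lef_pV2 ?posrE ?exprn_gt0 ?powR_gt0 ?(lt_le_trans ltr01)//.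
  rewrite -powR_mulrn ?(le_trans ler01)//; apply: ler_powR => //.
  by have /andP[_ /ltW] := truncn_itv (ltW A0).
apply: (@le_trans _ _ (C * (x / ln x ^+ k) + C * (x / ln x ^+ k))); last first.
  by apply: lerD; rewrite ler_wpM2l.
apply: le_trans (lerD (main x) (main (N `^ (1 / 2)))).
rewrite QE big_geq_mkord -big_split /=.
rewrite big_mkcond [leRHS]big_mkcond /=; apply: ler_sum => q _.
have mx0 (f : 'I_q -> R) : 0 <= \big[Num.max/0]_(a < q | coprime a q) `|f a|.
  by apply: (big_ind (fun v => 0 <= v)) => // v w hv hw; rewrite le_max hv.
case: ifP => [/andP[/andP[_ qB] q1]|_]; last first.
  by case: ifP => // _; apply: addr_ge0; exact: mx0.
rewrite q1 qB /=; apply: bigmax_le => [|a ca]; first by apply: addr_ge0; exact: mx0.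
rewrite inner; apply: le_trans (ler_normB _ _) _.
by apply: lerD; exact: (le_bigmax_cond _ (fun a : 'I_q => `|discrepancy x _ q a|) ca).
Qed.
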